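(* Assume the following. (i) The parameter $\theta$ belongs to a compact set. (ii) $m(Z,\theta)$ is a concave function of $\theta$ with a unique and finite maximum, and $E\{m^2(Z,\theta)\}<\infty$ for any $\theta$. (iii) The matrix $-E\{\ddot m(Z,\theta)\}$ is positive-definite, $E\{\ddot m_{k,l}^2(Z,\theta)\}<\infty$, and there exists a function $\psi(z)$ with $E\{\psi^2(Z)\}<\infty$ such that for every $\theta_1,\theta_2$, $|\ddot m_{k,l}(z,\theta_1)-\ddot m_{k,l}(z,\theta_2)|\le\psi(z)\|\theta_1-\theta_2\|$ for $k,l=1,\dots,d$. (iv) The matrix $\Lambda(\theta)=E\{\dot m(Z,\theta)\dot m^{T}(Z,\theta)\}$ is positive-definite, and for $\theta$ in the neighborhood of $\hat\theta_n$, $\frac1n\sum_{i=1}^n\|\dot m(Z_i,\theta)\|^4=O_P(1)$. (v) $\max_{i=1,\dots,n}(n\pi_{n,i})^{-1}=O_P(1)$. Then, as $s_n\to\infty$ and $n\to\infty$, the subsampling-with-replacement estimator $\tilde\theta_{s_n,R}$ satisfies $$\sqrt{s_n}\,\{V_{n,R}(\hat\theta_n)\}^{-1/2}(\tilde\theta_{s_n,R}-\hat\theta_n)\ \longrightarrow\ N(0,I_d)$$ in conditional distribution given $\mathcal D_n$ in probability, where $V_{n,R}(\theta)=\ddot M_n^{-1}(\theta)\Lambda_{n,R}(\theta)\ddot M_n^{-1}(\theta)$, $$\ddot M_n(\theta)=\frac1n\sum_{i=1}^n\ddot m(Z_i,\theta),\qquad \Lambda_{n,R}(\theta)=\frac1{n^2}\sum_{i=1}^n\frac{\dot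 m(Z_i,\theta)\dot m^{T}(Z_i,\theta)}{\pi_{n,i}}.$$
   Context: The full data $\mathcal D_n=\{Z_i\}_{i=1}^n$ are independent observations from the distribution of $Z$; $\theta\in\mathbb R^d$ is a parameter; $m(Z,\theta)$ is a real-valued function; $\dot m$ and $\ddot m$ are the gradient and Hessian of $m$ with respect to $\theta$, with $\ddot m_{k,l}$ the $(k,l)$ entry. The full data estimator $\hat\theta_n$ is the maximizer of $M_n(\theta)=\frac1n\sum_{i=1}^n m(Z_i,\theta)$. $\|\cdot\|$ is the Euclidean norm for vectors and the Frobenius norm for matrices. A subsampling distribution is $\{\pi_{n,i}\}_{i=1}^n$ with $\pi_{n,i}>0$, $\sum_{i=1}^n\pi_{n,i}=1$; it may depend on $\mathcal D_n$. Subsample size $s_n<n$ (but $s_n=o(n)$ is not required). Subsampling with replacement: conditionally on $\mathcal D_n$, draw $s_n$ indices independently from $\{1,\dots,n\}$ with probabilities $\{\pi_{n,i}\}$; let $Z_1^*,\dots,Z_{s_n}^*$ be the selected data points and $\pi_{n,1}^*,\dots,\pi_{n,s_n}^*$ the corresponding probabilities. The estimator is $\tilde\theta_{s_n,R}=\arg\max_\theta\sum_{i=1}^{s_n}\frac{m(Z_i^*,\theta)}{n s_n\pi_{n,i}^*}$. Convergence in conditional distribution: a $d$-dimensional $\Delta_{n,s_n}$ converges in conditional distribution to a continuous random vector $U$ given $\mathcal D_n$ in probability if, for every $x\in\mathbb R^d$, $\Pr(\Delta_{n,s_n}\le x\mid\mathcal D_n)-\Pr(U\le x)=o_P(1)$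 as $s_n,n\to\infty$.
   Formalization: The unique maximum in (ii) is taken for E m(Z,θ), and its maximizer is additionally assumed to be an interior point of the compact parameter set; without this the claim fails, e.g. m=-(θ-Z)²/2, Z~N(0,1), θ in [0,1]. *)

(* Defs.v *)
(* MathComp + MathComp-Analysis. *)
From HB Require Import structures.
From mathcomp Require Import all_boot all_order all_algebra.
From mathcomp Require Import all_classical all_reals all_analysis.
Import Order.TTheory GRing.Theory Num.Theory.
Import numFieldNormedType.Exports.

Set Implicit Arguments.
Unset Strict Implicit.
Unset Printing Implicit Defensive.

Local Open Scope classical_set_scope.
Local Open Scope ring_scope.

(* Vectors of R^d are rows. The norm `|x| carried by matrices is the sup norm;
   enorm is the Euclidean one. *)
Definition enorm (R : realType) (d : nat) (x : 'rV[R]_d) : R :=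
  Num.sqrt (\sum_(j < d) x 0 j ^+ 2).

Definition gradient (R : realType) (d : nat) (f : 'rV[R]_d -> R)
    (t : 'rV[R]_d) : 'rV[R]_d :=
  \row_k 'D_(delta_mx 0 k : 'rV[R]_d) f t.

Definition hessian (R : realType) (d : nat) (f : 'rV[R]_d -> R)
    (t : 'rV[R]_d) : 'M[R]_d :=
  \matrix_(k, l) 'D_(delta_mx 0 l : 'rV[R]_d)
                   (fun u => 'D_(delta_mx 0 k : 'rV[R]_d) f u) t.

Definition twice_differentiable_at (R : realType) (d : nat)
    (f : 'rV[R]_d -> R) (t : 'rV[R]_d) : Prop :=
  (\forall u \near t, differentiable f u) /\ differentiable (gradient f) t.

Definition concave (R : realType) (d : nat) (f : 'rV[R]_d -> R) : Prop :=
  convex_function [set: 'rV[R]_d] (fun t => - f t).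

Definition is_argmax (R : realType) (d : nat) (Theta : set 'rV[R]_d)
    (f : 'rV[R]_d -> R) (t : 'rV[R]_d) : Prop :=
  Theta t /\ forall u, Theta u -> f u <= f t.

Definition posdefmx (R : realType) (d : nat) (A : 'M[R]_d) : Prop :=
  A^T = A /\ forall u : 'rV[R]_d, u != 0 -> 0 < (u *m A *m u^T) 0 0.

(* A^(-1/2), the positive-definite B with B^2 = A^-1; it exists and is unique
   when A is positive-definite, and the junk value 0 is used when there is
   none. *)
Definition invsqrtmx (R : realType) (d : nat) (A : 'M[R]_d) : 'M[R]_d :=
  xget 0 [set B | posdefmx B /\ B *m B *m A = 1%:M].

(* Pr(U <= x) for U ~ N(0, I_d), whose coordinates are independent N(0, 1). *)
Definition std_normal_cdf (R : realType) (d : nat) (x : 'rV[R]_d) : R :=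
  \prod_(j < d) fine (normal_prob 0 1 `]-oo, x 0 j]).

Section probability_notions.
Context (dT dS : measure_display) (T : measurableType dT)
  (S : measurableType dS) (R : realType).

Definition mutually_independent (P : probability T R)
    (Z : nat -> {mfun T >-> S}) : Prop :=
  forall (n : nat) (A : nat -> set S), (forall i, measurable (A i)) ->
    P (\bigcap_(i < n) (Z i @^-1` A i)) =
    (\prod_(i < n) P (Z i @^-1` A i))%E.

Definition iid (P : probability T R) (Z : nat -> {mfun T >-> S})
    (Q : probability S R) : Prop :=
  mutually_independent P Z /\
  forall i (A : set S), measurable A -> distribution P (Z i) A = Q A.

Definition square_integrable (Q : probability S R) (f : S -> R) : Prop :=
  ('E_Q[(fun z => f z ^+ 2)%R] < +oo)%E.

Definition mx_expectation (d : nat) (Q : probability S R)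
    (F : S -> 'M[R]_d) : 'M[R]_d :=
  \matrix_(k, l) fine ('E_Q[fun z => F z k l])%E.

(* In the next two definitions P^* is the outer probability, which agrees with
   P on measurable sets. *)

(* X_n = O_P(1) *)
Definition bounded_in_prob (P : probability T R) (X : nat -> T -> \bar R) :
    Prop :=
  forall e : R, 0 < e -> exists K : R, \forall n \near \oo,
    ((P^*)%mu [set w | K%:E < X n w] < e%:E)%E.

(* X_n - l = o_P(1) *)
Definition cvg_in_prob (P : probability T R) (X : nat -> T -> R) (l : R) :
    Prop :=
  forall e : R, 0 < e ->
    (P^*)%mu [set w | e < `|X n w - l|] @[n --> \oo] --> 0%E.

End probability_notions.

Definition cvg_in_cond_distr (dT : measure_display) (T : measurableType dT)
    (R : realType) (P : probability T R) (d : nat)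
    (F : nat -> T -> 'rV[R]_d -> R) (G : 'rV[R]_d -> R) : Prop :=
  forall x : 'rV[R]_d, cvg_in_prob P (fun n w => F n w x) (G x).

(* The law, given the data, of s indices drawn independently from 'I_n with
   probabilities p. *)
Definition resampling_prob (R : realType) (n s : nat) (p : 'I_n -> R)
    (E : set (s.-tuple 'I_n)) : R :=
  \sum_(k : s.-tuple 'I_n | k \in E) \prod_(j < s) p (tnth k j).

Section estimation.
Context (dS : measure_display) (S : measurableType dS) (R : realType)
  (d : nat) (m : S -> 'rV[R]_d -> R).

Definition full_criterion (n : nat) (z : n.-tuple S) (t : 'rV[R]_d) : R :=
  n%:R^-1 * \sum_(i < n) m (tnth z i) t.

Definition subsample_criterion (n s : nat) (p : 'I_n -> R) (z : n.-tuple S)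
    (k : s.-tuple 'I_n) (t : 'rV[R]_d) : R :=
  \sum_(j < s) m (tnth z (tnth k j)) t / (n%:R * s%:R * p (tnth k j)).

Definition mean_hessian (n : nat) (z : n.-tuple S) (t : 'rV[R]_d) : 'M[R]_d :=
  n%:R^-1 *: \sum_(i < n) hessian (m (tnth z i)) t.

Definition LambdaR (n : nat) (p : 'I_n -> R) (z : n.-tuple S)
    (t : 'rV[R]_d) : 'M[R]_d :=
  (n%:R ^+ 2)^-1 *: \sum_(i < n) (p i)^-1 *:
    ((gradient (m (tnth z i)) t)^T *m gradient (m (tnth z i)) t).

Definition VR (n : nat) (p : 'I_n -> R) (z : n.-tuple S)
    (t : 'rV[R]_d) : 'M[R]_d :=
  invmx (mean_hessian z t) *m LambdaR p z t *m invmx (mean_hessian z t).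

(* Multiplying the row u - t on the right by the symmetric matrix V^(-1/2) is
   the transpose of multiplying the corresponding column on the left. *)
Definition standardized_error (n s : nat) (p : 'I_n -> R) (z : n.-tuple S)
    (t u : 'rV[R]_d) : 'rV[R]_d :=
  Num.sqrt s%:R *: ((u - t) *m invsqrtmx (VR p z t)).

(* sup of n^-1 sum_i |grad m(z_i, u)|^4 over the u in Theta within distance r
   of t *)
Definition local_fourth_moment (Theta : set 'rV[R]_d) (r : R) (n : nat)
    (z : n.-tuple S) (t : 'rV[R]_d) : \bar R :=
  ereal_sup [set (n%:R^-1 *
                  \sum_(i < n) enorm (gradient (m (tnth z i)) u) ^+ 4)%:E
            | u in [set u | Theta u /\ enorm (u - t) < r]].

End estimation.

(* Main.v *)
Require Import Defs.
From HB Require Import structures.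
From mathcomp Require Import all_boot all_order all_algebra.
From mathcomp Require Import all_classical all_reals all_analysis.
From mathcomp Require Import measurable_realfun.
From mathcomp Require complex finmap.
From mathcomp Require Import ring lra.
Import Order.TTheory GRing.Theory Num.Theory.
Import numFieldNormedType.Exports.

Set Implicit Arguments.
Unset Strict Implicit.
Unset Printing Implicit Defensive.

Local Open Scope classical_set_scope.
Local Open Scope ring_scope.

(** Why the theorem is true.

    Fix the data, and let t be the full data estimator. Given the data, the
    subsample criterion is a normalized sum of s independent concave terms,
    weighted by inverse probabilities so that its conditional mean is the full
    criterion. Around t, at the scale s^(-1/2), it is nearly the quadratic
    function

      dot u W + dot (u H) u / 2,   u = sqrt s (theta - t),

    where H is the Hessian of the full criterion at t and W is the weighted
    score of the subsample, which has conditional mean 0 because t is a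
    maximizer. A concave function that is uniformly close to a strictly concave
    quadratic one on a ball has its maximizer close to the maximizer - W H^-1 of
    the latter ([argmax_linearization]). So the standardized error is, up to a
    small remainder, the sum of s independent vectors divided by sqrt s, and
    these vectors have mean 0 and covariance exactly the identity, since V is
    the sandwich matrix of the same data ([influence_mean], [influence_cov]).

    The law of that sum changes with n, hence the central limit theorem is
    needed with an error bound that depends on the third moments only.
    It is proved by Lindeberg's replacement method ([lindeberg_product]): the
    draws are exchanged for Gaussian vectors one at a time, a Gaussian vector
    being represented by the heat semigroup acting on each coordinate of a
    product of smooth cutoffs. The result is [conditional_normality], a
    statement about fixed data: the conditional distribution function of the
    standardized error is within e of the normal one as soon as s is at least
    some N which depends only on e and on a few constants controlling the data,
    namely a lower bound c for the curvature and for the mean absolute score in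
    every direction, and an upper bound K for the inverse probabilities and for
    some empirical moments.

    It remains to see that the data meet such bounds with probability close to
    one. Some bounds are assumptions or follow from Markov's inequality. The
    lower bounds come from the weak law of large numbers, made uniform over
    compact sets by Lipschitz envelopes ([uniform_positive]); applied to a small
    sphere about the population maximizer, with concavity, the same lemma gives
    consistency ([estimator_consistent]), and applied to the unit sphere it gives
    [criterion_curvature] and [gradient_dispersion]. *)

(** * Second-order calculus along segments *)

Lemma sum_const_ord (R : pzSemiRingType) (n : nat) (c : R) :
  \sum_(i < n) c = n%:R * c.
Proof. by rewrite sumr_const card_ord mulr_natl. Qed.

Section calculus.
Context {R : realType}.

Lemma is_derive_mvt (f f' : R -> R) :
  (forall x : R, 0 <= x <= 1 -> is_derive x (1:R) f (f' x)) ->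
  forall b : R, 0 <= b <= 1 -> exists2 c, 0 <= c <= b & f b - f 0 = f' c * b.
Proof.
move=> df b /andP[b0 b1].
have [|c|c cb ->] := @MVT_segment R f f' 0 b b0.
- move=> x; rewrite in_itv/= => /andP[x0 xb]; apply: df.
  by rewrite ltW//= (le_trans (ltW xb)).
- apply: derivable_within_continuous => x; rewrite in_itv/= => /andP[x0 xb].
  by have [] := df x; rewrite ?x0 ?(le_trans xb).
- by exists c; rewrite ?subr0//; move: cb; rewrite in_itv.
Qed.

(** The mean value theorem, applied to f minus its second Taylor polynomial
    and then to f', gives the remainder without integrating f'', which is
    only known to exist. *)
Lemma taylor2_bound (f f' f'' : R -> R) (L : R) :
  (forall x : R, 0 <= x <= 1 -> is_derive x (1:R) f (f' x)) ->
  (forall x : R, 0 <= x <= 1 -> is_derive x (1:R) f' (f'' x)) ->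
  (forall x : R, 0 <= x <= 1 -> `|f'' x - f'' 0| <= L) ->
  `|f 1 - f 0 - f' 0 - f'' 0 / 2| <= L.
Proof.
move=> df df' f''L.
have L0 : 0 <= L by apply: le_trans (f''L 0 _); rewrite ?normr_ge0// lexx ler01.
pose h x := f x - f' 0 * x - f'' 0 / 2 * x ^+ 2.
have dh (x : R) : 0 <= x <= 1 -> is_derive x (1:R) h (f' x - f' 0 - f'' 0 * x).
  move=> x01; have dfx := df x x01.
  have d2 : is_derive x (1 : R) (fun y : R => y ^+ 2) (2 * x).
    by apply: is_derive_eq; rewrite /GRing.scale/=; lra.
  by apply: is_derive_eq; rewrite /GRing.scale/=; lra.
have [|c c01 hc] := is_derive_mvt dh (b := 1); first by rewrite ler01 lexx.
have -> : f 1 - f 0 - f' 0 - f'' 0 / 2 = h 1 - h 0 by rewrite /h; lra.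
rewrite hc mulr1; move: (c01) => /andP[c0 c1].
have [e /andP[e0 ec] ->] := is_derive_mvt df' c01.
rewrite -mulrBl normrM (ger0_norm c0).
apply: le_trans (ler_piMr _ c1) _ => //.
by apply: f''L; rewrite e0 (le_trans ec).
Qed.

Context {d : nat}.
Implicit Types (f : 'rV[R]_d -> R) (x u t : 'rV[R]_d).

Lemma is_derive_line f x u (s : R) : derivable f (x + s *: u) u ->
  is_derive s 1 (fun r => f (x + r *: u)) ('D_u f (x + s *: u)).
Proof.
have E : (fun h : R => h^-1 *: (f (x + (h *: 1 + s) *: u) - f (x + s *: u)))
   = (fun h : R => h^-1 *: (f (h *: u + (x + s *: u)) - f (x + s *: u))).
  apply/funext => h; congr (_ *: (f _ - _)).
  by rewrite scalerDl addrCA /GRing.scale/= mulr1.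
by move=> fxu; split; rewrite /derivable /derive /= E.
Qed.

Lemma derive_gradient f x u : differentiable f x ->
  'D_u f x = \sum_k u 0 k * gradient f x 0 k.
Proof.
move=> dfx; rewrite deriveE// [in LHS](row_sum_delta u) linear_sum.
by apply: eq_bigr => k _; rewrite linearZ mxE deriveE.
Qed.

Lemma differentiable_partial f x k : differentiable (gradient f) x ->
  differentiable (fun y => 'D_(delta_mx 0 k : 'rV[R]_d) f y) x.
Proof.
move=> dg; have -> : (fun y => 'D_(delta_mx 0 k : 'rV[R]_d) f y) =
    (fun M : 'rV[R]_d => M 0 k) \o gradient f.
  by apply/funext => y; rewrite /= mxE.
apply: differentiable_comp => //; exact: differentiable_coord.
Qed.

Lemma is_derive_line_gradient f x u (s : R) :
  twice_differentiable_at f (x + s *: u) ->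
  is_derive s (1 : R) (fun r => f (x + r *: u))
    (\sum_k u 0 k * gradient f (x + s *: u) 0 k).
Proof.
move=> [/nbhs_singleton df _]; rewrite -derive_gradient//.
exact/is_derive_line/diff_derivable.
Qed.

Lemma is_derive_line_partial f x u (s : R) k :
  twice_differentiable_at f (x + s *: u) ->
  is_derive s (1 : R) (fun r => gradient f (x + r *: u) 0 k)
    (\sum_l hessian f (x + s *: u) k l * u 0 l).
Proof.
move=> [_ dg].
have -> : \sum_l hessian f (x + s *: u) k l * u 0 l =
    'D_u (fun y => 'D_(delta_mx 0 k : 'rV[R]_d) f y) (x + s *: u).
  rewrite derive_gradient; last exact: differentiable_partial.
  by apply: eq_bigr => l _; rewrite !mxE mulrC.
rewrite (_ : (fun r => _) = (fun r : R =>
    (fun y => 'D_(delta_mx 0 k : 'rV[R]_d) f y) (x + r *: u))); last first.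
  by apply/funext => r; rewrite mxE.
by apply/is_derive_line/diff_derivable; exact: differentiable_partial.
Qed.

Lemma norm_coord u k : `|u 0 k| <= `|u|.
Proof. by rewrite /Num.norm/= mx_normrE; apply: (le_bigmax _ _ (0, k)). Qed.

Lemma normrV_le u (c : R) : 0 <= c -> (forall k, `|u 0 k| <= c) -> `|u| <= c.
Proof.
move=> c0 uc; rewrite /Num.norm/= mx_normrE; apply: bigmax_le => // -[i j] _ /=.
by rewrite ord1.
Qed.

Lemma taylor_hessian f x u (L : R) :
  (forall s : R, 0 <= s <= 1 -> twice_differentiable_at f (x + s *: u)) ->
  (forall (s : R) k l, 0 <= s <= 1 ->
     `|hessian f (x + s *: u) k l - hessian f x k l| <= L) ->
  `|f (x + u) - f x - \sum_k u 0 k * gradient f x 0 k -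
    (\sum_k u 0 k * \sum_l hessian f x k l * u 0 l) / 2| <=
  L * (d%:R * `|u|) ^+ 2.
Proof.
move=> df hL.
have := @taylor2_bound (fun r => f (x + r *: u))
  (fun r => \sum_k u 0 k * gradient f (x + r *: u) 0 k)
  (fun r => \sum_k u 0 k * \sum_l hessian f (x + r *: u) k l * u 0 l)
  (L * (d%:R * `|u|) ^+ 2).
rewrite scale1r scale0r addr0; apply=> s s01.
- exact/is_derive_line_gradient/df.
- rewrite (_ : (fun r => _) =
    \sum_k (u 0 k \*: (fun r : R => gradient f (x + r *: u) 0 k))).
    apply: is_derive_sum => k; apply: is_deriveZ.
    exact/is_derive_line_partial/df.
  by apply/funext => r; rewrite fct_sumE.
- rewrite -sumrB; apply: le_trans (ler_norm_sum _ _ _) _.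
  under eq_bigr do rewrite -mulrBr -sumrB.
  have -> : L * (d%:R * `|u|) ^+ 2 = \sum_(k < d) `|u| * (\sum_(l < d) L * `|u|).
    by rewrite !sum_const_ord; ring.
  apply: ler_sum => k _; rewrite normrM; apply: ler_pM => //.
    exact: norm_coord.
  apply: le_trans (ler_norm_sum _ _ _) _; apply: ler_sum => l _.
  rewrite -mulrBl normrM; apply: ler_pM => //; last exact: norm_coord.
  exact: hL.
Qed.

Lemma gradient_lipschitz f x u (B : R) k :
  (forall s : R, 0 <= s <= 1 -> twice_differentiable_at f (x + s *: u)) ->
  (forall (s : R) l, 0 <= s <= 1 -> `|hessian f (x + s *: u) k l| <= B) ->
  `|gradient f (x + u) 0 k - gradient f x 0 k| <= d%:R * B * `|u|.
Proof.
move=> df hB; have ddf (s : R) s01 := is_derive_line_partial k (df s s01).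
have [|c c01] := is_derive_mvt ddf (b := 1); first by rewrite ler01 lexx.
rewrite scale1r scale0r addr0 mulr1 => ->.
apply: le_trans (ler_norm_sum _ _ _) _.
have -> : d%:R * B * `|u| = \sum_(l < d) B * `|u|.
  by rewrite !sum_const_ord; ring.
apply: ler_sum => l _; rewrite normrM; apply: ler_pM => //.
  exact: hB.
exact: norm_coord.
Qed.

Lemma lipschitz_of_gradient f x u (B : R) :
  (forall s : R, 0 <= s <= 1 -> twice_differentiable_at f (x + s *: u)) ->
  (forall (s : R) k, 0 <= s <= 1 -> `|gradient f (x + s *: u) 0 k| <= B) ->
  `|f (x + u) - f x| <= d%:R * B * `|u|.
Proof.
move=> df hB; have ddf (s : R) s01 := is_derive_line_gradient (df s s01).
have [|c c01] := is_derive_mvt ddf (b := 1); first by rewrite ler01 lexx.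
rewrite scale1r scale0r addr0 mulr1 => ->.
apply: le_trans (ler_norm_sum _ _ _) _.
have -> : d%:R * B * `|u| = \sum_(l < d) B * `|u|.
  by rewrite !sum_const_ord; ring.
apply: ler_sum => l _; rewrite normrM mulrC; apply: ler_pM => //.
  exact: hB.
exact: norm_coord.
Qed.

(** The mean value theorem in the direction k reduces the second difference
    to an increment of the partial derivative of index k, and this increment
    is read off the differential of that derivative at x. *)
Lemma second_difference f x k l (e : R) : twice_differentiable_at f x -> 0 < e ->
  \forall h \near (0 : R)^'+,
  `|f (x + h *: delta_mx 0 k + h *: delta_mx 0 l) - f (x + h *: delta_mx 0 k)
    - f (x + h *: delta_mx 0 l) + f x - h ^+ 2 * hessian f x k l|
   <= e * h ^+ 2.
Proof.
move=> [df dg] e0.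
pose g y := 'D_(delta_mx 0 k : 'rV[R]_d) f y.
have dgx : differentiable g x by exact: differentiable_partial.
have [r r0 rE] : exists2 r : R, 0 < r & forall v : 'rV[R]_d, `|v| < r ->
    differentiable f (x + v) /\ `|g (x + v) - g x - 'd g x v| <= e / 3 * `|v|.
  have [r1 r10 h1] := (nbhs_normP x _).1 df.
  have e30 : 0 < e / 3 by rewrite divr_gt0.
  have /eqaddoP dgo := diff_locally dgx.
  have := dgo _ e30.
  move=> /nbhs_normP[r2 r20 h2].
  exists (Num.min r1 r2); first by rewrite lt_min r10.
  move=> v; rewrite lt_min => /andP[vr1 vr2]; split.
    by apply: h1; rewrite /ball_/= opprD addNKr normrN.
  have := h2 v; rewrite /ball_/= sub0r normrN => /(_ vr2).
  by rewrite !fctE /= opprD addrA (addrC v).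
near=> h.
have h0 : 0 < h by near: h; exact: nbhs_right_gt.
have hr : 2 * h < r.
  by rewrite mulrC -ltr_pdivlMr//; near: h; apply: nbhs_right_lt; rewrite divr_gt0.
pose ek : 'rV[R]_d := delta_mx 0 k; pose el : 'rV[R]_d := delta_mx 0 l.
have nek : forall j : 'I_d, `|delta_mx 0 j : 'rV[R]_d| <= 1.
  by move=> j; apply: normrV_le => // i; rewrite mxE eqxx /=; case: eqP; rewrite ?normr1 ?normr0.
have n2 (s : R) : 0 <= s <= 1 -> `|s *: (h *: ek)| <= h.
  move=> /andP[s0 s1]; rewrite !normrZ (gtr0_norm h0) (ger0_norm s0).
  by rewrite mulrCA ger_pMr// mulr_ile1// nek.
have n1 (s : R) : 0 <= s <= 1 -> `|h *: el + s *: (h *: ek)| <= 2 * h.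
  move=> s01; apply: le_trans (ler_normD _ _) _; rewrite mulr_natl mulr2n.
  by rewrite lerD ?n2// normrZ (gtr0_norm h0) ger_pMr// nek.
have dek y : differentiable f y -> 'D_(h *: ek) f y = h * g y.
  by move=> dfy; rewrite deriveE// linearZ /g deriveE.
have dphi (s : R) : 0 <= s <= 1 -> is_derive s (1 : R)
  (fun s : R => f (x + h *: el + s *: (h *: ek)) - f (x + s *: (h *: ek)))
  (h * g (x + h *: el + s *: (h *: ek)) - h * g (x + s *: (h *: ek))).
  move=> s01; apply: is_deriveB.
    rewrite -dek; last by rewrite -addrA; have [] := rE _ (le_lt_trans (n1 _ s01) hr).
    by apply/is_derive_line/diff_derivable; rewrite -addrA;
      have [] := rE _ (le_lt_trans (n1 _ s01) hr).
  have [|dd _] := rE (s *: (h *: ek)).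
    by apply: le_lt_trans hr; apply: le_trans (n2 _ s01) _; rewrite ler_peMl ?ltW// ltr1n.
  by rewrite -dek//; apply/is_derive_line/diff_derivable.
have [|c c01] := is_derive_mvt dphi (b := 1); first by rewrite ler01 lexx.
rewrite !scale1r !scale0r !addr0 mulr1 => E.
rewrite -[in f _ - _](addrA x) (addrC (h *: ek)) addrA.
have -> : f (x + h *: el + h *: ek) - f (x + h *: ek) - f (x + h *: el) + f x =
  f (x + h *: el + h *: ek) - f (x + h *: ek) - (f (x + h *: el) - f x) by ring.
rewrite E -mulrBr.
have Hkl : h * hessian f x k l = 'd g x (h *: el + c *: (h *: ek)) - 'd g x (c *: (h *: ek)).
  by rewrite -linearB addrK linearZ/= mxE -deriveE.
rewrite expr2 -mulrA Hkl -mulrBr normrM (gtr0_norm h0).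
rewrite (_ : e * (h * h) = h * (e * h)); last by ring.
rewrite ler_pM2l//.
set v1 := h *: el + _; set v2 := c *: _.
have [_ b1] := rE v1 (le_lt_trans (n1 _ c01) hr).
have [|_ b2] := rE v2.
  by apply: le_lt_trans hr; apply: le_trans (n2 _ c01) _; rewrite ler_peMl ?ltW// ltr1n.
rewrite -[x + _ + v2]addrA -/v1.
have -> : g (x + v1) - g (x + v2) - ('d g x v1 - 'd g x v2) =
  (g (x + v1) - g x - 'd g x v1) - (g (x + v2) - g x - 'd g x v2) by ring.
apply: le_trans (ler_normB _ _) _; apply: le_trans (lerD b1 b2) _.
rewrite -mulrDr; have := n1 _ c01; have := n2 _ c01; rewrite -/v1 -/v2 => ? ?.
have : e * (`|v1| + `|v2|) <= e * (2 * h + h) by rewrite ler_pM2l// lerD.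
by lra.
Unshelve. all: by end_near. Qed.

(** Schwarz's theorem for a gradient that is differentiable at one point:
    the second difference is unchanged when k and l are exchanged. *)
Lemma hessian_sym f x : twice_differentiable_at f x ->
  (hessian f x)^T = hessian f x.
Proof.
move=> df; apply/matrixP => l k; rewrite mxE; apply/eqP; rewrite -subr_eq0 -normr_le0.
apply/ler_addgt0Pl => e e0; rewrite addr0.
have e20 : 0 < e / 2 by rewrite divr_gt0.
near (0 : R)^'+ => h.
have h0 : 0 < h by near: h; exact: nbhs_right_gt.
have A : `|f (x + h *: delta_mx 0 k + h *: delta_mx 0 l) - f (x + h *: delta_mx 0 k)
    - f (x + h *: delta_mx 0 l) + f x - h ^+ 2 * hessian f x k l|
   <= e / 2 * h ^+ 2 by near: h; exact: second_difference.
have B : `|f (x + h *: delta_mx 0 l + h *: delta_mx 0 k) - f (x + h *: delta_mx 0 l)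
    - f (x + h *: delta_mx 0 k) + f x - h ^+ 2 * hessian f x l k|
   <= e / 2 * h ^+ 2 by near: h; exact: second_difference.
have h20 : 0 < h ^+ 2 by rewrite exprn_gt0.
rewrite -(ler_pM2l h20) -(ger0_norm (ltW h20)) -normrM (ger0_norm (ltW h20)).
move: A B; rewrite -[X in f X](addrA x) (addrC (h *: _) (h *: _)) addrA.
move: (f (x + _ + _)) (f (x + h *: delta_mx 0 k)) (f (x + h *: delta_mx 0 l)) => p q r'.
move=> /ler_normlP[A1 A2] /ler_normlP[B1 B2]; apply/ler_normlP; split; lra.
Unshelve. all: by end_near. Qed.
End calculus.

(** * Gaussian expectations *)

Section gaussian.
Context {R : realType}.
Implicit Types (f g a b : R -> R) (x y h l t s : R).
Local Notation mu := (@lebesgue_measure R).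

(** Completing the square; exponential moments of N(0, 1) become total
    masses of shifted normal densities. *)
Lemma normal_pdf_tilt l y :
  expR (l * y) * normal_pdf 0 1 y = expR (l ^+ 2 / 2) * normal_pdf l 1 y.
Proof.
rewrite !normal_pdfE ?oner_neq0// /normal_fun mulrCA [RHS]mulrCA; congr (_ * _).
by rewrite -!expRD; congr expR; field.
Qed.

Definition gexp f : R := \int[mu]_y (f y * normal_pdf 0 1 y).

Definition gintegrable f := mu.-integrable setT (fun y => (f y * normal_pdf 0 1 y)%:E).

Lemma gexpR l : gintegrable (fun y => expR (l * y)) /\
  gexp (fun y => expR (l * y)) = expR (l ^+ 2 / 2).
Proof.
have I := @integrable_normal_pdf R l 1; split.
  rewrite /gintegrable; under eq_fun do rewrite normal_pdf_tilt EFinM.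
  exact: integrableZl.
rewrite /gexp; under eq_Rintegral do rewrite normal_pdf_tilt.
by rewrite RintegralZl// /Rintegral integral_normal_pdf mulr1.
Qed.

Let E2 y := expR (2 * y) + expR (-2 * y).

Lemma gintegrableD f g : gintegrable f -> gintegrable g ->
  gintegrable (fun y => f y + g y).
Proof.
move=> If Ig; rewrite /gintegrable; under eq_fun do rewrite mulrDl EFinD.
exact: integrableD.
Qed.

Lemma gintegrableZ (c : R) f : gintegrable f -> gintegrable (fun y => c * f y).
Proof.
move=> If; rewrite /gintegrable; under eq_fun do rewrite -mulrA EFinM.
exact: integrableZl.
Qed.

Lemma gexpD f g : gintegrable f -> gintegrable g ->
  gexp (fun y => f y + g y) = gexp f + gexp g.
Proof.
by move=> If Ig; rewrite -RintegralD//; apply: eq_Rintegral => y _; rewrite mulrDl.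
Qed.

Lemma gexpZ (c : R) f : gintegrable f -> gexp (fun y => c * f y) = c * gexp f.
Proof.
by move=> If; rewrite -RintegralZl//; apply: eq_Rintegral => y _; rewrite mulrA.
Qed.

Lemma gexp_le f g : gintegrable f -> gintegrable g -> (forall y, f y <= g y) ->
  gexp f <= gexp g.
Proof.
move=> If Ig fg; apply: le_Rintegral => // y _.
by rewrite ler_wpM2r// normal_pdf_ge0.
Qed.

Lemma ler_expR_abs x : expR `|x| <= expR x + expR (- x).
Proof.
by case: (ger0P x) => _; rewrite ?lerDl ?lerDr expR_ge0.
Qed.

Lemma expR_abs_le_E2 y : expR (2 * `|y|) <= E2 y.
Proof.
have -> : 2 * `|y| = `|2 * y| by rewrite normrM ger0_norm.
by rewrite /E2 mulNr; exact: ler_expR_abs.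
Qed.

(** E2 is integrable by [gexpR] and grows faster than any polynomial, so
    this is the integrability test for the moments. *)
Lemma gintegrable_dom f (C : R) : measurable_fun setT f ->
  (forall y, `|f y| <= C * E2 y) -> gintegrable f.
Proof.
move=> mf fC.
have IE : gintegrable (fun y => C * E2 y).
  by apply/gintegrableZ/gintegrableD; apply: (gexpR _).1.
apply: le_integrable IE => //.
  apply/measurable_EFinP; apply: measurable_funM => //; exact: measurable_normal_pdf.
move=> y _ /=; rewrite lee_fin !normrM ler_wpM2r//.
by rewrite -[X in _ <= X]normrM (le_trans (fC y))// ler_norm.
Qed.

Lemma ge1_E2 y : 1 <= E2 y.
Proof.
apply: le_trans (expR_abs_le_E2 y); rewrite -expR0 ler_expR mulr_ge0//.
Qed.

Lemma gintegrable_bounded f (C : R) : measurable_fun setT f ->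
  (forall y, `|f y| <= C) -> gintegrable f.
Proof.
move=> mf fC; have C0 : 0 <= C by apply: le_trans (fC 0).
apply: (@gintegrable_dom _ C) => // y; rewrite (le_trans (fC y))//.
by rewrite ler_peMr// ge1_E2.
Qed.

Lemma gexp_cst (c : R) : gexp (fun=> c) = c.
Proof.
have [I E] := gexpR 0.
have e1 : (fun y => expR (0 * y)) = (fun=> 1) by apply/funext => y; rewrite mul0r expR0.
move: I E; rewrite e1 expr0n mul0r expR0 => I E.
by rewrite -[RHS]mulr1 -E -gexpZ//; under [in RHS]eq_fun do rewrite mulr1.
Qed.

Lemma gexp_norm_le f (C : R) : gintegrable f -> (forall y, `|f y| <= C) -> `|gexp f| <= C.
Proof.
have Ic c : gintegrable (fun=> c) by apply: (@gintegrable_bounded _ `|c|).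
move=> If fC; rewrite ler_norml -{1}(gexp_cst (- C)) -{2}(gexp_cst C).
by apply/andP; split; apply: gexp_le => // y; have := fC y; rewrite ler_norml => /andP[].
Qed.

Lemma cube_le_expR y : `|y| ^+ 3 <= 27 * expR `|y|.
Proof.
have y0 := normr_ge0 y.
have h : `|y| / 3 <= expR (`|y| / 3).
  by apply: le_trans (expR_ge1Dx _); rewrite lerDr.
have : (`|y| / 3) ^+ 3 <= expR (`|y| / 3) ^+ 3.
  by apply: lerXn2r; rewrite ?nnegrE ?divr_ge0 ?expR_ge0.
rewrite -expRM_natl (_ : 3%:R * (`|y| / 3) = `|y|); last by field.
by rewrite expr_div_n; lra.
Qed.

Lemma expR_taylor x : `|expR x - 1 - x - x ^+ 2 / 2| <= `|x| ^+ 3 * expR `|x|.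
Proof.
have D (s : R) : is_derive s (1 : R) (fun r => expR (r * x)) (x * expR (s * x)).
  have : is_derive s (1 : R) (fun r => r * x) x.
    by apply: is_derive_eq; rewrite /GRing.scale/=; lra.
  move=> ?; by apply: is_derive_eq; rewrite mulrC.
have := @taylor2_bound R (fun s => expR (s * x)) (fun s => x * expR (s * x))
  (fun s => x ^+ 2 * expR (s * x)) (`|x| ^+ 3 * expR `|x|).
rewrite !mul1r !mul0r expR0 !mulr1; apply=> s s01.
- by have ? := D s; apply: is_derive_eq; rewrite /GRing.scale/=; ring.
- rewrite -{2}[x ^+ 2]mulr1 -mulrBr normrM normrX (exprSr _ 2) -mulrA ler_wpM2l ?exprn_ge0//.
  move: s01 => /andP[s0 s1]; set z := s * x.
  have zx : `|z| <= `|x| by rewrite normrM (ger0_norm s0) ler_piMl.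
  suff : `|expR z - 1| <= `|z| * expR `|z|.
    by move=> /le_trans; apply; rewrite ler_pM ?expR_ge0// ler_expR.
  case: (ger0P z) => z0.
    rewrite ger0_norm ?subr_ge0 -?expR0 ?ler_expR// expR0.
    have := expR_ge1Dx (- z); rewrite expRN -(ler_pM2r (expR_gt0 z)).
    by rewrite mulVf ?gt_eqF ?expR_gt0//; lra.
  rewrite ler0_norm; last by rewrite subr_le0 -expR0 ler_expR ltW.
  have := expR_ge1Dx z; have := expR_ge1Dx (- z) => h1 h2.
  have h3 : 0 <= - z by lra.
  have : - z * 1 <= - z * expR (- z) by rewrite ler_wpM2l//; lra.
  by lra.
Qed.

Let m1 := gexp id.
Let m2 := gexp (fun y => y ^+ 2).
Let m3 := gexp (fun y => `|y| ^+ 3).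

Let int3 : gintegrable (fun y => `|y| ^+ 3).
Proof.
apply: (@gintegrable_dom _ 27).
  by apply: measurable_funX => //; exact: measurableT_comp.
move=> y; rewrite ger0_norm ?exprn_ge0//.
apply: le_trans (cube_le_expR y) _; rewrite ler_wpM2l//.
by apply: le_trans (expR_abs_le_E2 y); rewrite ler_expR ler_peMl// ler1n.
Qed.

Let int1 : gintegrable id.
Proof.
apply: (@gintegrable_dom _ 1) => //= y; rewrite mul1r.
apply: le_trans (expR_abs_le_E2 y).
have := expR_ge1Dx (2 * `|y|); have := normr_ge0 y; lra.
Qed.

Let int2 : gintegrable (fun y => y ^+ 2).
Proof.
apply: (@gintegrable_dom _ 1) => //= y.
rewrite mul1r normrX; apply: le_trans (expR_abs_le_E2 y).
have h : `|y| <= expR `|y| by have := expR_ge1Dx `|y|; lra.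
by rewrite mulr_natl mulr2n expRD expr2 ler_pM.
Qed.

(** The known exponential moment exp (l^2 / 2) and the termwise average of
    the Taylor polynomial of exp (l y) agree up to O(l^3). *)
Let moment_bound : exists2 K : R, 0 <= K & forall l, `|l| <= 1 ->
  `|l * m1 + l ^+ 2 * (m2 - 1) / 2| <= K * `|l| ^+ 3.
Proof.
have IE2 : gintegrable E2 by apply/gintegrableD; apply: (gexpR _).1.
exists (27 * gexp E2 + expR 1 + 1).
  rewrite !addr_ge0 ?expR_ge0// mulr_ge0//.
  rewrite -(gexp_cst 0); apply: gexp_le => // [|y].
    by apply: (@gintegrable_bounded _ 0) => // y; rewrite normr0.
  by rewrite (le_trans ler01)// ge1_E2.
move=> l l1.
have [Il El] := gexpR l.
have I0 : gintegrable (fun y => l * y + l ^+ 2 / 2 * y ^+ 2).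
  by apply: gintegrableD; exact: gintegrableZ.
have I1 : gintegrable (fun=> -1) by apply: (@gintegrable_bounded _ 1) => // y; rewrite normrN1.
pose rem y := expR (l * y) + (-1 + (-1) * (l * y + l ^+ 2 / 2 * y ^+ 2)).
have Ir : gintegrable rem by apply/gintegrableD => //; apply/gintegrableD => //; exact: gintegrableZ.
have Er : gexp rem = expR (l ^+ 2 / 2) + (-1 + (-1) * (l * m1 + l ^+ 2 / 2 * m2)).
  rewrite /rem gexpD//; last by apply/gintegrableD => //; exact: gintegrableZ.
  rewrite El gexpD//; last exact: gintegrableZ.
  by rewrite gexp_cst gexpZ// gexpD ?gexpZ//; exact: gintegrableZ.
have rB y : `|rem y| <= `|l| ^+ 3 * 27 * E2 y.
  rewrite (_ : rem y = expR (l * y) - 1 - l * y - (l * y) ^+ 2 / 2); last first.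
    by rewrite /rem; field.
  apply: le_trans (expR_taylor _) _; rewrite normrM exprMn -[leLHS]mulrA -[leRHS]mulrA ler_wpM2l ?exprn_ge0//.
    apply: (@le_trans _ _ (27 * expR (2 * `|y|))); last by rewrite ler_wpM2l ?expR_abs_le_E2.
  rewrite (mulr_natl _ 2) mulr2n expRD mulrA ler_pM ?exprn_ge0 ?expR_ge0 ?cube_le_expR//.
  by rewrite ler_expR ler_piMl.
have B1 : `|gexp rem| <= `|l| ^+ 3 * 27 * gexp E2.
  have IB := gintegrableZ (`|l| ^+ 3 * 27) IE2.
  have IBN := gintegrableZ (- (`|l| ^+ 3 * 27)) IE2.
  rewrite ler_norml -mulNr -!gexpZ//; apply/andP; split; apply: gexp_le => // y;
    by have := rB y; rewrite ler_norml -mulNr => /andP[].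
have B2 : `|expR (l ^+ 2 / 2) - 1 - l ^+ 2 / 2| <= (expR 1 + 1) * `|l| ^+ 3.
  set z := l ^+ 2 / 2; have z0 : 0 <= z by rewrite divr_ge0 ?sqr_ge0.
  have zl : z <= `|l| ^+ 2 by rewrite /z -normrX ger0_norm ?sqr_ge0//; have := sqr_ge0 l; lra.
  have l2 : `|l| ^+ 2 <= 1 by rewrite exprn_ile1.
  have z1 : z <= 1 by apply: le_trans l2.
  have := expR_taylor z; rewrite (ger0_norm z0) => T.
  have zz : z ^+ 2 <= `|l| ^+ 3.
    apply: (@le_trans _ _ (`|l| ^+ 2 * `|l| ^+ 2)); first by rewrite expr2 ler_pM.
    by rewrite -exprD ler_wiXn2l.
  have zzz : z ^+ 3 * expR z <= `|l| ^+ 3 * expR 1.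
    rewrite ler_pM ?exprn_ge0 ?expR_ge0 ?ler_expR//.
    by rewrite (le_trans _ zz)// ler_wiXn2l.
  have := ler_normD (expR z - 1 - z - z ^+ 2 / 2) (z ^+ 2 / 2).
  rewrite subrK (ger0_norm (_ : 0 <= z ^+ 2 / 2)) ?divr_ge0 ?exprn_ge0//.
  have := exprn_ge0 2 z0; lra.
have -> : l * m1 + l ^+ 2 * (m2 - 1) / 2 =
    (expR (l ^+ 2 / 2) - 1 - l ^+ 2 / 2) - gexp rem by rewrite Er; field.
apply: le_trans (ler_normB _ _) _; lra.
Qed.

Lemma gintegrable_moments : [/\ gintegrable id, gintegrable (fun y => y ^+ 2) &
  gintegrable (fun y => `|y| ^+ 3)].
Proof. by []. Qed.

(** By [moment_bound], l m1 + l^2 (m2 - 1) / 2 is O(l^3) for l of both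
    signs, so that both coefficients vanish. *)
Lemma gexp_moments : gexp id = 0 /\ gexp (fun y => y ^+ 2) = 1.
Proof.
have [K K0 B] := moment_bound; rewrite -/m1 -/m2.
have Bp l : 0 < l -> l <= 1 -> `|m1| <= K * l ^+ 2 /\ `|m2 - 1| <= 2 * K * l.
  move=> l0 l1.
  have := B l; have := B (- l); rewrite !normrN (gtr0_norm l0) sqrrN => /(_ l1) + /(_ l1).
  move=> /ler_normlP[A1 A2] /ler_normlP[A3 A4].
  have E3 : l ^+ 3 = l * l ^+ 2 by rewrite -exprS.
  have E3' : l ^+ 3 = l ^+ 2 * l by rewrite -exprSr.
  split.
    rewrite -(ler_pM2l l0) -{1}(gtr0_norm l0) -normrM mulrCA -E3.
    by apply/ler_normlP; split; lra.
  have l2 : 0 < l ^+ 2 by rewrite exprn_gt0.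
  rewrite -(ler_pM2l l2) -{1}(gtr0_norm l2) -normrM mulrCA -E3'.
  by apply/ler_normlP; split; lra.
have small (c : R) : (forall l, 0 < l -> l <= 1 -> `|c| <= 2 * K * l) -> c = 0.
  move=> H; apply/eqP; rewrite -normr_le0; apply/ler_addgt0Pl => e e0; rewrite addr0.
  pose l := Num.min 1 (e / (2 * K + 1)).
  have l0 : 0 < l by rewrite lt_min ltr01/= divr_gt0// ltr_wpDl// mulr_ge0.
  apply: le_trans (H l l0 _) _; first by rewrite ge_min lexx.
  have : l <= e / (2 * K + 1) by rewrite ge_min lexx orbT.
  rewrite ler_pdivlMr; last by rewrite ltr_wpDl// mulr_ge0.
  by lra.
split; last first.
  by apply/eqP; rewrite -subr_eq0; apply/eqP/small => l l0 l1; have [] := Bp l l0 l1.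
apply: small => l l0 l1; have [+ _] := Bp l l0 l1; move=> /le_trans; apply.
have : K * l ^+ 2 <= K * l by rewrite ler_wpM2l// expr2 ler_piMl// ltW.
have : 0 <= K * l by rewrite mulr_ge0// ltW.
lra.
Qed.

End gaussian.

(** * The heat semigroup *)

Section smoothing.
Context {R : realType}.
Implicit Types (f g a b : R -> R) (x y h l t s C : R).
Local Notation mu := (@lebesgue_measure R).

(** The mean of g (x + sqrt t Y) for a standard normal Y: the heat
    semigroup, which stands for adding an independent N(0, t) variable. *)
Definition heat t g x : R := gexp (fun y => g (x + Num.sqrt t * y)).

(** A second-order expansion with a cubic error uniform in x, rather than a
    bound on derivatives: this form is linear in (g, a, b) and is preserved
    by averages with the same constant. *)
Definition jet2 C g a b := [/\ forall x, 0 <= g x <= 1, forall x, `|a x| <= C,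
  forall x, `|b x| <= C &
  forall x h, `|g (x + h) - g x - h * a x - h ^+ 2 / 2 * b x| <= C * `|h| ^+ 3].

Lemma jet2_lipschitz C g a b : jet2 C g a b ->
  forall x h, `|h| <= 1 -> `|g (x + h) - g x| <= 3 * C * `|h|.
Proof.
move=> [_ aC bC E] x h h1.
have C0 : 0 <= C by apply: le_trans (aC 0).
have h0 := normr_ge0 h.
have h2 : `|h| ^+ 2 <= `|h| by rewrite expr2 ler_piMl.
have h3 : `|h| ^+ 3 <= `|h| by rewrite (le_trans _ h2)// ler_wiXn2l.
have -> : g (x + h) - g x =
  (g (x + h) - g x - h * a x - h ^+ 2 / 2 * b x) + (h * a x + h ^+ 2 / 2 * b x) by ring.
apply: le_trans (ler_normD _ _) _.
have A : `|h * a x| <= `|h| * C by rewrite normrM ler_wpM2l.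
have B : `|h ^+ 2 / 2 * b x| <= `|h| * C.
  rewrite normrM ler_pM// normrM normrX (ger0_norm (_ : 0 <= 2^-1)) ?invr_ge0//.
  by lra.
have D : C * `|h| ^+ 3 <= C * `|h| by rewrite ler_wpM2l.
have := ler_normD (h * a x) (h ^+ 2 / 2 * b x); have := E x h; lra.
Qed.

Lemma near_dist_le x (e : R) : 0 < e -> \forall y \near x, `|y - x| <= e.
Proof.
move=> e0; apply/nbhs_normP; exists e => //= z.
by rewrite /ball_/= distrC => /ltW.
Qed.

Lemma cvg_harmonic_bound (u : R^nat) (l K : R) :
  (forall n, `|u n - l| <= K * n.+1%:R^-1) -> u @ \oo --> l.
Proof.
move=> H; apply/cvgrPdist_le => e e0; near=> n.
rewrite distrC (le_trans (H n))// (le_trans (ler_norm _))//.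
near: n; apply: cvgr0_norm_le e e0.
rewrite -(mulr0 K); apply: cvgM; first exact: cvg_cst.
exact: cvg_harmonic.
Unshelve. all: by end_near. Qed.

Lemma jet2_continuous C g a b : jet2 C g a b -> continuous g.
Proof.
move=> J x; have [_ aC _ _] := J.
have C0 : 0 <= C by apply: le_trans (aC 0).
apply/cvgrPdist_le => e e0; near=> y.
rewrite distrC -(subrKC x y).
have yx1 : `|y - x| <= 1 by near: y; exact: near_dist_le.
apply: le_trans (jet2_lipschitz J _ yx1) _.
have : `|y - x| <= e / (3 * C + 1).
  by near: y; apply: near_dist_le; rewrite divr_gt0// ltr_wpDl// mulr_ge0//.
rewrite ler_pdivlMr; last by rewrite ltr_wpDl// mulr_ge0.
by have := normr_ge0 (y - x); nra.
Unshelve. all: by end_near. Qed.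

(** The function g is continuous, and a and b are pointwise limits of its
    first and second difference quotients. *)
Lemma jet2_measurable C g a b : jet2 C g a b ->
  [/\ measurable_fun setT g, measurable_fun setT a & measurable_fun setT b].
Proof.
move=> J; have mg := continuous_measurable_fun (jet2_continuous J).
have mgD h : measurable_fun setT (fun x => g (x + h)).
  by apply: measurableT_comp => //; exact: measurable_funD.
have [_ aC bC E] := J.
have C0 : 0 <= C by apply: le_trans (aC 0).
split=> //.
- pose u (n : nat) x := n.+1%:R * (g (x + n.+1%:R^-1) - g x).
  apply: (measurable_fun_cvg (h := u)) => [n|x _].
    by apply: measurable_funM => //; exact: measurable_funB.
  apply: (@cvg_harmonic_bound _ _ (2 * C)) => n; rewrite /u.
  have n0 : 0 < n.+1%:R^-1 :> R by rewrite invr_gt0.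
  have n1 : n.+1%:R^-1 <= 1 :> R by rewrite invf_le1// ler1n.
  have nE : n.+1%:R * n.+1%:R^-1 = 1 :> R by rewrite divff.
  move: n.+1%:R n.+1%:R^-1 n0 n1 nE => m k k0 k1 mk.
  have m0 : 0 <= m by rewrite -(pmulr_lge0 _ k0) mk.
  have := E x k; rewrite (gtr0_norm k0) => Ek.
  have -> : m * (g (x + k) - g x) - a x =
      m * (g (x + k) - g x - k * a x - k ^+ 2 / 2 * b x) + k / 2 * b x.
    rewrite [in RHS](_ : m * _ = m * (g (x + k) - g x) - (m * k) * a x
      - (m * k) * (k / 2 * b x)); last by ring.
    by rewrite mk; ring.
  apply: le_trans (ler_normD _ _) _; rewrite !normrM (ger0_norm m0) (gtr0_norm k0).
  have A1 : m * `|g (x + k) - g x - k * a x - k ^+ 2 / 2 * b x| <= C * k.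
    apply: (@le_trans _ _ (m * (C * k ^+ 3))); first by rewrite ler_wpM2l.
    have -> : m * (C * k ^+ 3) = (m * k) * (C * k) * k by ring.
    by rewrite mk mul1r ler_piMr// mulr_ge0// ltW.
  have A2 : k * `|2^-1| * `|b x| <= C * k.
    rewrite (ger0_norm (_ : 0 <= 2^-1)) ?invr_ge0// -mulrA mulrC ler_pM2r//.
    by have := bC x; have := normr_ge0 (b x); lra.
  by lra.
- pose u (n : nat) x := n.+1%:R ^+ 2 * (g (x + n.+1%:R^-1) + g (x + - n.+1%:R^-1) - 2 * g x).
  apply: (measurable_fun_cvg (h := u)) => [n|x _].
    apply: measurable_funM => //; apply: measurable_funB; first exact: measurable_funD.
    exact: measurable_funM.
  apply: (@cvg_harmonic_bound _ _ (2 * C)) => n; rewrite /u.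
  have n0 : 0 < n.+1%:R^-1 :> R by rewrite invr_gt0.
  have nE : n.+1%:R * n.+1%:R^-1 = 1 :> R by rewrite divff.
  move: n.+1%:R n.+1%:R^-1 n0 nE => m k k0 mk.
  have := E x k; have := E x (- k); rewrite normrN sqrrN (gtr0_norm k0) => E1 E2.
  have -> : m ^+ 2 * (g (x + k) + g (x - k) - 2 * g x) - b x =
      m ^+ 2 * ((g (x + k) - g x - k * a x - k ^+ 2 / 2 * b x) +
                (g (x - k) - g x - (- k) * a x - k ^+ 2 / 2 * b x)).
    rewrite [in RHS](_ : m ^+ 2 * _ = m ^+ 2 * (g (x + k) + g (x - k) - 2 * g x)
      - (m * k) ^+ 2 * b x); last by field.
    by rewrite mk; ring.
  rewrite normrM (ger0_norm (sqr_ge0 _)).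
  apply: (@le_trans _ _ (m ^+ 2 * (2 * C * k ^+ 3))).
    by rewrite ler_wpM2l ?sqr_ge0// (le_trans (ler_normD _ _))//; lra.
  have -> : m ^+ 2 * (2 * C * k ^+ 3) = (m * k) ^+ 2 * (2 * C * k) by ring.
  by rewrite mk expr1n mul1r.
Qed.

Lemma measurable_affine f x t : measurable_fun setT f ->
  measurable_fun setT (fun y => f (x + t * y)).
Proof.
move=> mf; apply: measurableT_comp => //; exact: measurable_funD.
Qed.

(** Averaging keeps the bounds and the expansion with the same C, so that
    the cost of a replacement step does not grow along the iteration. *)
Lemma heat_jet2 C g a b t : jet2 C g a b -> jet2 C (heat t g) (heat t a) (heat t b).
Proof.
move=> J; have [mg ma mb] := jet2_measurable J; have [g01 aC bC E] := J.
have g1 x : `|g x| <= 1 by have /andP[? ?] := g01 x; rewrite ger0_norm.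
have Ig x : gintegrable (fun y => g (x + Num.sqrt t * y)).
  by apply: (@gintegrable_bounded _ _ 1) => //; exact: measurable_affine.
have Ia x : gintegrable (fun y => a (x + Num.sqrt t * y)).
  by apply: (@gintegrable_bounded _ _ C) => //; exact: measurable_affine.
have Ib x : gintegrable (fun y => b (x + Num.sqrt t * y)).
  by apply: (@gintegrable_bounded _ _ C) => //; exact: measurable_affine.
have Ic (c : R) : gintegrable (fun=> c) by apply: (@gintegrable_bounded _ _ `|c|).
split=> [x|x|x|x h].
- apply/andP; split; [rewrite -[X in X <= _](gexp_cst 0)|rewrite -[X in _ <= X](gexp_cst 1)];
    by apply: gexp_le => // y; have /andP[] := g01 (x + Num.sqrt t * y).
- exact: gexp_norm_le.
- exact: gexp_norm_le.
- have -> : heat t g (x + h) - heat t g x - h * heat t a x - h ^+ 2 / 2 * heat t b x =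
     gexp (fun y => g (x + h + Num.sqrt t * y) + (-1 * g (x + Num.sqrt t * y) +
       (- h * a (x + Num.sqrt t * y) + - (h ^+ 2 / 2) * b (x + Num.sqrt t * y)))).
    by rewrite !gexpD ?gexpZ//; do ?apply: gintegrableD => //; do ?exact: gintegrableZ;
      rewrite /heat; ring.
  apply: gexp_norm_le => [|y].
    by do ?apply: gintegrableD => //; exact: gintegrableZ.
  have := E (x + Num.sqrt t * y) h; rewrite (addrAC x _ h).
  by congr (`|_| <= _); ring.
Qed.

Lemma gexp_cube_ge0 : 0 <= gexp (fun y => `|y| ^+ 3) :> R.
Proof.
by apply: Rintegral_ge0 => y _; rewrite mulr_ge0 ?exprn_ge0 ?normal_pdf_ge0.
Qed.

(** In the averaged expansion of g at x, the first Gaussian moment kills the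
    linear term and the second one leaves t / 2 times b. *)
Lemma heat_expand C g a b t x : 0 <= t -> jet2 C g a b ->
  `|heat t g x - g x - t / 2 * b x| <=
  C * gexp (fun y => `|y| ^+ 3) * Num.sqrt t ^+ 3.
Proof.
move=> t0 J; have [mg ma mb] := jet2_measurable J; have [g01 aC bC E] := J.
have [I1 I2 I3] := @gintegrable_moments R.
have [M1 M2] := @gexp_moments R.
have g1 z : `|g z| <= 1 by have /andP[? ?] := g01 z; rewrite ger0_norm.
have Ig : gintegrable (fun y => g (x + Num.sqrt t * y)).
  by apply: (@gintegrable_bounded _ _ 1) => //; exact: measurable_affine.
have Ic (c : R) : gintegrable (fun=> c) by apply: (@gintegrable_bounded _ _ `|c|).
set s := Num.sqrt t; have s0 : 0 <= s by exact: sqrtr_ge0.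
pose rem y := g (x + s * y) + (- g x + (- (s * a x) * y + - (t / 2 * b x) * y ^+ 2)).
have Irem : gintegrable rem.
  by do ?apply: gintegrableD => //; exact: gintegrableZ.
have -> : heat t g x - g x - t / 2 * b x = gexp rem.
  rewrite /rem gexpD//; last by do ?apply: gintegrableD => //; exact: gintegrableZ.
  rewrite gexpD//; last by do ?apply: gintegrableD => //; exact: gintegrableZ.
  rewrite gexp_cst gexpD; do ?exact: gintegrableZ.
  by rewrite !gexpZ// M1 M2 /heat; ring.
have remB y : `|rem y| <= C * s ^+ 3 * `|y| ^+ 3.
  have := E x (s * y); rewrite !exprMn (normrM s) (ger0_norm s0) exprMn sqr_sqrtr// mulrA.
  by congr (`|_| <= _); rewrite /rem; field.
have -> : C * gexp (fun y => `|y| ^+ 3) * s ^+ 3 = C * s ^+ 3 * gexp (fun y => `|y| ^+ 3) by ring.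
rewrite ler_norml -mulNr -!gexpZ//; apply/andP; split; apply: gexp_le => //;
  do ?exact: gintegrableZ; by move=> y; have := remB y; rewrite ler_norml -?mulNr => /andP[].
Qed.

Lemma heat0 g x : heat 0 g x = g x.
Proof.
by rewrite /heat sqrtr0; under eq_fun do rewrite mul0r addr0; rewrite gexp_cst.
Qed.

Lemma normal_pdf_scale x (s : R) y : 0 < s ->
  normal_pdf x s (x + s * y) * s = normal_pdf 0 1 y.
Proof.
move=> s0; have sn0 : s != 0 by rewrite gt_eqF.
rewrite !normal_pdfE ?oner_neq0// /normal_fun mulrAC; congr (_ * _).
  rewrite /normal_peak -!mulrnAr sqrtrM ?sqr_ge0// sqrtr_sqr (gtr0_norm s0).
  by rewrite invfM mulrAC mulVf// mul1r expr1n !mul1r.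
congr expR; rewrite (addrC x) addrK subr0 exprMn -!mulNr.
by field; rewrite sn0.
Qed.

(** Substituting z = x + sqrt t y turns the semigroup law into an identity
    between normal densities. *)
Lemma heat_kernel t g x : 0 < t -> continuous g -> (forall y, 0 <= g y <= 1) ->
  (heat t g x)%:E = (\int[mu]_y (g y * normal_pdf x (Num.sqrt t) y)%:E)%E.
Proof.
move=> t0 cg g01; set s := Num.sqrt t; have s0 : 0 < s by rewrite sqrtr_gt0.
pose F y := x + s * y.
have dF y : is_derive y (1 : R) F s.
  by rewrite /F; apply: is_derive_eq; rewrite /GRing.scale/=; lra.
have F'E : F^`()%classic = cst s.
  by apply/funext => y; rewrite derive1E derive_val.
have mg := continuous_measurable_fun cg.
have -> : (heat t g x)%:E = (\int[mu]_y (g (F y) * normal_pdf 0 1 y)%:E)%E.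
  rewrite /heat /gexp /Rintegral fineK//; apply: integrable_fin_num => //.
  apply: (@gintegrable_bounded _ _ 1); first exact: measurable_affine.
  by move=> y; have /andP[? ?] := g01 (x + s * y); rewrite ger0_norm.
rewrite [RHS](@increasing_ge0_integration_by_substitutionT _ F); first last.
- by move=> y; rewrite mulr_ge0 ?normal_pdf_ge0//; have /andP[] := g01 y.
- move=> y; apply: cvgM; first exact: cg.
  by apply: continuous_normal_pdf; rewrite gt_eqF.
- apply: (@cvg_comp _ _ _ (fun y => s * y) (fun y => x + y) _ +oo%R).
    by apply: gt0_cvgMry => //; exact: cvg_id.
  exact: cvg_addrl.
- apply: (@cvg_comp _ _ _ (fun y => s * y) (fun y => x + y) _ -oo%R).
    by apply: gt0_cvgMrNy => //; exact: cvg_id.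
  exact: cvg_addrl_Ny.
- by move=> y; have [] := dF y.
- by rewrite F'E; exact: is_cvg_cst.
- by rewrite F'E; exact: is_cvg_cst.
- by rewrite F'E => y; exact: cvg_cst.
- by move=> y z yz; rewrite /F ltrD2l ltr_pM2l.
by apply: eq_integral => y _; rewrite F'E !fctE /= -mulrA normal_pdf_scale.
Qed.

(** The joint density of two successive Gaussian increments is the density
    of their sum times the conditional density of the first one. *)
Lemma normal_pdf_compose x y z s t : 0 < s -> 0 < t ->
  normal_pdf y (Num.sqrt t) z * normal_pdf x (Num.sqrt s) y =
  normal_pdf x (Num.sqrt (s + t)) z *
  normal_pdf ((t * x + s * z) / (s + t)) (Num.sqrt (s * t / (s + t))) y.
Proof.
move=> s0 t0; have st0 : 0 < s + t by rewrite addr_gt0.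
have k0 : 0 < s * t / (s + t) by rewrite divr_gt0// mulr_gt0.
have [s' t' st' k'] : [/\ 0 <= s, 0 <= t, 0 <= s + t & 0 <= s * t / (s + t)].
  by split; apply: ltW.
rewrite !normal_pdfE ?gt_eqF ?sqrtr_gt0// /normal_fun !sqr_sqrtr//.
rewrite mulrACA [RHS]mulrACA; congr (_ * _); last first.
  rewrite -!expRD; congr expR; field.
  by rewrite !gt_eqF.
rewrite /normal_peak -!invfM !sqr_sqrtr// -!sqrtrM ?mulrn_wge0 ?mulr_ge0 ?pi_ge0//.
congr (Num.sqrt _)^-1; rewrite -!mulrnAr.
by field; rewrite gt_eqF.
Qed.

Lemma measurable_normal_pdf2 (t : R) : t != 0 ->
  measurable_fun setT (fun p : R * R => normal_pdf p.1 t p.2).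
Proof.
move=> t0; under eq_fun do rewrite normal_pdfE//.
apply: measurable_funM => //; apply: measurableT_comp => //.
apply: measurable_funM => //; apply: measurableT_comp => //.
by apply: measurable_funX => //; exact: measurable_funB.
Qed.

(** A sum of independent Gaussian variables is Gaussian: after exchanging
    the integrals, the inner one is the total mass of the conditional
    density in [normal_pdf_compose]. *)
Lemma heat_semigroup C g a b s t x : 0 <= s -> 0 <= t -> jet2 C g a b ->
  heat s (heat t g) x = heat (s + t) g x.
Proof.
rewrite le_eqVlt => /predU1P[<- _ _|s0]; first by rewrite heat0 add0r.
rewrite le_eqVlt => /predU1P[<- _|t0 J].
  by rewrite addr0; congr (gexp _); apply/funext => y; rewrite heat0.
have st0 : 0 < s + t by rewrite addr_gt0.
have cg := jet2_continuous J; have mg := continuous_measurable_fun cg.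
have [g01 _ _ _] := J.
have cUg := jet2_continuous (heat_jet2 t J).
have [Ug01 _ _ _] := heat_jet2 t J.
have ks y : 0 <= normal_pdf x (Num.sqrt s) y by exact: normal_pdf_ge0.
have g0 y : 0 <= g y by have /andP[] := g01 y.
apply: EFin_inj; rewrite (heat_kernel x s0 cUg Ug01) (heat_kernel x st0 cg g01).
pose f (p : R * R) := (g p.2 * normal_pdf p.1 (Num.sqrt t) p.2 * normal_pdf x (Num.sqrt s) p.1)%:E.
transitivity (\int[mu]_y \int[mu]_z f (y, z))%E.
  apply: eq_integral => y _; rewrite EFinM (heat_kernel y t0 cg g01) -ge0_integralZr//.
  - apply/measurable_EFinP; apply: measurable_funM => //; exact: measurable_normal_pdf.
  - by move=> z _; rewrite lee_fin mulr_ge0 ?normal_pdf_ge0.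
  - by rewrite lee_fin.
have mf : measurable_fun setT f.
  apply/measurable_EFinP; apply: measurable_funM; last first.
    by apply: measurableT_comp => //; exact: measurable_normal_pdf.
  apply: measurable_funM; first exact: measurableT_comp.
  by apply: measurable_normal_pdf2; rewrite gt_eqF// sqrtr_gt0.
have f0 q : (0 <= f q)%E by rewrite lee_fin !mulr_ge0 ?normal_pdf_ge0.
transitivity (\int[mu]_z \int[mu]_y f (y, z))%E.
  exact: (@fubini_tonelli _ _ _ _ R (@lebesgue_measure R) (@lebesgue_measure R) f mf f0).
apply: eq_integral => z _; rewrite /f /=.
under eq_integral do rewrite -mulrA normal_pdf_compose// mulrA EFinM.
rewrite ge0_integralZl//.
- by rewrite integral_normal_pdf mule1.
- apply/measurable_EFinP; exact: measurable_normal_pdf.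
- by move=> y _; rewrite lee_fin normal_pdf_ge0.
- by rewrite lee_fin mulr_ge0 ?normal_pdf_ge0.
Qed.
End smoothing.

(** * Smooth cutoffs and the normal distribution function *)

Section cutoff.
Context {R : realType}.
Implicit Types (x h e y C : R).

Let pos x : R := Num.max x 0.
Let pos_ge x : 0 <= x -> pos x = x. Proof. by move=> x0; rewrite /pos max_l. Qed.
Let pos_le x : x <= 0 -> pos x = 0. Proof. by move=> x0; rewrite /pos max_r. Qed.

Let pos_cube x h :
  `|pos (x + h) ^+ 3 - pos x ^+ 3 - h * (3 * pos x ^+ 2) - h ^+ 2 / 2 * (6 * pos x)|
  <= `|h| ^+ 3.
Proof.
have mono u v : 0 <= u -> u <= v -> u ^+ 3 <= v ^+ 3 by move=> u0 uv; rewrite lerXn2r// nnegrE (le_trans u0).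
have [x0|x0] := leP 0 x; have [y0|y0] := leP 0 (x + h).
- rewrite !pos_ge// -normrX (_ : _ - _ = h ^+ 3)//; by field.
- rewrite (pos_ge x0) (pos_le (ltW y0)) -normrX.
  rewrite (_ : _ - _ = - (x ^+ 3 + 3 * h * x ^+ 2 + 3 * h ^+ 2 * x)); last by field.
  have h0 : h < 0 by lra.
  rewrite normrN normrX (ltr0_norm h0).
  have A : (- (x + h)) ^+ 3 <= (- h) ^+ 3 by apply: mono; lra.
  have B : 0 <= (- (x + h)) ^+ 3 by rewrite exprn_ge0//; lra.
  by apply/ler_normlP; split; lra.
- rewrite (pos_le (ltW x0)) pos_ge// expr0n/= !mulr0 !subr0.
  rewrite expr0n/= mulr0 mulr0 !subr0 ger0_norm ?exprn_ge0//; apply: mono => //.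
  by apply: le_trans (ler_norm h); lra.
- rewrite (pos_le (ltW x0)) (pos_le (ltW y0)) !expr0n/= !mulr0 !subr0 normr0.
  exact: exprn_ge0.
Qed.

(** One minus a primitive of the quadratic B-spline, written with third
    powers of positive parts; the weights 1, -3, 3, -1 make it constant
    outside [0, 3]. A and B are its first two derivatives. *)
Let G x := 1 - (pos x ^+ 3 - 3 * pos (x - 1) ^+ 3 + 3 * pos (x - 2) ^+ 3 - pos (x - 3) ^+ 3) / 6.
Let A x := - (pos x ^+ 2 - 3 * pos (x - 1) ^+ 2 + 3 * pos (x - 2) ^+ 2 - pos (x - 3) ^+ 2) / 2.
Let B x := - (pos x - 3 * pos (x - 1) + 3 * pos (x - 2) - pos (x - 3)).

Let cases x : x <= 0 \/ [\/ 0 <= x <= 1, 1 <= x <= 2, 2 <= x <= 3 | 3 <= x].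
Proof.
have [|x0] := leP x 0; first by left.
right; have [x1|x1] := leP x 1; first by constructor 1; rewrite ltW.
have [x2|x2] := leP x 2; first by constructor 2; rewrite ltW.
have [x3|x3] := leP x 3; first by constructor 3; rewrite ltW.
by constructor 4; apply: ltW.
Qed.

Let G_le0 x : x <= 0 -> G x = 1.
Proof. by move=> x0; rewrite /G !pos_le; lra. Qed.

Let G_ge3 x : 3 <= x -> G x = 0.
Proof. by move=> x0; rewrite /G !pos_ge; try lra; field. Qed.

Let G01 x : 0 <= G x <= 1.
Proof.
case: (cases x) => [x0|[|||x3]].
- by rewrite G_le0// ler01 lexx.
- move=> /andP[x0 x1]; rewrite /G (pos_ge x0) !pos_le; try lra.
  have : 0 <= x ^+ 3 by rewrite exprn_ge0.
  have : x ^+ 3 <= 1 by rewrite exprn_ile1.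
  by rewrite !expr0n /=; lra.
- move=> /andP[x1 x2]; rewrite /G (pos_le (_ : x - 2 <= 0)) ?(pos_le (_ : x - 3 <= 0)); try lra.
  rewrite !pos_ge; try lra.
  set v := x - 1; have v0 : 0 <= v by rewrite /v; lra.
  have v1 : v <= 1 by rewrite /v; lra.
  rewrite (_ : x = v + 1); last by rewrite /v; lra.
  have v3 : 0 <= v ^+ 3 by rewrite exprn_ge0.
  have v32 : v ^+ 3 <= v ^+ 2 by rewrite ler_wiXn2l.
  have v21 : v ^+ 2 <= v by rewrite expr2 ler_piMl.
  have vv : 0 <= (1 - v) ^+ 2 * (1 + 2 * v) by rewrite mulr_ge0 ?sqr_ge0//; lra.
  by rewrite expr0n /=; lra.
- move=> /andP[x2 x3]; rewrite /G (pos_le (_ : x - 3 <= 0)) ?pos_ge; try lra.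
  have u3 : 0 <= (3 - x) ^+ 3 by rewrite exprn_ge0//; lra.
  have u1 : (3 - x) ^+ 3 <= 1 by rewrite exprn_ile1//; lra.
  by rewrite expr0n /=; lra.
- by rewrite G_ge3// lexx ler01.
Qed.

Let A_bound x : `|A x| <= 12.
Proof.
have sq u : 0 <= pos u ^+ 2 by rewrite sqr_ge0.
have le9 u : u <= 3 -> pos u ^+ 2 <= 9.
  move=> u3; rewrite (_ : 9 = 3 ^+ 2); last by lra.
  rewrite lerXn2r ?nnegrE//; first by rewrite le_max lexx orbT.
  by rewrite ge_max u3/=.
have [x3|/ltW x3] := leP x 3; last first.
  rewrite (_ : A x = 0) ?normr0// /A !pos_ge; try lra; by field.
rewrite /A (pos_le (_ : x - 3 <= 0)); last lra.
have := sq x; have := sq (x - 1); have := sq (x - 2).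
have le4 u : u <= 2 -> pos u ^+ 2 <= 4.
  move=> u3; rewrite (_ : 4 = 2 ^+ 2); last by lra.
  rewrite lerXn2r ?nnegrE//; first by rewrite le_max lexx orbT.
  by rewrite ge_max u3/=.
have := le9 x x3; have := le4 (x - 1) _; have := le4 (x - 2) _.
move=> /(_ ltac:(lra)) ? /(_ ltac:(lra)) ? ? ? ? ?.
by rewrite expr0n /=; apply/ler_normlP; split; lra.
Qed.

Let B_bound x : `|B x| <= 12.
Proof.
have sq u : 0 <= pos u by rewrite le_max lexx orbT.
have le3 u : u <= 3 -> pos u <= 3 by move=> u3; rewrite ge_max u3/=.
have [x3|/ltW x3] := leP x 3; last first.
  by rewrite (_ : B x = 0) ?normr0// /B !pos_ge; lra.
rewrite /B (pos_le (_ : x - 3 <= 0)); last lra.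
have := sq x; have := sq (x - 1); have := sq (x - 2).
have le2 u : u <= 2 -> pos u <= 2 by move=> u3; rewrite ge_max u3/=.
have le1 u : u <= 1 -> pos u <= 1 by move=> u3; rewrite ge_max u3/=.
have := le3 x x3; have := le2 (x - 1) _; have := le1 (x - 2) _.
move=> /(_ ltac:(lra)) ? /(_ ltac:(lra)) ? ? ? ? ?.
by apply/ler_normlP; split; lra.
Qed.

Let G_jet : jet2 12 G A B.
Proof.
split=> // x h.
have := pos_cube x h; have := pos_cube (x - 1) h; have := pos_cube (x - 2) h.
have := pos_cube (x - 3) h.
have e (c : R) : x - c + h = x + h - c by ring.
rewrite !e; move=> /ler_normlP[? ?] /ler_normlP[? ?] /ler_normlP[? ?] /ler_normlP[? ?].
have h3 : 0 <= `|h| ^+ 3 by rewrite exprn_ge0.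
by rewrite /G /A /B; apply/ler_normlP; split; lra.
Qed.

(** Rescaling G to width e and translating it; C depends on e only because
    translations do not change the bounds. *)
Lemma smooth_cutoff e : 0 < e -> exists2 C, 0 <= C & forall x, exists g a b,
  [/\ jet2 C g a b, forall y, y <= x -> g y = 1 & forall y, x + e <= y -> g y = 0].
Proof.
move=> e0; pose k := 3 / e; have k0 : 0 < k by rewrite divr_gt0.
exists (12 * (1 + k + k ^+ 2 + k ^+ 3)).
  by rewrite mulr_ge0// !addr_ge0 ?exprn_ge0 ?ltW.
move=> x; exists (fun y => G (k * (y - x))),
  (fun y => k * A (k * (y - x))), (fun y => k ^+ 2 * B (k * (y - x))).
have k2 : 0 <= k ^+ 2 by rewrite exprn_ge0// ltW.
have k3 : 0 <= k ^+ 3 by rewrite exprn_ge0// ltW.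
have [_ Ab Bb E] := G_jet.
split; last 2 first.
- by move=> y yx; apply: G_le0; rewrite pmulr_rle0// subr_le0.
- move=> y yx; apply: G_ge3; rewrite /k mulrAC ler_pdivlMr//.
  by rewrite ler_pM2l//; lra.
split=> [y|y|y|y h].
- exact: G01.
- rewrite normrM (gtr0_norm k0).
  have : k * `|A (k * (y - x))| <= k * 12 by rewrite ler_pM2l.
  lra.
- rewrite normrM (ger0_norm k2).
  have : k ^+ 2 * `|B (k * (y - x))| <= k ^+ 2 * 12 by rewrite ler_wpM2l.
  lra.
- have := E (k * (y - x)) (k * h); rewrite (normrM k h) (gtr0_norm k0) (exprMn 3 k) -mulrDr.
  rewrite (_ : y - x + h = y + h - x); last by ring.
  have h3 : 0 <= `|h| ^+ 3 by rewrite exprn_ge0.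
  set r := (X in `|X| <= _ -> _) => H.
  rewrite (_ : _ - _ = r); last by rewrite /r; field.
  apply: le_trans H _; rewrite mulrA ler_wpM2r//; lra.
Qed.

Let Phi (x : R) : R := fine (normal_prob 0 1 `]-oo, x]%classic).

Lemma normal_cdf_gexp x : Phi x = gexp (\1_`]-oo, x]%classic : R -> R).
Proof.
rewrite /Phi /gexp /Rintegral /normal_prob; congr fine; rewrite [in LHS]integral_mkcond/=.
apply: eq_integral => y _; rewrite patchE indicE /=.
by case: ifP => _; rewrite ?mul1r ?mul0r.
Qed.

Lemma gint_indic x : gintegrable (\1_`]-oo, x]%classic : R -> R).
Proof.
apply: (@gintegrable_bounded _ _ 1) => // y.
by rewrite indicE; case: (_ \in _); rewrite ?normr1 ?normr0.
Qed.

Lemma heat1_le_normal_cdf C (g a b : R -> R) x : jet2 C g a b ->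
  (forall y, x <= y -> g y = 0) -> heat 1 g 0 <= Phi x.
Proof.
move=> J g0; have [mg _ _] := jet2_measurable J; have [g01 _ _ _] := J.
rewrite normal_cdf_gexp /heat sqrtr1; apply: gexp_le.
- apply: (@gintegrable_bounded _ _ 1); first exact: measurable_affine.
  by move=> y; have /andP[? ?] := g01 (0 + 1 * y); rewrite ger0_norm.
- exact: gint_indic.
- move=> y; rewrite mul1r add0r indicE; case: (boolP (y \in _)) => yx.
    by have /andP[] := g01 y.
  rewrite g0//; move: yx; rewrite notin_setE/= in_itv/=.
  by move=> /negP; rewrite -ltNge => /ltW.
Qed.

Lemma normal_cdf_le_heat1 C (g a b : R -> R) x : jet2 C g a b ->
  (forall y, y <= x -> g y = 1) -> Phi x <= heat 1 g 0.
Proof.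
move=> J g0; have [mg _ _] := jet2_measurable J; have [g01 _ _ _] := J.
rewrite normal_cdf_gexp /heat sqrtr1; apply: gexp_le.
- exact: gint_indic.
- apply: (@gintegrable_bounded _ _ 1); first exact: measurable_affine.
  by move=> y; have /andP[? ?] := g01 (0 + 1 * y); rewrite ger0_norm.
- move=> y; rewrite mul1r add0r indicE; case: (boolP (y \in _)) => yx.
    by rewrite g0//; move: yx; rewrite inE/= in_itv.
  by have /andP[] := g01 y.
Qed.

(** The normal density is bounded by its peak. *)
Lemma normal_cdf_lipschitz x e : 0 <= e -> Phi (x + e) <= Phi x + normal_peak 1 * e.
Proof.
move=> e0; have fin y : normal_prob (0 : R) 1 `]-oo, y]%classic \is a fin_num by exact: fin_num_measure.
rewrite /Phi -lee_fin EFinD !fineK//.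
have -> : `]-oo, x + e]%classic = `]-oo, x]%classic `|` `]x, (x + e)%R]%classic :> set R.
  by rewrite -itv_bndbnd_setU// bnd_simp lerDl.
apply: le_trans (measureU2 _ _ _) _ => //=; rewrite leeD2l//.
rewrite /normal_prob.
apply: (@le_trans _ _ (\int[@lebesgue_measure R]_(y in `]x, (x + e)%R]) (normal_peak 1 : R)%:E)%E).
  apply: ge0_le_integral => //=.
  - by move=> y _; rewrite lee_fin normal_pdf_ge0.
  - by apply/measurable_EFinP/measurable_funTS; exact: measurable_normal_pdf.
  - by move=> y _; rewrite lee_fin normal_pdf_ub// oner_neq0.
rewrite integral_cst//= lebesgue_measure_itv/=; case: ifP => _.
  by rewrite -EFinB -EFinM addrAC subrr add0r.
by rewrite mule0 lee_fin mulr_ge0// normal_peak_ge0.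
Qed.
End cutoff.

(** * Averages over a finite set *)

Section finite_expectation.
Context {R : realType} {I : finType} (p : I -> R).
Implicit Types (f g : I -> R).

Definition fexp f : R := \sum_i p i * f i.

Lemma fexpD f g : fexp (fun i => f i + g i) = fexp f + fexp g.
Proof. by rewrite /fexp -big_split; apply: eq_bigr => i _; rewrite mulrDr. Qed.

Lemma fexpZ c f : fexp (fun i => c * f i) = c * fexp f.
Proof. by rewrite /fexp mulr_sumr; apply: eq_bigr => i _; rewrite mulrCA. Qed.

Lemma fexp_cst c : \sum_i p i = 1 -> fexp (fun=> c) = c.
Proof. by move=> p1; rewrite /fexp -mulr_suml p1 mul1r. Qed.

Lemma fexp_le f g : (forall i, 0 <= p i) -> (forall i, f i <= g i) -> fexp f <= fexp g.
Proof. by move=> p0 fg; apply: ler_sum => i _; rewrite ler_wpM2l. Qed.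

Lemma fexp_norm_le f g : (forall i, 0 <= p i) -> (forall i, `|f i| <= g i) ->
  `|fexp f| <= fexp g.
Proof.
move=> p0 fg; apply: le_trans (ler_norm_sum _ _ _) _; apply: ler_sum => i _.
by rewrite normrM ger0_norm// ler_wpM2l.
Qed.
End finite_expectation.

Lemma norm_prod_le1 {R : realType} {I : Type} (r : seq I) (f : I -> R) :
  (forall i, 0 <= f i <= 1) -> `|\prod_(i <- r) f i| <= 1.
Proof.
move=> f01; have f0 i : 0 <= f i by have /andP[] := f01 i.
rewrite ger0_norm ?prodr_ge0//; elim: r => [|i r IH]; first by rewrite big_nil.
by rewrite big_cons mulr_ile1 ?prodr_ge0//; have /andP[] := f01 i.
Qed.

(** * Lindeberg's replacement for one summand *)

Section lindeberg.
Context {R : realType} {d : nat}.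
Implicit Types (r : seq 'I_d) (v : 'rV[R]_d) (g a b : 'I_d -> R -> R) (y : 'I_d -> R).

Lemma ler_norm_mul (x y s t : R) : `|x| <= s -> `|y| <= t -> `|x * y| <= s * t.
Proof. by move=> xs yt; rewrite normrM ler_pM. Qed.

Let m3 : R := gexp (fun z : R => `|z| ^+ 3).

(** The product of the g k has an expansion c + L v + q v / 2, and, since X
    has mean 0 and covariance t times the identity, L has mean 0 and q has
    mean t tau. The product of the heated factors has the expansion c + t /
    2 tau with the same c and tau, so that replacing X by a Gaussian vector
    changes the mean by cubic terms only. Factors are added one at a time;
    the third clause is what makes the cross terms with the next factor
    average to 0. The constant K depends on C and r alone, hence neither on
    the weights nor on the point y. *)
Lemma product_jet (C : R) r : 0 <= C -> uniq r -> exists2 K : R, 0 <= K &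
  forall (I : finType) (p : I -> R) (X : I -> 'rV[R]_d) (t : R),
  (forall k, fexp p (fun i => X i 0 k) = 0) ->
  (forall k l, fexp p (fun i => X i 0 k * X i 0 l) = t * (k == l)%:R) ->
  0 <= t <= 1 ->
  forall g a b y, (forall k, jet2 C (g k) (a k) (b k)) ->
  exists c (L q : 'rV[R]_d -> R) tau,
  [/\ [/\ `|c| <= K, forall v, `|L v| <= K * `|v|,
        forall v, `|q v| <= K * `|v| ^+ 2 & `|tau| <= K],
      fexp p (fun i => L (X i)) = 0,
      forall k, k \notin r -> fexp p (fun i => X i 0 k * L (X i)) = 0,
      fexp p (fun i => q (X i)) = t * tau &
      (forall v, `|\prod_(k <- r) g k (y k + v 0 k) - c - L v - q v / 2| <= K * `|v| ^+ 3) /\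
      `|\prod_(k <- r) heat t (g k) (y k) - c - t / 2 * tau| <= K * Num.sqrt t ^+ 3].
Proof.
move=> C0; have m30 : 0 <= m3 by exact: gexp_cube_ge0.
elim: r => [_|k r IH /= /andP[kr /IH[K K0 H]]].
  exists 1 => // I p X t _ _ /andP[t0 _] g a b y _.
  exists 1, (fun=> 0), (fun=> 0), 0; split.
  - by split=> [|v|v|]; rewrite ?normr0 ?normr1 ?mul1r ?exprn_ge0.
  - by rewrite /fexp big1// => i _; rewrite mulr0.
  - by move=> k _; rewrite /fexp big1// => i _; rewrite !mulr0.
  - by rewrite mulr0 /fexp big1// => i _; rewrite mulr0.
  - split=> [v|]; rewrite big_nil mul1r.
      by rewrite subrr !(mul0r, subr0) normr0 exprn_ge0.
    by rewrite subrr mulr0 subr0 normr0 exprn_ge0.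
have KC0 : 0 <= K * C by rewrite mulr_ge0.
have KCm0 : 0 <= K * (C * m3) by rewrite mulr_ge0// mulr_ge0.
pose K' := 1 + 3 * K + 5 * (K * C) + 2 * (K * (C * m3)).
have K'0 : 0 <= K' by rewrite /K'; lra.
exists K' => // I p X t E1 E2 t01 g a b y J; have /andP[t0 t1] := t01.
have [c [L [q [tau [[cK LK qK tauK] EL EXL Eq [PE HE]]]]]] := H I p X t E1 E2 t01 g a b y J.
have [g01 aC bC E] := J k.
set gk := g k (y k); set ak := a k (y k); set bk := b k (y k).
have gk1 : `|gk| <= 1 by have /andP[? ?] := g01 (y k); rewrite ger0_norm.
have akC : `|ak| <= C by exact: aC.
have bkC : `|bk| <= C by exact: bC.
exists (gk * c), (fun v => gk * L v + c * ak * v 0 k),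
  (fun v => gk * q v + (c * bk * (v 0 k * v 0 k) + 2 * ak * (v 0 k * L v))),
  (gk * tau + c * bk).
have LB v : `|gk * L v + c * ak * v 0 k| <= (K + K * C) * `|v|.
  apply: le_trans (ler_normD _ _) _.
  have := ler_norm_mul gk1 (LK v).
  have := ler_norm_mul (ler_norm_mul cK akC) (norm_coord v k); lra.
have qB v : `|gk * q v + (c * bk * (v 0 k * v 0 k) + 2 * ak * (v 0 k * L v))| <=
    (K + 3 * (K * C)) * `|v| ^+ 2.
  apply: le_trans (ler_normD _ _) _; apply: le_trans (lerD (lexx _) (ler_normD _ _)) _.
  have h1 := ler_norm_mul gk1 (qK v).
  have h2 := ler_norm_mul (ler_norm_mul cK bkC) (ler_norm_mul (norm_coord v k) (norm_coord v k)).
  have h3 := ler_norm_mul akC (ler_norm_mul (norm_coord v k) (LK v)).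
  by rewrite -[2 * ak * _]mulrA (normrM 2) (ger0_norm (_ : 0 <= 2))//; lra.
split.
- split.
  + by have := ler_norm_mul gk1 cK; rewrite /K'; lra.
  + by move=> v; apply: le_trans (LB v) _; rewrite ler_wpM2r// /K'; lra.
  + by move=> v; apply: le_trans (qB v) _; rewrite ler_wpM2r ?exprn_ge0// /K'; lra.
  + apply: le_trans (ler_normD _ _) _.
    by have := ler_norm_mul gk1 tauK; have := ler_norm_mul cK bkC; rewrite /K'; lra.
- by rewrite fexpD !fexpZ EL E1; ring.
- move=> j; rewrite inE negb_or => /andP[jk jr].
  under eq_fun do rewrite mulrDr mulrCA [X in _ + X]mulrCA.
  by rewrite fexpD !fexpZ EXL// E2 (negbTE jk) mulr0n; ring.
- by rewrite !(fexpD, fexpZ) Eq E2 eqxx mulr1n EXL//; ring.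
split=> [v|]; last first.
  rewrite big_cons; set h := heat t (g k) (y k); set HP := \prod_(j <- r) _.
  have [h01 _ _ _] := heat_jet2 t (J k).
  have h1 : `|h| <= 1 by have /andP[? ?] := h01 (y k); rewrite ger0_norm.
  have hE := heat_expand (y k) t0 (J k); rewrite -/h -/gk -/bk -/m3 in hE.
  set u := Num.sqrt t ^+ 3; rewrite -/u in hE; rewrite -/HP -/u in HE.
  have u0 : 0 <= u by rewrite exprn_ge0// sqrtr_ge0.
  have tu : t ^+ 2 <= u.
    have e : t = Num.sqrt t ^+ 2 by rewrite sqr_sqrtr.
    rewrite {1}e -exprM /u ler_wiXn2l ?sqrtr_ge0//.
    by rewrite -sqrtr1 ler_sqrt.
  have -> : h * HP - gk * c - t / 2 * (gk * tau + c * bk) =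
    (HP - c - t / 2 * tau) * h + ((c + t / 2 * tau) * (h - gk - t / 2 * bk)
     + t ^+ 2 * (tau * bk) / 4) by field.
  have b1 := ler_norm_mul HE h1.
  have b2 : `|c + t / 2 * tau| <= 2 * K.
    apply: le_trans (ler_normD _ _) _.
    have : `|t / 2| <= 1 by rewrite ger0_norm; lra.
    by move=> /ler_norm_mul/(_ tauK); lra.
  have b3 := ler_norm_mul b2 hE.
  have b4 : `|t ^+ 2 * (tau * bk) / 4| <= K * C * u.
    rewrite -mulrA; have : `|t ^+ 2| <= u by rewrite ger0_norm ?sqr_ge0.
    move=> /ler_norm_mul/(_ (ler_norm_mul (ler_norm_mul tauK bkC) (lexx `|4^-1|))).
    move=> /le_trans; apply.
    rewrite (ger0_norm (_ : 0 <= 4^-1)) ?invr_ge0//.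
    by have := mulr_ge0 u0 KC0; lra.
  apply: le_trans (ler_normD _ _) _; apply: le_trans (lerD (lexx _) (ler_normD _ _)) _.
  have e1 : 0 <= K * u by rewrite mulr_ge0.
  have e2 : 0 <= K * C * u by rewrite mulr_ge0.
  have e3 : 0 <= K * (C * m3) * u by rewrite mulr_ge0.
  by rewrite /K'; lra.
rewrite big_cons; set G := g k _; set P := \prod_(j <- r) _; rewrite -/P in PE.
set n := `|v|; have n0 : 0 <= n by exact: normr_ge0.
have G1 : `|G| <= 1 by have /andP[? ?] := g01 (y k + v 0 k); rewrite ger0_norm.
have P1 : `|P| <= 1 by apply: norm_prod_le1 => j; have [h _ _ _] := J j; exact: h.
have xn : `|v 0 k| <= n := norm_coord v k.
(* Far from the origin each term is bounded by a multiple of n^3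
   separately; near it, the errors of the two expansions are multiplied
   out. *)
have [n1|/ltW n1] := leP n 1; last first.
  have n3 : 1 <= n ^+ 3 by rewrite exprn_ege1.
  have n13 : n <= n ^+ 3 by rewrite -{1}[n]expr1 ler_weXn2l.
  have n23 : n ^+ 2 <= n ^+ 3 by rewrite ler_weXn2l.
  have PG := ler_norm_mul G1 P1.
  have cg := ler_norm_mul gk1 cK.
  have h1 := LB v; have h2 := qB v; rewrite -/n in h1 h2.
  have k1 : (K + K * C) * n <= (K + K * C) * n ^+ 3 by rewrite ler_wpM2l// addr_ge0.
  have k2 : (K + 3 * (K * C)) * n ^+ 2 <= (K + 3 * (K * C)) * n ^+ 3.
    by rewrite ler_wpM2l// addr_ge0// mulr_ge0.
  have k3 : K <= K * n ^+ 3 by rewrite ler_peMr.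
  have k4 : 0 <= K * (C * m3) * n ^+ 3 by rewrite mulr_ge0// exprn_ge0.
  have k5 : 0 <= K * C * n ^+ 3 by rewrite mulr_ge0// exprn_ge0.
  rewrite (_ : K' * _ = n ^+ 3 + 3 * (K * n ^+ 3) + 5 * (K * C * n ^+ 3) + 2 * (K * (C * m3) * n ^+ 3)); last first.
    by rewrite /K'; ring.
  rewrite (_ : (K + K * C) * n ^+ 3 = K * n ^+ 3 + K * C * n ^+ 3) in k1; last by ring.
  rewrite (_ : (K + 3 * (K * C)) * n ^+ 3 = K * n ^+ 3 + 3 * (K * C * n ^+ 3)) in k2; last by ring.
  move: (le_trans h1 k1) (le_trans h2 k2) PG cg; rewrite !mul1r.
  set X1 := _ + c * ak * _; set X2 := _ + (_ + _).
  move: k3 k4 k5 n3.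
  move: (G * P) (gk * c) X1 X2 (K * n ^+ 3) (K * C * n ^+ 3) (K * (C * m3) * n ^+ 3) (n ^+ 3).
  clear => X0 X1 X2 X3 A B D E ? ? ? ? /ler_normlP[? ?] /ler_normlP[? ?] /ler_normlP[? ?] /ler_normlP[? ?].
  by apply/ler_normlP; split; lra.
have rE := E (y k) (v 0 k); rewrite -/G -/gk -/ak -/bk in rE.
have x3 : `|v 0 k| ^+ 3 <= n ^+ 3 by rewrite lerXn2r ?nnegrE.
have {}rE := le_trans rE (ler_wpM2l C0 x3).
pose X1 := (P - c - L v - q v / 2) * G.
pose X2 := (c + L v + q v / 2) * (G - gk - v 0 k * ak - v 0 k ^+ 2 / 2 * bk).
pose X3 := L v * bk * (v 0 k * v 0 k).
pose X4 := q v * ak * v 0 k.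
pose X5 := q v * bk * (v 0 k * v 0 k).
have -> : G * P - gk * c - (gk * L v + c * ak * v 0 k) -
   (gk * q v + (c * bk * (v 0 k * v 0 k) + 2 * ak * (v 0 k * L v))) / 2 =
   X1 + (X2 + (X3 / 2 + (X4 / 2 + X5 / 4))) by rewrite /X1 /X2 /X3 /X4 /X5; field.
have n2 : n ^+ 2 <= n by rewrite expr2 ler_piMl.
have n43 : n ^+ 4 <= n ^+ 3 by rewrite ler_wiXn2l.
have b1 := ler_norm_mul (PE v) G1; rewrite -/n in b1.
have LKv := LK v; have qKv := qK v; rewrite -/n in LKv qKv.
have QB : `|c + L v + q v / 2| <= 3 * K.
  have l1 : K * n <= K by rewrite ler_piMr.
  have l2 : K * n ^+ 2 <= K by rewrite ler_piMr// (le_trans n2).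
  move: (le_trans LKv l1) (le_trans qKv l2) cK; move: (L v) (q v) => lv qv.
  clear => /ler_normlP[? ?] /ler_normlP[? ?] /ler_normlP[? ?].
  by apply/ler_normlP; split; lra.
have b2 := ler_norm_mul QB rE.
have b3 := ler_norm_mul (ler_norm_mul LKv bkC) (ler_norm_mul xn xn).
have b4 := ler_norm_mul (ler_norm_mul qKv akC) xn.
have b5 := ler_norm_mul (ler_norm_mul qKv bkC) (ler_norm_mul xn xn).
have k4 : 0 <= K * (C * m3) * n ^+ 3 by rewrite mulr_ge0// exprn_ge0.
have k5 : 0 <= K * C * n ^+ 3 by rewrite mulr_ge0// exprn_ge0.
have k6 : 0 <= K * n ^+ 3 by rewrite mulr_ge0// exprn_ge0.
have k7 : K * C * n ^+ 4 <= K * C * n ^+ 3 by rewrite ler_wpM2l.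
have n30 : 0 <= n ^+ 3 by rewrite exprn_ge0.
rewrite -/X1 in b1; rewrite -/X2 in b2; rewrite -/X3 in b3.
rewrite -/X4 in b4; rewrite -/X5 in b5.
have {}b3 : `|X3| <= K * C * n ^+ 3 by rewrite (le_trans b3)// le_eqVlt; apply/orP; left; apply/eqP; ring.
have {}b4 : `|X4| <= K * C * n ^+ 3 by rewrite (le_trans b4)// le_eqVlt; apply/orP; left; apply/eqP; ring.
have {}b5 : `|X5| <= K * C * n ^+ 3.
  by rewrite (le_trans b5)// (le_trans _ k7)// le_eqVlt; apply/orP; left; apply/eqP; ring.
rewrite (_ : K' * _ = n ^+ 3 + 3 * (K * n ^+ 3) + 5 * (K * C * n ^+ 3) + 2 * (K * (C * m3) * n ^+ 3)); last first.
  by rewrite /K'; ring.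
rewrite (_ : _ * (C * _) = 3 * (K * C * n ^+ 3)) in b2; last by ring.
rewrite mulr1 in b1.
move: X1 X2 X3 X4 X5 (K * n ^+ 3) (K * C * n ^+ 3) (K * (C * m3) * n ^+ 3) (n ^+ 3) b1 b2 b3 b4 b5 k4 k5 k6 n30.
clear.
move=> X1 X2 X3 X4 X5 A B D E /ler_normlP[? ?] /ler_normlP[? ?] /ler_normlP[? ?] /ler_normlP[? ?] /ler_normlP[? ?] ? ? ? ?.
by apply/ler_normlP; split; lra.
Qed.
End lindeberg.

(** * Independent draws from a finite set *)

Section resampling.
Context {R : realType} {I : finType} (p : I -> R).

Definition rexp (s : nat) (f : s.-tuple I -> R) : R :=
  \sum_(k : s.-tuple I) (\prod_(j < s) p (tnth k j)) * f k.

Lemma rexp0 (f : 0.-tuple I -> R) : rexp f = f [tuple].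
Proof.
rewrite /rexp (big_pred1 [tuple]) ?big_ord0 ?mul1r// => k.
by apply/esym/eqP/val_inj; rewrite /= tuple0.
Qed.

(** Conditioning on the first draw. *)
Lemma rexpS (s : nat) (f : s.+1.-tuple I -> R) :
  rexp f = fexp p (fun i => rexp (fun k : s.-tuple I => f [tuple of i :: k])).
Proof.
rewrite /rexp /fexp; under [RHS]eq_bigr do rewrite mulr_sumr.
rewrite pair_big/= (reindex (fun q : I * s.-tuple I => [tuple of q.1 :: q.2])) /=; last first.
  exists (fun k => (thead k, [tuple of behead k])) => [[i k] _|k _] /=.
    by congr (_, _); apply/val_inj.
  by rewrite [RHS]tuple_eta.
apply: eq_bigr => -[i k] _ /=; rewrite mulrA big_ord_recl; congr (_ * _ * _).
by apply: eq_bigr => j _; rewrite tnthS.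
Qed.

Context (s : nat).
Implicit Types (f g : s.-tuple I -> R).

Lemma rexpD f g : rexp (fun k => f k + g k) = rexp f + rexp g.
Proof. by rewrite /rexp -big_split; apply: eq_bigr => i _; rewrite mulrDr. Qed.

Lemma rexpZ c f : rexp (fun k => c * f k) = c * rexp f.
Proof. by rewrite /rexp mulr_sumr; apply: eq_bigr => i _; rewrite mulrCA. Qed.

Hypothesis p0 : forall i, 0 <= p i.

Lemma rexp_le f g : (forall k, f k <= g k) -> rexp f <= rexp g.
Proof.
move=> fg; apply: ler_sum => k _; rewrite ler_wpM2l// prodr_ge0// => j _.
Qed.
End resampling.

Section resampling_moments.
Context {R : realType} {I : finType} (p : I -> R).
Hypotheses (p0 : forall i, 0 <= p i) (p1 : \sum_i p i = 1).

Lemma rexp_cst s c : rexp p (fun _ : s.-tuple I => c) = c.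
Proof.
elim: s => [|s IHs]; first by rewrite rexp0.
by rewrite rexpS; under eq_fun do rewrite IHs; rewrite fexp_cst.
Qed.

Lemma sum_tnth_cons (V : nmodType) s (a : I -> V) i (k : s.-tuple I) :
  \sum_(j < s.+1) a (tnth [tuple of i :: k] j) = a i + \sum_(j < s) a (tnth k j).
Proof. by rewrite big_ord_recl tnth0; under eq_bigr do rewrite tnthS. Qed.

Lemma rexp_sum s (a : I -> R) :
  rexp p (fun k : s.-tuple I => \sum_(j < s) a (tnth k j)) = s%:R * fexp p a.
Proof.
elim: s => [|s IHs]; first by rewrite rexp0 big_ord0 mul0r.
rewrite rexpS.
under eq_fun => i.
  under eq_fun do rewrite sum_tnth_cons.
  rewrite rexpD rexp_cst IHs.
  over.
by rewrite fexpD fexp_cst// mulrSr mulrDl mul1r addrC.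
Qed.

(** The cross terms of the square vanish because the terms are centred and
    the draws are independent. *)
Lemma rexp_sum_sqr s (a : I -> R) : fexp p a = 0 ->
  rexp p (fun k : s.-tuple I => (\sum_(j < s) a (tnth k j)) ^+ 2) =
  s%:R * fexp p (fun i => a i ^+ 2).
Proof.
move=> a0; elim: s => [|s IHs]; first by rewrite rexp0 big_ord0 mul0r expr0n.
rewrite rexpS.
under eq_fun => i.
  under eq_fun do rewrite sum_tnth_cons sqrrD -mulr_natl mulrA -addrA.
  rewrite /= !rexpD rexp_cst IHs rexpZ rexp_sum a0 !mulr0 add0r.
  over.
by rewrite fexpD fexp_cst// mulrSr mulrDl mul1r addrC.
Qed.

Lemma rexp_markov s (f : s.-tuple I -> R) (c : R) : 0 < c -> (forall k, 0 <= f k) ->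
  rexp p (fun k => (c < f k)%R%:R) <= rexp p f / c.
Proof.
move=> c0 f0; rewrite mulrC -rexpZ; apply: rexp_le => // k.
case: ltP => [cf|_]; last by rewrite mulr_ge0// invr_ge0 ltW.
by rewrite mulrC ler_pdivlMr// mul1r ltW.
Qed.

Lemma rexp_chebyshev s (a : I -> R) (c : R) : 0 < c -> fexp p a = 0 ->
  rexp p (fun k : s.-tuple I => (c < `|\sum_(j < s) a (tnth k j)|)%R%:R) <=
  s%:R * fexp p (fun i => a i ^+ 2) / c ^+ 2.
Proof.
move=> c0 a0; rewrite -rexp_sum_sqr//.
have c20 : 0 < c ^+ 2 by rewrite exprn_gt0.
apply: le_trans (rexp_markov c20 _) => [|k]; last exact: sqr_ge0.
apply: rexp_le => // k; rewrite ler_nat.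
case: ltP => // ca; rewrite (_ : (_ < _) = true)//.
by rewrite -[ltRHS]real_normK ?num_real// ltrXn2r// ltW.
Qed.
End resampling_moments.

(** * The central limit theorem with explicit error *)

Section clt.
Context {R : realType} {d : nat}.
Implicit Types (g a b : 'I_d -> R -> R) (y : 'I_d -> R).

(** By [product_jet], both means have the same expansion up to cubic terms. *)
Lemma lindeberg_step (C : R) : 0 <= C -> exists2 K : R, 0 <= K &
  forall (I : finType) (p : I -> R) (X : I -> 'rV[R]_d) (t : R),
  (forall i, 0 <= p i) -> \sum_i p i = 1 ->
  (forall k, fexp p (fun i => X i 0 k) = 0) ->
  (forall k l, fexp p (fun i => X i 0 k * X i 0 l) = t * (k == l)%:R) ->
  0 <= t <= 1 ->
  forall g a b y, (forall k, jet2 C (g k) (a k) (b k)) ->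
  `|fexp p (fun i => \prod_k g k (y k + X i 0 k)) - \prod_k heat t (g k) (y k)| <=
  K * (fexp p (fun i => `|X i| ^+ 3) + Num.sqrt t ^+ 3).
Proof.
move=> C0; have [K K0 H] := product_jet C0 (index_enum_uniq 'I_d).
exists K => // I p X t p0 p1 E1 E2 t01 g a b y J.
have [c [L [q [tau [_ EL _ Eq [PE HE]]]]]] := H I p X t E1 E2 t01 g a b y J.
rewrite [X in `|X|](_ : _ =
  fexp p (fun i => \prod_k g k (y k + X i 0 k) +
     (- c + (-1 * L (X i) + - 2^-1 * q (X i))))
  - (\prod_k heat t (g k) (y k) - c - t / 2 * tau)); last first.
  by rewrite fexpD fexpD (fexp_cst _ p1) fexpD !fexpZ EL Eq; field.
apply: le_trans (ler_normB _ _) _; rewrite mulrDr lerD//.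
rewrite -fexpZ; apply: fexp_norm_le => // i.
by have := PE (X i); congr (`|_| <= _); field.
Qed.

(** The draws are replaced one after the other. The part that is already
    Gaussian enters through the heated factors, which are jets with the same
    C, so that all replacements cost the same. *)
Lemma lindeberg_product (C : R) : 0 <= C -> exists2 K : R, 0 <= K &
  forall (I : finType) (p : I -> R) (X : I -> 'rV[R]_d) (t : R),
  (forall i, 0 <= p i) -> \sum_i p i = 1 ->
  (forall k, fexp p (fun i => X i 0 k) = 0) ->
  (forall k l, fexp p (fun i => X i 0 k * X i 0 l) = t * (k == l)%:R) ->
  0 <= t <= 1 ->
  forall s g a b y, (forall k, jet2 C (g k) (a k) (b k)) ->
  `|rexp p (fun h : s.-tuple I => \prod_k g k (y k + \sum_(j < s) X (tnth h j) 0 k))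
    - \prod_k heat (s%:R * t) (g k) (y k)| <=
  s%:R * (K * (fexp p (fun i => `|X i| ^+ 3) + Num.sqrt t ^+ 3)).
Proof.
move=> C0; have [K K0 H] := lindeberg_step C0.
exists K => // I p X t p0 p1 E1 E2 t01 s g a b.
set e := K * _; have /andP[t0 t1] := t01.
elim: s => [|s IHs] y J.
  rewrite rexp0 !mul0r; under [X in X - _]eq_bigr do rewrite big_ord0 addr0.
  by under [X in _ - X]eq_bigr do rewrite heat0; rewrite subrr normr0.
rewrite rexpS.
have Hs k : jet2 C (heat (s%:R * t) (g k)) (heat (s%:R * t) (a k)) (heat (s%:R * t) (b k)).
  exact: heat_jet2.
have S1 := H I p X t p0 p1 E1 E2 t01 _ _ _ y Hs; rewrite -/e in S1.
have -> : \prod_k heat (s.+1%:R * t) (g k) (y k) =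
    \prod_k heat t (heat (s%:R * t) (g k)) (y k).
  apply: eq_bigr => k _; rewrite (heat_semigroup _ _ _ (J k)) ?mulr_ge0//.
  by rewrite mulrSr mulrDl mul1r addrC.
rewrite [X in `|X|](_ : _ =
  fexp p (fun i => rexp p (fun h : s.-tuple I => \prod_k g k (y k + X i 0 k + \sum_(j < s) X (tnth h j) 0 k)) +
     -1 * \prod_k heat (s%:R * t) (g k) (y k + X i 0 k)) +
  (fexp p (fun i => \prod_k heat (s%:R * t) (g k) (y k + X i 0 k)) -
   \prod_k heat t (heat (s%:R * t) (g k)) (y k))); last first.
  rewrite fexpD fexpZ mulN1r addrA subrK; congr (fexp p _ - _); apply/funext => i.
  congr rexp; apply/funext => h; apply: eq_bigr => k _.
  by rewrite (sum_tnth_cons (fun i => X i 0 k)) addrA.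
rewrite mulrSr mulrDl mul1r; apply: le_trans (ler_normD _ _) _; rewrite lerD//.
rewrite -(fexp_cst (s%:R * e) p1); apply: fexp_norm_le => // i.
by rewrite mulN1r; apply: (IHs (fun k => y k + X i 0 k)).
Qed.
End clt.

(** Telescoping: the factors are exchanged one at a time. *)
Lemma prod_dist_le {R : realType} {I : Type} (r : seq I) (f g : I -> R) :
  (forall i, 0 <= f i <= 1) -> (forall i, 0 <= g i <= 1) ->
  `|\prod_(i <- r) f i - \prod_(i <- r) g i| <= \sum_(i <- r) `|f i - g i|.
Proof.
move=> f01 g01;
elim: r => [|i r IH]; first by rewrite !big_nil subrr normr0.
rewrite !big_cons; set F := \prod_(j <- r) f j; set G := \prod_(j <- r) g j.
have -> : f i * F - g i * G = (f i - g i) * F + g i * (F - G) by ring.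
apply: le_trans (ler_normD _ _) _; rewrite !normrM; apply: lerD.
  by rewrite ler_piMr// norm_prod_le1.
apply: le_trans IH; rewrite ler_piMl//.
by have /andP[? ?] := g01 i; rewrite ger0_norm.
Qed.

Section clt_cdf.
Context {R : realType} {d : nat}.

Let Phi (x : R) : R := fine (normal_prob 0 1 `]-oo, x]%classic).

(** The indicator of an orthant is squeezed between products of smooth
    cutoffs of width eta, moved by eta to the right and by 2 eta to the left
    of x; one eta absorbs the remainder D - S, the other the width of the
    cutoffs. The Lipschitz bound on the normal distribution function turns
    these shifts into an error proportional to eta. The integer N depends
    only on the bound M for the third moments, and therefore serves all laws
    on all finite sets at once. *)
Lemma clt_with_remainder (x : 'rV[R]_d) (M e : R) : 0 <= M -> 0 < e ->
  exists eta N, 0 < eta /\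
  forall (I : finType) (p : I -> R) (X : I -> 'rV[R]_d) (s : nat)
    (D : s.-tuple I -> 'rV[R]_d),
  (N <= s)%N -> (0 < s)%N -> (forall i, 0 <= p i) -> \sum_i p i = 1 ->
  (forall k, fexp p (fun i => X i 0 k) = 0) ->
  (forall k l, fexp p (fun i => X i 0 k * X i 0 l) = (k == l)%:R) ->
  fexp p (fun i => `|X i| ^+ 3) <= M ->
  rexp p (fun h => (eta < `|D h - (Num.sqrt s%:R)^-1 *: \sum_(j < s) X (tnth h j)|)%R%:R) <= eta ->
  `|rexp p (fun h => [forall j, D h 0 j <= x 0 j]%:R) - \prod_j Phi (x 0 j)| <= e.
Proof.
move=> M0 e0; pose kap : R := normal_peak 1.
have kap0 : 0 <= kap by exact: normal_peak_ge0.
have den0 : 0 < 2 * (1 + 2 * d%:R * kap).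
  by rewrite mulr_gt0// ltr_pwDl// !mulr_ge0.
(* Each of the d coordinates is shifted by at most 2 eta, and the remainder
   is large with probability at most eta. *)
pose eta := e / (2 * (1 + 2 * d%:R * kap)); have eta0 : 0 < eta by rewrite divr_gt0.
have etaE : 2 * d%:R * kap * eta + eta = e / 2.
  by rewrite /eta; field; apply/eqP => h; move: den0; rewrite h mulr0 ltxx.
have [C C0 cut] := smooth_cutoff eta0.
have /choice[gu /choice[au /choice[bu Hu]]] := fun j => cut (x 0 j + eta).
have /choice[gl /choice[al /choice[bl Hl]]] := fun j => cut (x 0 j - 2 * eta).
have [K K0 HK] := @lindeberg_product R d C C0.
(* From N on, s replacements, each of cost O(s^(-3/2)), cost at most e / 2. *)
pose N := (Num.bound ((2 * K * (M + 1) / e) ^+ 2)).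
exists eta, N; split => // I p X s D Ns s0 p0 p1 E1 E2 E3 DS.
have Phi01 z : 0 <= Phi z <= 1.
  rewrite fine_ge0//= -lee_fin fineK ?fin_num_measure//; exact: probability_le1.
have Phi_lip z t : 0 <= t -> Phi (z + t) <= Phi z + kap * t.
  exact: normal_cdf_lipschitz.
pose r : R := Num.sqrt s%:R; have r0 : 0 < r by rewrite sqrtr_gt0 ltr0n.
have r2 : r ^+ 2 = s%:R by rewrite sqr_sqrtr.
pose Y i := r^-1 *: X i.
have YE i k : Y i 0 k = r^-1 * X i 0 k by rewrite mxE.
pose t : R := s%:R^-1.
have t01 : 0 <= t <= 1 by rewrite invr_ge0 ler0n invf_le1 ?ltr0n// ler1n.
have Y1 k : fexp p (fun i => Y i 0 k) = 0.
  by under eq_fun do rewrite YE; rewrite fexpZ E1 mulr0.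
have Y2 k l : fexp p (fun i => Y i 0 k * Y i 0 l) = t * (k == l)%:R.
  under eq_fun do rewrite !YE mulrACA; rewrite fexpZ E2 /t -r2.
  by rewrite -invfM expr2.
have Y3 : s%:R * (K * (fexp p (fun i => `|Y i| ^+ 3) + Num.sqrt t ^+ 3)) <= e / 2.
  under [X in fexp p X]eq_fun do rewrite normrZ (gtr0_norm (_ : 0 < r^-1)) ?invr_gt0// exprMn.
  rewrite fexpZ /t sqrtrV ?ler0n// -/r -r2.
  have -> : r ^+ 2 * (K * (r^-1 ^+ 3 * fexp p (fun i => `|X i| ^+ 3) + r^-1 ^+ 3)) =
     K * (fexp p (fun i => `|X i| ^+ 3) + 1) / r by field; rewrite gt_eqF.
  rewrite ler_pdivrMr//.
  have : 2 * K * (M + 1) / e <= r.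
    have Nr : (2 * K * (M + 1) / e) ^+ 2 <= r ^+ 2.
      rewrite r2; apply: le_trans (ltW (archi_boundP (sqr_ge0 _))) _.
      by rewrite ler_nat.
    have A0 : 0 <= 2 * K * (M + 1) / e.
      by apply: divr_ge0; [apply: mulr_ge0; [exact: mulr_ge0|exact: addr_ge0]|exact: ltW].
    by rewrite -(@ler_pXn2r _ 2) // nnegrE // ltW.
  rewrite ler_pdivrMr//.
  have : K * (fexp p (fun i => `|X i| ^+ 3) + 1) <= K * (M + 1) by rewrite ler_wpM2l// lerD2r.
  lra.
have tE : s%:R * t = 1 by rewrite /t divff// pnatr_eq0 -lt0n.
pose S (h : s.-tuple I) := \sum_(j < s) Y (tnth h j).
have SE h : r^-1 *: \sum_(j < s) X (tnth h j) = S h by rewrite scaler_sumr.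
have ScE h k : S h 0 k = 0 + \sum_(j < s) Y (tnth h j) 0 k by rewrite add0r summxE.
pose bad h : R := (eta < `|D h - S h|)%R%:R.
have badE : rexp p bad <= eta by move: DS; rewrite -/r; under eq_fun do rewrite SE.
have good h : bad h = 0 -> forall k, D h 0 k <= S h 0 k + eta /\ S h 0 k <= D h 0 k + eta.
  rewrite /bad; case: ltP => [_ /eqP|le _ k]; first by rewrite oner_eq0.
  have := le_trans (norm_coord (D h - S h) k) le; rewrite !mxE => /ler_normlP[]; lra.
have bad01 h : bad h = 0 \/ bad h = 1 by rewrite /bad; case: ltP; [right|left].
have Hgu : forall k, jet2 C (gu k) (au k) (bu k) by move=> k; have [] := Hu k.
have Hgl : forall k, jet2 C (gl k) (al k) (bl k) by move=> k; have [] := Hl k.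
have Lu := HK I p Y t p0 p1 Y1 Y2 t01 s gu au bu (fun=> 0) Hgu.
have Ll := HK I p Y t p0 p1 Y1 Y2 t01 s gl al bl (fun=> 0) Hgl.
rewrite tE in Lu Ll.
have up : rexp p (fun h => [forall j, D h 0 j <= x 0 j]%:R) <=
    rexp p (fun h => \prod_k gu k (0 + \sum_(j < s) Y (tnth h j) 0 k)) + rexp p bad.
  rewrite -rexpD; apply: rexp_le => // h.
  under eq_bigr do rewrite -ScE.
  have [b0|->] := bad01 h; last first.
    apply: (@le_trans _ _ 1); first by case: [forall j, _].
    by rewrite lerDr prodr_ge0// => k _; have [/(_ (S h 0 k))/andP[]] := Hgu k.
  rewrite b0 addr0; case: forallP => [Dx|_]; last first.
    by rewrite prodr_ge0// => k _; have [/(_ (S h 0 k))/andP[]] := Hgu k.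
  rewrite big1// => k _; have [_ gu1 _] := Hu k; apply: gu1.
  by have [_ h2] := good h b0 k; rewrite (le_trans h2)// lerD2r.
have lo : rexp p (fun h => \prod_k gl k (0 + \sum_(j < s) Y (tnth h j) 0 k)) <=
    rexp p (fun h => [forall j, D h 0 j <= x 0 j]%:R) + rexp p bad.
  rewrite -rexpD; apply: rexp_le => // h.
  under eq_bigr do rewrite -ScE.
  have le1 : \prod_k gl k (S h 0 k) <= 1.
    by apply: prodr_ile1 => k _; have [/(_ (S h 0 k))] := Hgl k.
  have [b0|->] := bad01 h; last by rewrite (le_trans le1)// lerDr.
  rewrite b0 addr0; case: (boolP [forall j, _]) => // /forallPn[k].
  rewrite -ltNge => xD; rewrite (bigD1 k)//= [gl k _](_ : _ = 0) ?mul0r//.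
  have [_ _ gl0] := Hl k; apply: gl0; have [h1 _] := good h b0 k; lra.
have prodP (g a b : 'I_d -> R -> R) : (forall k, jet2 C (g k) (a k) (b k)) ->
  forall k, 0 <= heat 1 (g k) 0 <= 1.
  by move=> J k; have [h _ _ _] := heat_jet2 1 (J k).
have Du : \prod_k heat 1 (gu k) 0 <= \prod_j Phi (x 0 j) + 2 * d%:R * kap * eta.
  have -> : 2 * d%:R * kap * eta = \sum_(j < d) kap * (2 * eta) by rewrite sum_const_ord; ring.
  rewrite -lerBlDl.
  have pu k : heat 1 (gu k) 0 <= Phi (x 0 k + 2 * eta).
    have [J _ g0] := Hu k; apply: (heat1_le_normal_cdf J) => y xy; apply: g0; lra.
  apply: (@le_trans _ _ (\prod_k Phi (x 0 k + 2 * eta) - \prod_j Phi (x 0 j))).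
    rewrite lerD2r; apply: ler_prod => k _; rewrite pu andbT.
    by have /andP[] := prodP _ _ _ Hgu k.
  apply: le_trans (ler_norm _) _; apply: le_trans (prod_dist_le _ _ _) _ => //.
  apply: ler_sum => k _; have := Phi_lip (x 0 k) (2 * eta).
  have mono : Phi (x 0 k) <= Phi (x 0 k + 2 * eta).
    rewrite fine_le ?fin_num_measure//; apply: le_measure; rewrite ?inE//.
    by apply: subset_itvl; rewrite bnd_simp; lra.
  by rewrite ger0_norm ?subr_ge0// => /(_ _); lra.
have Dl : \prod_j Phi (x 0 j) <= \prod_k heat 1 (gl k) 0 + 2 * d%:R * kap * eta.
  have -> : 2 * d%:R * kap * eta = \sum_(j < d) kap * (2 * eta) by rewrite sum_const_ord; ring.
  rewrite -lerBlDl.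
  have pu k : Phi (x 0 k - 2 * eta) <= heat 1 (gl k) 0.
    by have [J g0 _] := Hl k; apply: (normal_cdf_le_heat1 J).
  apply: (@le_trans _ _ (\prod_k Phi (x 0 k) - \prod_j Phi (x 0 j - 2 * eta))).
    rewrite lerD2l lerN2; apply: ler_prod => k _; rewrite pu andbT.
    by have /andP[] := Phi01 (x 0 k - 2 * eta).
  apply: le_trans (ler_norm _) _; apply: le_trans (prod_dist_le _ _ _) _ => //.
  apply: ler_sum => k _; have := Phi_lip (x 0 k - 2 * eta) (2 * eta); rewrite subrK.
  have mono : Phi (x 0 k - 2 * eta) <= Phi (x 0 k).
    rewrite fine_le ?fin_num_measure//; apply: le_measure; rewrite ?inE//.
    by apply: subset_itvl; rewrite bnd_simp; lra.
  by rewrite ger0_norm ?subr_ge0// => /(_ _); lra.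
move: Lu Ll => /ler_normlP[L1 L2] /ler_normlP[L3 L4].
by apply/ler_normlP; split; lra.
Qed.
End clt_cdf.

(** * Inverse square roots of positive-definite matrices *)

(** A polynomial in a diagonalizable matrix acts on the eigenvalues. *)
Lemma diagonalized_fourth_root (F : fieldType) n (P : 'M[F]_n.+1) (D : 'rV[F]_n.+1)
    (q : {poly F}) : P \in unitmx -> (forall j, q.[D 0 j] ^+ 4 * D 0 j = 1) ->
  let A := invmx P *m diag_mx D *m P in let B := horner_mx A q in
  B *m B *m B *m B *m A = 1%:M.
Proof.
move=> Pu qD A B.
have mm (a b : 'rV[F]_n.+1) : (invmx P *m diag_mx a *m P) *m (invmx P *m diag_mx b *m P) =
    invmx P *m diag_mx (\row_j (a 0 j * b 0 j)) *m P.
  by rewrite !mulmxA mulmxK// -(mulmxA (invmx P)) mulmx_diag.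
have BE : B = invmx P *m diag_mx (\row_j q.[D 0 j]) *m P.
  by rewrite /B /A horner_mx_uconjC// horner_mx_diag; congr (_ *m diag_mx _ *m _);
    apply/rowP => j; rewrite !mxE.
rewrite BE !mm (_ : \row_j _ = const_mx 1).
  by rewrite diag_const_mx mulmx1 mulVmx.
by apply/rowP => j; rewrite !mxE -[RHS](qD j) !exprS expr0 mulr1 !mulrA.
Qed.

Section matrix_sqrt.
Import complex.
Context {R : realType}.

Lemma interpolation (g : R -> R) (s : seq R) :
  exists q : {poly R}, forall x, x \in s -> q.[x] = g x.
Proof.
elim: s => [|a s [q qE]]; first by exists 0.
have [as_|as_] := boolP (a \in s).
  by exists q => x; rewrite inE => /predU1P[->|]; apply: qE.
pose w : {poly R} := \prod_(y <- s) ('X - y%:P).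
have wa : w.[a] != 0 by rewrite -[_ == 0]/(root w a) root_prod_XsubC.
exists (q + ((g a - q.[a]) / w.[a]) *: w) => x; rewrite inE => /predU1P[->|xs].
  by rewrite hornerD hornerZ divfK// subrKC.
rewrite hornerD hornerZ (_ : w.[x] = 0) ?mulr0 ?addr0 ?qE//.
by apply/eqP; rewrite -[_ == 0]/(root w x) root_prod_XsubC.
Qed.

Lemma trmx_horner_mx n (A : 'M[R]_n.+1) (q : {poly R}) : A^T = A ->
  (horner_mx A q)^T = horner_mx A q.
Proof.
move=> At; elim/poly_ind: q => [|q c IH]; first by rewrite rmorph0 trmx0.
rewrite rmorphD rmorphM /= horner_mx_X horner_mx_C linearD /= tr_scalar_mx; congr (_ + _).
rewrite -mulmxE trmx_mul IH At; apply: comm_mx_horner; exact: comm_mx_refl.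
Qed.

Let C : numClosedFieldType := complex R.
Let f : {rmorphism R -> C} := real_complex R.

Lemma rV_sqr_gt0 n (a : 'rV[R]_n) : a != 0 -> 0 < (a *m a^T) 0 0.
Proof.
move=> a0; rewrite mxE lt_neqAle; apply/andP; split.
  apply: contra a0; rewrite eq_sym psumr_eq0 => [/allP h|j _].
    apply/eqP/rowP => j; have := h j; rewrite mem_index_enum => /(_ isT).
    by rewrite !mxE -expr2 sqrf_eq0 => /eqP.
  by rewrite mxE -expr2 sqr_ge0.
by apply: sumr_ge0 => j _; rewrite mxE -expr2 sqr_ge0.
Qed.

(** Over the complex numbers V is unitarily diagonalizable with real
    eigenvalues; they are positive because the real and imaginary parts of
    an eigenvector are real eigenvectors. A real polynomial that
    interpolates x^(-1/4) at them gives B, which is real and symmetric as a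
    polynomial in V. *)
Lemma posdef_fourth_root n (V : 'M[R]_n.+1) : posdefmx V ->
  exists2 B, B^T = B & B *m B *m B *m B *m V = 1%:M.
Proof.
move=> [Vt Vpos]; pose A := map_mx f V.
have freal x : f x \is Num.real by rewrite complex_real.
have Aherm : A \is hermsymmx.
  apply/is_hermitianmxP; rewrite expr0 scale1r; apply/matrixP => i j.
  by rewrite !mxE -[in LHS]Vt mxE; apply/esym/CrealP.
have /orthomx_spectralP := hermitian_normalmx Aherm.
set P := spectralmx A; set D := spectral_diag A => AE.
have Pu : P \in unitmx by exact: spectral_unit.
have Dr j : D 0 j \is Num.real by have /mxOverP := hermitian_spectral_diag_real Aherm; exact.
pose lam j := Re (D 0 j).
have lamE j : f (lam j) = D 0 j by exact: RRe_real.
have lam0 j : 0 < lam j.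
  have eig : row j P *m A = D 0 j *: row j P.
    rewrite AE !mulmxA -row_mul mulmxV// row1 -rowE row_diag_mx -scalemxAl.
    by rewrite -rowE.
  have ReZ (x : C) (r : R) : Re (x * f r) = Re x * r.
    by case: x => x y; rewrite /f /= mulr0 subr0.
  have ImZ (x : C) (r : R) : Im (x * f r) = Im x * r.
    by case: x => x y; rewrite /f /= mulr0 add0r.
  have part (g : C -> R) : (forall x y, g (x + y) = g x + g y) -> g 0 = 0 ->
      (forall x r, g (x * f r) = g x * r) ->
      map_mx g (row j P) *m V = lam j *: map_mx g (row j P).
    move=> gD g0 gZ; apply/rowP => k; rewrite !mxE.
    have /rowP/(_ k) := eig; rewrite !mxE => /(congr1 g).
    rewrite (big_morph g gD g0) -lamE (mulrC (f _)) gZ (mulrC (g _)) => <-.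
    by apply: eq_bigr => l _; rewrite !mxE gZ.
  have pos (a : 'rV[R]_n.+1) : a != 0 -> a *m V = lam j *: a -> 0 < lam j.
    move=> a0 aV; have := Vpos a a0; rewrite aV -scalemxAl mxE pmulr_lgt0//.
    exact: rV_sqr_gt0.
  have [re0|re0] := eqVneq (map_mx (@Re R) (row j P) : 'rV[R]_n.+1) 0; last first.
    by apply: pos re0 _; apply: part => [[? ?] [? ?]||].
  have [im0|im0] := eqVneq (map_mx (@Im R) (row j P) : 'rV[R]_n.+1) 0; last first.
    by apply: pos im0 _; apply: part => [[? ?] [? ?]||].
  have rj0 : row j P = 0.
    apply/rowP => k; move/rowP/(_ k) : re0; move/rowP/(_ k) : im0; rewrite !mxE.
    by case: (P j k) => x y /= -> ->.
  have : row j P *m invmx P = delta_mx 0 j by rewrite -row_mul mulmxV// row1.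
  rewrite rj0 mul0mx => /rowP/(_ j)/eqP; rewrite !mxE !eqxx /= eq_sym oner_eq0.
  by [].
pose g (x : R) := (Num.sqrt (Num.sqrt x))^-1.
have [q qE] := interpolation g [seq lam j | j <- enum 'I_n.+1].
have qlam j : q.[lam j] = g (lam j) by apply/qE/map_f; rewrite mem_enum.
pose B := horner_mx V q; exists B; first exact: trmx_horner_mx.
apply: (map_mx_inj (f := f)).
rewrite !map_mxM map_mx1 /B map_horner_mx -/A AE.
apply: diagonalized_fourth_root => // j; rewrite -lamE horner_map qlam -!rmorphXn -rmorphM.
have l0 : 0 < Num.sqrt (lam j) by rewrite sqrtr_gt0.
have s0 : 0 < Num.sqrt (Num.sqrt (lam j)) by rewrite sqrtr_gt0.
rewrite (_ : _ * _ = 1) ?rmorph1// /g.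
rewrite -{2}(sqr_sqrtr (ltW (lam0 j))) -{2}(sqr_sqrtr (ltW l0)).
by field; rewrite gt_eqF.
Qed.

(** The square of an invertible symmetric matrix is positive-definite, so
    the square of the fourth root is an admissible witness. *)
Lemma posdef_invsqrt n (V : 'M[R]_n) : posdefmx V ->
  posdefmx (invsqrtmx V) /\ invsqrtmx V *m invsqrtmx V *m V = 1%:M.
Proof.
move=> Vpos; apply: (@xgetPex _ 0 [set B : 'M[R]_n | posdefmx B /\ B *m B *m V = 1%:M]).
case: n V Vpos => [|n] V Vpos.
  exists 0 => /=; split; last by rewrite [LHS]flatmx0 [RHS]flatmx0.
  by split=> [|u]; [rewrite trmx0|rewrite [u]thinmx0 eqxx].
have [B Bt BV] := posdef_fourth_root Vpos.
exists (B *m B); split; last by rewrite !mulmxA.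
split=> [|u u0]; first by rewrite trmx_mul Bt.
rewrite mulmxA -mulmxA -[X in _ *m (X *m _)]Bt -trmx_mul; apply: rV_sqr_gt0.
apply: contra u0 => /eqP uB; have := congr1 (mulmx u) BV.
by rewrite !mulmxA uB !mul0mx mulmx1 => <-.
Qed.

End matrix_sqrt.

(** * Integrability on a probability space *)

Section integrability.
Context {d} {T : measurableType d} {R : realType}.
Variable P : probability T R.
Implicit Types f g : T -> R.

Lemma square_integrableP f : measurable_fun setT f ->
  square_integrable P f <-> P.-integrable setT (EFin \o (fun z => f z ^+ 2)).
Proof.
move=> mf; have E : ('E_P[(fun z => (f z ^+ 2)%R)])%E =
    (\int[P]_z `|(EFin \o (fun z => f z ^+ 2)%R) z|)%E.
  rewrite unlock; apply: eq_integral => z _ /=.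
  by rewrite ger0_norm// sqr_ge0.
rewrite /square_integrable E; split=> [h|/integrableP[]//].
by apply/integrableP; split => //; apply/measurable_EFinP; exact: measurable_funX.
Qed.

Lemma dominated_integrable f g : measurable_fun setT f -> P.-integrable setT (EFin \o g) ->
  (forall z, `|f z| <= g z) -> P.-integrable setT (EFin \o f).
Proof.
move=> mf ig fg; apply: le_integrable ig => //; first exact/measurable_EFinP.
by move=> z _ /=; rewrite lee_fin (le_trans (fg z))// ler_norm.
Qed.

Lemma integrable_cst_prob (c : R) : P.-integrable setT (EFin \o (fun=> c)).
Proof. exact: finite_measure_integrable_cst. Qed.

Lemma RintegralZD (c : R) f g : P.-integrable setT (EFin \o f) ->
  P.-integrable setT (EFin \o g) ->
  P.-integrable setT (EFin \o (fun z => c * f z + g z)) /\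
  \int[P]_z (c * f z + g z) = c * \int[P]_z f z + \int[P]_z g z.
Proof.
move=> If Ig; have Icf : P.-integrable setT (EFin \o (fun z => c * f z)).
  by rewrite /comp; under eq_fun do rewrite EFinM; exact: integrableZl.
split; last by rewrite RintegralD// RintegralZl.
by rewrite /comp; under eq_fun do rewrite EFinD; exact: integrableD.
Qed.

Lemma square_integrable1 f : measurable_fun setT f -> square_integrable P f ->
  P.-integrable setT (EFin \o f).
Proof.
move=> mf /(square_integrableP mf) h.
have [h' _] := RintegralZD 1 h (integrable_cst_prob 1).
apply: dominated_integrable h' _ => // z; rewrite mul1r -real_normK ?num_real//.
by have := sqr_ge0 (`|f z| - 1); have := sqr_ge0 `|f z|; lra.
Qed.

Lemma mul_integrable f g : measurable_fun setT f -> measurable_fun setT g ->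
  P.-integrable setT (EFin \o (fun z => f z ^+ 2)) ->
  P.-integrable setT (EFin \o (fun z => g z ^+ 2)) ->
  P.-integrable setT (EFin \o (fun z => f z * g z)).
Proof.
move=> mf mg If Ig; have [h _] := RintegralZD 1 If Ig.
apply: dominated_integrable h _ => [|z]; first exact: measurable_funM.
rewrite normrM mul1r -(real_normK (num_real (f z))) -(real_normK (num_real (g z))).
by have := sqr_ge0 (`|f z| - `|g z|); have := sqr_ge0 (`|f z| + `|g z|); lra.
Qed.

Lemma square_integrable_dom f g : measurable_fun setT f -> measurable_fun setT g ->
  square_integrable P g -> (forall z, `|f z| <= `|g z|) -> square_integrable P f.
Proof.
move=> mf mg /(square_integrableP mg) Ig fg; apply/square_integrableP => //.
apply: dominated_integrable Ig _ => [|z]; first exact: measurable_funX.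
by rewrite normrX -(real_normK (num_real (g z))) lerXn2r ?nnegrE.
Qed.

Lemma square_integrableZD (c : R) f g : measurable_fun setT f -> measurable_fun setT g ->
  square_integrable P f -> square_integrable P g ->
  square_integrable P (fun z => c * f z + g z).
Proof.
move=> mf mg /(square_integrableP mf) If /(square_integrableP mg) Ig.
have mh : measurable_fun setT (fun z => c * f z + g z).
  by apply: measurable_funD => //; exact: measurable_funM.
apply/square_integrableP => //.
have [I1 _] := RintegralZD (2 * c ^+ 2) If (RintegralZD 2 Ig (integrable_cst_prob 0)).1.
apply: dominated_integrable I1 _ => [|z]; first exact: measurable_funX.
rewrite addr0 ger0_norm ?sqr_ge0//.
by have := sqr_ge0 (c * f z - g z); lra.
Qed.

Lemma markov_Rintegral f (K : R) : 0 < K -> measurable_fun setT f ->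
  (forall z, 0 <= f z) -> P.-integrable setT (EFin \o f) ->
  (P [set z | (K < f z)%R] <= (\int[P]_z f z / K)%:E)%E.
Proof.
move=> K0 mf f0 If.
have mef : measurable_fun setT (EFin \o f) by exact/measurable_EFinP.
have mA : measurable [set z | (K < f z)%R].
  by have := emeasurable_fun_o_infty measurableT mef K%:E; rewrite setTI.
have -> : (\int[P]_z f z / K)%:E = (K^-1%:E * \int[P]_z (f z)%:E)%E.
  by rewrite mulrC EFinM /Rintegral fineK//; exact: integrable_fin_num.
rewrite -lee_pdivrMl ?invr_gt0// invrK -integral_cst//.
apply: (@le_trans _ _ (\int[P]_(z in [set z | (K < f z)%R]) (f z)%:E)%E).
  apply: ge0_le_integral => //.
  - by move=> z _; rewrite lee_fin ltW.
  - exact: measurable_funTS.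
  - by move=> z /= Kz; rewrite lee_fin ltW.
apply: ge0_subset_integral => //.
by move=> z _; rewrite lee_fin.
Qed.
End integrability.

(** * The weak law of large numbers *)

Section lln.
Context {dT dS : measure_display} {T : measurableType dT} {S : measurableType dS}
  {R : realType} {P : probability T R} {Q : probability S R}
  {Z : nat -> {mfun T >-> S}}.
Hypothesis HZ : iid P Z Q.

Lemma iid_pair i j (A B : set S) : (i < j)%N -> measurable A -> measurable B ->
  P ((Z i @^-1` A) `&` (Z j @^-1` B)) = (Q A * Q B)%E.
Proof.
move=> ij mA mB; have [ind law] := HZ.
pose F k := if k == i then A else if k == j then B else setT.
have mF k : measurable (F k) by rewrite /F; case: ifP => // _; case: ifP.
have := ind j.+1 F mF.
have -> : \bigcap_(k < j.+1) (Z k @^-1` F k) = (Z i @^-1` A) `&` (Z j @^-1` B).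
  apply/seteqP; split => [w h|w [wA wB] k /= _].
    split; first by have := h i; rewrite /F eqxx => /(_ (ltn_trans ij (ltnSn j))).
    by have := h j; rewrite /F eqxx (gtn_eqF ij) => /(_ (ltnSn j)).
  by rewrite /F; case: eqP => [->//|_]; case: eqP => [->|].
rewrite big_ord_recr/= (bigD1 (Ordinal ij))//= {1 3}/F !eqxx (gtn_eqF ij).
rewrite big1 ?mule1 => [->|k /negP ki].
  by rewrite -(law i A mA) -(law j B mB).
rewrite /F; case: eqP => [ki'|_]; first by case: ki; apply/eqP/val_inj.
by rewrite ltn_eqF// preimage_setT probability_setT.
Qed.

(** The joint law of two observations is the product of their laws, by
    uniqueness of product measures, and the integral factors by Fubini's
    theorem. *)
Lemma iid_pair_integral i j (g h : S -> R) : (i < j)%N ->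
  measurable_fun setT g -> measurable_fun setT h ->
  Q.-integrable setT (EFin \o g) -> Q.-integrable setT (EFin \o h) ->
  \int[Q]_z h z = 0 -> P.-integrable setT (EFin \o (fun w => g (Z i w) * h (Z j w))) ->
  \int[P]_w (g (Z i w) * h (Z j w)) = 0.
Proof.
move=> ij mg mh Ig Ih h0 Igh.
have mphi : measurable_fun setT (fun w => (Z i w, Z j w)) by exact: measurable_fun_pair.
pose phi : {mfun T >-> (S * S)%type} := mfun_Sub (mem_set mphi).
pose f (q : S * S) : \bar R := (g q.1 * h q.2)%:E.
have mf : measurable_fun setT f.
  by apply/measurable_EFinP; apply: measurable_funM; exact: measurableT_comp.
rewrite /Rintegral -(@integral_distribution _ _ _ _ _ P phi f) //.
rewrite (@eq_measure_integral _ _ _ setT (Q \x Q)%E); last first.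
  move=> A mA _; apply/esym; apply: product_measure_unique => // B C mB mC.
  exact: iid_pair.
have If : (Q \x Q)%E.-integrable setT f.
  apply/integrable12ltyP => //.
  under eq_integral => x _.
    under eq_integral do rewrite /f/= normrM EFinM.
    rewrite ge0_integralZl//; last by apply/measurable_EFinP; exact: measurableT_comp.
    over.
  move/integrableP : (Ih) => [_ Ih']; move/integrableP : (Ig) => [_ Ig'].
  rewrite ge0_integralZr//.
  - by rewrite lte_mul_pinfty// ?integral_ge0// ge0_fin_numE ?integral_ge0.
  - by apply/measurable_EFinP; exact: measurableT_comp.
  - exact: integral_ge0.
rewrite -integral12_prod_meas1//.
rewrite /fubini_F /f /=; under eq_integral => x _.
  under eq_integral do rewrite EFinM.
  rewrite integralZl// -(@fineK _ (integral _ _ _)); last exact: integrable_fin_num.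
  rewrite [fine _]h0 mule0; over.
by rewrite integral0.
Qed.

Lemma iid_integral i (f : S -> R) : Q.-integrable setT (EFin \o f) ->
  P.-integrable setT (EFin \o (fun w => f (Z i w))) /\
  \int[P]_w f (Z i w) = \int[Q]_z f z.
Proof.
move=> If; have [_ law] := HZ.
have mf : measurable_fun setT (EFin \o f) by exact: (measurable_int Q).
have mfZ : measurable_fun setT (EFin \o (fun w => f (Z i w))).
  exact: (measurableT_comp mf).
have I : P.-integrable setT (EFin \o (fun w => f (Z i w))).
  apply/integrableP; split => //.
  have mab : measurable_fun setT (abse \o (EFin \o f)) by exact: measurableT_comp.
  rewrite -(@ge0_integral_distribution _ _ _ _ _ P (Z i) (abse \o (EFin \o f)) mab
    (fun y => abse_ge0 _)).
  rewrite (@eq_measure_integral _ _ _ setT Q) => [|A mA _]; last exact: law.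
  by move/integrableP : If => [].
split => //; rewrite /Rintegral -(@integral_distribution _ _ _ _ _ P (Z i) (EFin \o f))//.
by congr fine; apply: eq_measure_integral => A mA _; exact: law.
Qed.

(** The sum is extended by one observation at a time; the cross term is a
    sum of products of independent variables, one factor being centred. *)
Lemma iid_sum_sqr (g : S -> R) (n : nat) : measurable_fun setT g ->
  square_integrable Q g -> \int[Q]_z g z = 0 ->
  P.-integrable setT (EFin \o (fun w => (\sum_(i < n) g (Z i w)) ^+ 2)) /\
  \int[P]_w ((\sum_(i < n) g (Z i w)) ^+ 2) = n%:R * \int[Q]_z (g z ^+ 2).
Proof.
move=> mg sg g0; have Ig := square_integrable1 mg sg.
move/(square_integrableP _ mg) : (sg) => Ig2.
have mgZ i : measurable_fun setT (fun w => g (Z i w)) by exact: measurableT_comp.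
have msum m : measurable_fun setT (fun w => \sum_(i < m) g (Z i w)).
  exact: measurable_sum.
have cross m j : (m <= j)%N ->
    P.-integrable setT (EFin \o (fun w => (\sum_(i < m) g (Z i w)) * g (Z j w))) /\
    \int[P]_w ((\sum_(i < m) g (Z i w)) * g (Z j w)) = 0.
  elim: m => [_|m IH mj].
    have -> : (fun w => (\sum_(i < 0) g (Z i w)) * g (Z j w)) = (fun=> 0).
      by apply/funext => w; rewrite big_ord0 mul0r.
    by split; [exact: integrable_cst_prob|rewrite Rintegral_cst// mul0r].
  have [I1 E1] := IH (ltnW mj).
  have I2 : P.-integrable setT (EFin \o (fun w => g (Z m w) * g (Z j w))).
    by apply: mul_integrable => //; apply: (iid_integral _ Ig2).1.
  have E2 := iid_pair_integral mj mg mg Ig Ig g0 I2.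
  have [I3 E3] := RintegralZD 1 I1 I2.
  have -> : (fun w => (\sum_(i < m.+1) g (Z i w)) * g (Z j w)) = (fun w =>
     1 * ((\sum_(i < m) g (Z i w)) * g (Z j w)) + g (Z m w) * g (Z j w)).
    by apply/funext => w; rewrite big_ord_recr/= mulrDl mul1r.
  by rewrite E3 E1 E2 mulr0 addr0.
elim: n => [|n [I1 E1]].
  have -> : (fun w => (\sum_(i < 0) g (Z i w)) ^+ 2) = (fun=> 0).
    by apply/funext => w; rewrite big_ord0 expr0n.
  by split; [exact: integrable_cst_prob|rewrite Rintegral_cst// !mul0r].
have [I2 E2] := cross n n (leqnn n).
have [I3 E3] := iid_integral n Ig2.
have [I4 E4] := RintegralZD 2 I2 I3.
have [I5 E5] := RintegralZD 1 I1 I4.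
have -> : (fun w => (\sum_(i < n.+1) g (Z i w)) ^+ 2) = (fun w => 1 * (\sum_(i < n) g (Z i w)) ^+ 2 +
   (2 * ((\sum_(i < n) g (Z i w)) * g (Z n w)) + g (Z n w) ^+ 2)).
  by apply/funext => w; rewrite big_ord_recr/=; ring.
split=> //; rewrite E5 E1 E4 E2 E3 mulr0 add0r mul1r.
by rewrite mulrSr mulrDl mul1r.
Qed.
End lln.

Section with_high_probability.
Context {dT : measure_display} {T : measurableType dT} {R : realType}
  (P : probability T R).
Implicit Types (A B : nat -> set T) (delta : R).

(** Outer probability, because the events below involve suprema and
    maximizers whose measurability is not known; monotonicity and
    subadditivity suffice to combine them. *)
Definition eventually_prob delta A : Prop :=
  \forall n \near \oo, ((P^*)%mu (~` A n) <= delta%:E)%E.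

Definition whp A : Prop := forall delta, 0 < delta -> eventually_prob delta A.

Lemma eventually_probI d1 d2 A B : eventually_prob d1 A -> eventually_prob d2 B ->
  eventually_prob (d1 + d2) (fun n => A n `&` B n).
Proof.
move=> hA hB; near=> n; rewrite setCI; apply: le_trans (outer_measureU2 _ _ _) _.
by rewrite EFinD leeD//; near: n.
Unshelve. all: by end_near. Qed.

Lemma eventually_prob_sub d A B : eventually_prob d A ->
  (\forall n \near \oo, A n `<=` B n) -> eventually_prob d B.
Proof.
move=> hA AB; near=> n; apply: (@le_trans _ _ ((P^*)%mu (~` A n))).
  by apply: le_outer_measure; apply: subsetC; near: n.
by near: n.
Unshelve. all: by end_near. Qed.

Lemma whpI A B : whp A -> whp B -> whp (fun n => A n `&` B n).
Proof.
move=> hA hB d d0; have d20 : 0 < d / 2 by rewrite divr_gt0.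
by have := eventually_probI (hA _ d20) (hB _ d20); rewrite -splitr.
Qed.

Lemma whp_sub A B : whp A -> (\forall n \near \oo, A n `<=` B n) -> whp B.
Proof. by move=> hA AB d d0; exact: eventually_prob_sub (hA d d0) AB. Qed.

Lemma whpT A : (\forall n \near \oo, A n = setT) -> whp A.
Proof.
move=> AT d d0; near=> n; rewrite (_ : A n = setT); last by near: n.
by rewrite setCT outer_measure0 lee_fin ltW.
Unshelve. all: by end_near. Qed.

Lemma whp_all (I : eqType) (r : seq I) (A : I -> nat -> set T) :
  (forall i, i \in r -> whp (A i)) -> whp (fun n => [set w | forall i, i \in r -> A i n w]).
Proof.
elim: r => [_|i r IH H]; first by apply: whpT; near=> n; apply/seteqP; split.
have h1 := H i (mem_head _ _).
have h2 : whp (fun n => [set w | forall i, i \in r -> A i n w]).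
  by apply: IH => j jr; apply: H; rewrite inE jr orbT.
apply: whp_sub (whpI h1 h2) _; near=> n => w [/= w1 w2] j.
by rewrite inE => /predU1P[->//|]; exact: w2.
Unshelve. all: by end_near. Qed.
End with_high_probability.

Section weak_law.
Context {dT dS : measure_display} {T : measurableType dT} {S : measurableType dS}
  {R : realType} {P : probability T R} {Q : probability S R}
  {Z : nat -> {mfun T >-> S}}.
Hypothesis HZ : iid P Z Q.

Definition average (f : S -> R) (n : nat) (w : T) : R :=
  n%:R^-1 * \sum_(i < n) f (Z i w).

(** Markov's inequality for the square of the centred sum, by [iid_sum_sqr]. *)
Lemma weak_law (f : S -> R) (e : R) : 0 < e -> measurable_fun setT f ->
  square_integrable Q f ->
  whp P (fun n => [set w | `|average f n w - \int[Q]_z f z| <= e]).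
Proof.
move=> e0 mf sf delta delta0; set c := \int[Q]_z f z.
pose g z := 1 * f z + (- c).
have mg : measurable_fun setT g.
  by apply: measurable_funD => //; exact: measurable_funM.
have sg : square_integrable Q g.
  apply: square_integrableZD => //; apply/square_integrableP => //.
  exact: integrable_cst_prob.
have g0 : \int[Q]_z g z = 0.
  have [_ ->] := RintegralZD 1 (square_integrable1 mf sf) (integrable_cst_prob Q (- c)).
  rewrite Rintegral_cst// (_ : fine _ = 1) ?mulr1 ?mul1r ?subrr//.
  by rewrite (_ : _ setT = 1%E)//; exact: probability_setT.
set v := \int[Q]_z (g z ^+ 2).
have v0 : 0 <= v by apply: Rintegral_ge0 => z _; exact: sqr_ge0.
near=> n.
have n0 : (0 < n)%N by near: n; exact: nbhs_infty_gt.
have n0R : 0 < n%:R :> R by rewrite ltr0n.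
have [Is Es] := iid_sum_sqr HZ n mg sg g0; rewrite -/v in Es.
have ms : measurable_fun setT (fun w => \sum_(i < n) g (Z i w)).
  by apply: measurable_sum => i; exact: measurableT_comp.
have sumE w : \sum_(i < n) g (Z i w) = n%:R * (average f n w - c).
  rewrite /average big_split /= sum_const_ord mulrBr mulVKf ?gt_eqF// mulrN.
  by congr (_ - _); apply: eq_bigr => i _; rewrite mul1r.
have ne0 : 0 < n%:R * e by rewrite mulr_gt0.
have -> : ~` [set w | `|average f n w - c| <= e] =
    [set w | ((n%:R * e) ^+ 2 < (\sum_(i < n) g (Z i w)) ^+ 2)%R].
  have E w : ((n%:R * e) ^+ 2 < (\sum_(i < n) g (Z i w)) ^+ 2) = (e < `|average f n w - c|).
    rewrite sumE -[ltRHS]real_normK ?num_real// ltr_pXn2r ?nnegrE ?(ltW ne0)//.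
    by rewrite normrM (gtr0_norm n0R) ltr_pM2l.
  by apply/seteqP; split => w /=; rewrite E ltNge => /negP.
have mA : measurable [set w | ((n%:R * e) ^+ 2 < (\sum_(i < n) g (Z i w)) ^+ 2)%R].
  have mnf : measurable_fun setT (EFin \o (fun w => (\sum_(i < n) g (Z i w)) ^+ 2)).
    by apply/measurable_EFinP; exact: measurable_funX.
  by have := emeasurable_fun_o_infty measurableT mnf ((n%:R * e) ^+ 2)%:E; rewrite setTI.
rewrite measurable_mu_extE//; apply: le_trans (markov_Rintegral _ _ _ Is) _.
- by rewrite exprn_gt0.
- exact: measurable_funX.
- by move=> w; exact: sqr_ge0.
rewrite lee_fin Es exprMn.
have -> : n%:R * v / (n%:R ^+ 2 * e ^+ 2) = v / e ^+ 2 / n%:R.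
  by field; rewrite !gt_eqF.
rewrite ler_pdivrMr// -ler_pdivrMl//.
near: n; exact: nbhs_infty_ger.
Unshelve. all: by end_near. Qed.
End weak_law.

(** * Uniform lower bounds and concave maximizers *)

Section uniform_positivity.
Context {dT dS : measure_display} {T : measurableType dT} {S : measurableType dS}
  {R : realType} {P : probability T R} {Q : probability S R}
  {Z : nat -> {mfun T >-> S}}.
Hypothesis HZ : iid P Z Q.

Lemma averageB (f g : S -> R) n w :
  average (Z := Z) f n w - average (Z := Z) g n w = average (Z := Z) (fun z => f z - g z) n w.
Proof. by rewrite /average sumrB mulrBr. Qed.

Lemma average_norm_le (f g : S -> R) n w : (forall z, `|f z| <= g z) ->
  `|average (Z := Z) f n w| <= average (Z := Z) g n w.
Proof.
move=> fg; rewrite normrM ger0_norm ?invr_ge0 ?ler0n// ler_wpM2l ?invr_ge0 ?ler0n//.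
by apply: le_trans (ler_norm_sum _ _ _) _; apply: ler_sum.
Qed.

Lemma averageZ (c : R) (f : S -> R) n w :
  average (Z := Z) (fun z => c * f z) n w = c * average (Z := Z) f n w.
Proof. by rewrite /average -mulr_sumr mulrCA. Qed.

(** The compact set K is covered by finitely many balls. At their centres
    the averages are close to positive expectations by the weak law; inside
    a ball they move by at most its radius times the average of L, which is
    bounded, and the radius is chosen in proportion to the expectation at
    the centre. *)
Lemma uniform_positive (k : nat) (K : set 'rV[R]_k) (f : S -> 'rV[R]_k -> R) (L : S -> R) :
  compact K -> measurable_fun setT L -> square_integrable Q L ->
  (forall t, K t -> measurable_fun setT (f ^~ t)) ->
  (forall t, K t -> square_integrable Q (f ^~ t)) ->
  (forall t, K t -> 0 < \int[Q]_z f z t) ->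
  (forall z t t', K t -> K t' -> `|f z t - f z t'| <= L z * `|t - t'|) ->
  exists2 c : R, 0 < c &
    whp P (fun n => [set w | forall t, K t -> c <= average (Z := Z) (f ^~ t) n w]).
Proof.
move=> cK mL sL mf sf f0 fL.
pose B := `|\int[Q]_z L z| + 1; have B0 : 0 < B by rewrite ltr_wpDl.
pose mu t := \int[Q]_z f z t.
pose rad t := if `[< K t >] then mu t / (4 * B) else 1.
have rad0 t : 0 < rad t.
  by rewrite /rad; case: asboolP => // Kt; rewrite divr_gt0 ?f0// mulr_gt0.
pose U t := [set u : 'rV[R]_k | `|t - u| < rad t].
have [D DK cov] : finite_subset_cover K U K.
  move: cK; rewrite compact_cover; apply.
    move=> t _; rewrite (_ : U t = ball t (rad t)); first exact: ball_open.
    by rewrite -ball_normE.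
  by move=> t Kt; exists t => //; rewrite /U/= subrr normr0.
have DKt t : t \in finmap.enum_fset D -> K t by move=> tD; have := DK _ tD; rewrite inE.
have [c c0 cmu] : exists2 c : R, 0 < c & forall t, t \in finmap.enum_fset D -> c <= mu t / 2.
  elim: (finmap.enum_fset D) DKt => [_|t r IH rK]; first by exists 1.
  have [c c0 H] := IH (fun u ur => rK u (mem_behead (s := t :: r) ur)).
  have mut : 0 < mu t / 2 by rewrite divr_gt0// f0//; apply: rK; rewrite mem_head.
  exists (Num.min c (mu t / 2)); first by rewrite lt_min c0.
  move=> u; rewrite inE => /predU1P[->|/H uc]; first by rewrite ge_min lexx orbT.
  by rewrite ge_min uc.
exists c => //.
have W1 := weak_law HZ ltr01 mL sL.
have W2 : whp P (fun n => [set w | forall t, t \in finmap.enum_fset D ->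
    [set w | `|average (Z := Z) (f ^~ t) n w - mu t| <= mu t / 4] w]).
  apply: whp_all => t tD; apply: (weak_law HZ) => //; last 2 first.
  - exact/mf/DKt.
  - exact/sf/DKt.
  - by rewrite divr_gt0// f0//; exact: DKt.
apply: whp_sub (whpI W1 W2) _; near=> n => w [/= w1 w2] u Ku.
have [t tD] := cov u Ku; rewrite /U/= => tu.
have Kt : K t by exact: DKt.
have muB := w2 t tD.
have LB : average (Z := Z) L n w <= B.
  by rewrite /B; have := ler_norm (\int[Q]_z L z); move: w1 => /ler_normlP[]; lra.
have fd : `|average (Z := Z) (f ^~ t) n w - average (Z := Z) (f ^~ u) n w| <= mu t / 4.
  rewrite averageB; apply: (@le_trans _ _ (average (Z := Z) (fun z => `|t - u| * L z) n w)).
    by apply: average_norm_le => z; rewrite mulrC; exact: fL.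
  rewrite averageZ; have mut0 : 0 < mu t := f0 _ Kt.
  have : `|t - u| <= mu t / (4 * B).
    by apply: le_trans (ltW tu) _; rewrite /rad; case: asboolP.
  move=> tu'; have := ler_wpM2l (normr_ge0 (t - u)) LB.
  move=> /le_trans; apply; have := ler_wpM2r (ltW B0) tu'.
  by move=> /le_trans; apply; rewrite le_eqVlt; apply/orP; left; apply/eqP; field; rewrite gt_eqF.
have := cmu t tD; move: muB fd => /ler_normlP[? ?] /ler_normlP[? ?]; lra.
Unshelve. all: by end_near. Qed.
End uniform_positivity.

Section concave_argmax.
Context {R : realType} {d : nat}.
Implicit Types (f : 'rV[R]_d -> R) (x y t : 'rV[R]_d).

Definition concave_seg f := forall x y (l : R), 0 <= l <= 1 ->
  (1 - l) * f x + l * f y <= f (x + l *: (y - x)).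

Lemma concave_concave_seg f : concave f -> concave_seg f.
Proof.
move=> cf x y l /andP[l0 l1].
have := cf (Itv01 l0 l1) y x; rewrite !inE => /(_ I I) /=.
rewrite /conv /= => H.
have : - f (l *: y + (1 - l) *: x) <= l * (- f y) + (1 - l) * (- f x) by exact: H.
have -> : l *: y + (1 - l) *: x = x + l *: (y - x).
  by rewrite scalerBl scale1r scalerBr addrC -addrA [- _ + _]addrC.
lra.
Qed.

Lemma concave_seg_sum (I : Type) (r : seq I) (F : I -> 'rV[R]_d -> R) (a : I -> R) :
  (forall i, 0 <= a i) -> (forall i, concave_seg (F i)) ->
  concave_seg (fun t => \sum_(i <- r) a i * F i t).
Proof.
move=> a0 cF x y l l01; rewrite !mulr_sumr -big_split; apply: ler_sum => i _ /=.
have := ler_wpM2l (a0 i) (cF i x y l l01); lra.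
Qed.

(** If y were at distance at least e, the segment from x to y would cross
    the sphere at a point where, by concavity, f is at least f x. *)
Lemma concave_superlevel f x y (e : R) : concave_seg f -> 0 < e ->
  (forall t, `|t - x| = e -> f t < f x) -> f x <= f y -> `|y - x| < e.
Proof.
move=> cf e0 sph fxy; rewrite ltNge; apply/negP => ey.
have n0 : 0 < `|y - x| by exact: lt_le_trans ey.
pose l := e / `|y - x|.
have l01 : 0 <= l <= 1.
  by rewrite divr_ge0 ?(ltW e0)//= ler_pdivrMr// mul1r.
have := sph (x + l *: (y - x)).
rewrite addrC addKr normrZ ger0_norm; last by case/andP: l01.
rewrite divfK ?gt_eqF// => /(_ erefl); apply/negP; rewrite -leNgt.
apply: le_trans (cf x y l l01).
by case/andP: l01 => l0 l1; have := ler_wpM2l l0 fxy; lra.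
Qed.
End concave_argmax.

(** * Quadratic forms and maximizers of nearly quadratic functions *)

Section quadratic_forms.
Context {R : realType} {d : nat}.
Implicit Types (A H : 'M[R]_d) (u v w : 'rV[R]_d).

Definition dot u v : R := (u *m v^T) 0 0.

Lemma dotE u v : dot u v = \sum_k u 0 k * v 0 k.
Proof. by rewrite /dot mxE; apply: eq_bigr => k _; rewrite mxE. Qed.

Lemma dotC u v : dot u v = dot v u.
Proof. by rewrite !dotE; apply: eq_bigr => k _; rewrite mulrC. Qed.

Lemma dotDl u v w : dot (u + v) w = dot u w + dot v w.
Proof. by rewrite /dot mulmxDl mxE. Qed.

Lemma dotNl u v : dot (- u) v = - dot u v.
Proof. by rewrite /dot mulNmx mxE. Qed.

Lemma dotZl (a : R) u v : dot (a *: u) v = a * dot u v.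
Proof. by rewrite /dot -scalemxAl mxE. Qed.

Lemma dotDr u v w : dot u (v + w) = dot u v + dot u w.
Proof. by rewrite dotC dotDl !(dotC u). Qed.

Lemma dotNr u v : dot u (- v) = - dot u v.
Proof. by rewrite dotC dotNl dotC. Qed.

Lemma dotZr (a : R) u v : dot u (a *: v) = a * dot u v.
Proof. by rewrite dotC dotZl dotC. Qed.

Lemma dot_sumr u (I : Type) (r : seq I) (F : I -> 'rV[R]_d) :
  dot u (\sum_(i <- r) F i) = \sum_(i <- r) dot u (F i).
Proof.
elim: r => [|i r IH]; first by rewrite !big_nil /dot trmx0 mulmx0 mxE.
by rewrite !big_cons dotDr IH.
Qed.

Lemma dot_mulmx u v A : dot (u *m A) v = dot u (v *m A^T).
Proof. by rewrite /dot trmx_mul trmxK mulmxA. Qed.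

Lemma dot_le u v : `|dot u v| <= d%:R * (`|u| * `|v|).
Proof.
rewrite dotE; apply: le_trans (ler_norm_sum _ _ _) _.
rewrite -sum_const_ord; apply: ler_sum => k _.
by rewrite normrM ler_pM// norm_coord.
Qed.

Lemma norm_mulmx_le u A (h : R) : 0 <= h -> (forall k l, `|A k l| <= h) ->
  `|u *m A| <= d%:R * h * `|u|.
Proof.
move=> h0 Ah; apply: normrV_le => [|k]; first by rewrite !mulr_ge0.
rewrite mxE; apply: le_trans (ler_norm_sum _ _ _) _.
rewrite -mulrA -sum_const_ord; apply: ler_sum => l _.
by rewrite normrM mulrC ler_pM// norm_coord.
Qed.

Context (H : 'M[R]_d) (c : R).
Hypotheses (c0 : 0 < c) (Hc : forall u, c * `|u| ^+ 2 <= - dot (u *m H) u).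

Lemma coercive_unitmx : H \in unitmx.
Proof.
rewrite -row_free_unit -kermx_eq0; apply/eqP/row_matrixP => i; rewrite row0.
have := Hc (row i (kermx H)); rewrite -row_mul mulmx_ker row0 /dot mul0mx mxE oppr0.
by rewrite pmulr_rle0// exprn_even_le0//= normr_eq0 => /eqP.
Qed.

Lemma coercive_invmx u : `|u *m invmx H| <= d%:R / c * `|u|.
Proof.
set w := u *m invmx H; have wH : w *m H = u by rewrite mulmxKV// coercive_unitmx.
have [->|w0] := eqVneq w 0; first by rewrite normr0 !mulr_ge0// invr_ge0 ltW.
have nw : 0 < `|w| by rewrite normr_gt0.
rewrite mulrAC ler_pdivlMr// -(ler_pM2l nw).
have := Hc w; rewrite wH => h; have := dot_le u w => /ler_normlP[h1 _]; lra.
Qed.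

Hypothesis Hsym : H^T = H.

(** The quadratic function dot u W + dot (u H) u / 2 is maximal at us = - W
    H^-1, and it is smaller by at least c rho^2 / 2 on the sphere of radius
    rho about us. This gap exceeds twice the approximation error, so that f,
    rescaled, is also smaller on the sphere than at the centre, and
    [concave_superlevel] locates its maximizer. *)
Lemma argmax_linearization (Theta : set 'rV[R]_d) (f : 'rV[R]_d -> R)
    (t tt W : 'rV[R]_d) (sg rho K1 err : R) :
  concave_seg f -> is_argmax Theta f tt -> 0 < sg -> 0 < rho ->
  `|W *m invmx H| <= K1 -> 4 * err < c * rho ^+ 2 ->
  (forall u, `|u| <= K1 + rho -> Theta (t + sg^-1 *: u) /\
    `|sg ^+ 2 * (f (t + sg^-1 *: u) - f t) - dot u W - dot (u *m H) u / 2| <= err) ->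
  `|sg *: (tt - t) + W *m invmx H| < rho.
Proof.
move=> cf [Ttt mtt] sg0 rho0 WK e4 loc.
have [us usE] : exists us, us = - (W *m invmx H) by exists (- (W *m invmx H)).
pose g u := f (t + sg^-1 *: u).
have cg : concave_seg g.
  move=> x y l l01; rewrite /g (_ : t + sg^-1 *: (x + l *: (y - x)) =
    (t + sg^-1 *: x) + l *: ((t + sg^-1 *: y) - (t + sg^-1 *: x))); first exact: cf.
  rewrite opprD addrACA subrr add0r -scalerBr scalerDr addrA !scalerA.
  by rewrite (mulrC l).
have usK1 : `|us| <= K1 by rewrite usE normrN.
have usK : `|us| <= K1 + rho by rewrite (le_trans usK1)// lerDl ltW.
have WE : W = - (us *m H) by rewrite usE mulNmx mulmxKV ?opprK// coercive_unitmx.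
have -> : sg *: (tt - t) + W *m invmx H = sg *: (tt - t) - us by rewrite usE opprK.
have gtt : g (sg *: (tt - t)) = f tt.
  by rewrite /g scalerA mulVf ?gt_eqF// scale1r subrKC.
apply: (concave_superlevel cg rho0); last first.
  by rewrite gtt; apply: mtt; have [] := loc us usK.
move=> u uE; rewrite -subr_lt0.
have uK : `|u| <= K1 + rho.
  by rewrite -(subrK us u) (le_trans (ler_normD _ _))// uE addrC lerD.
have [_ /ler_normlP[A1 A2]] := loc us usK; have [_ /ler_normlP[B1 B2]] := loc u uK.
have sg20 : 0 < sg ^+ 2 by rewrite exprn_gt0.
rewrite -(pmulr_rlt0 _ sg20).
have qE : dot u W + dot (u *m H) u / 2 =
    dot us W + dot (us *m H) us / 2 + dot ((u - us) *m H) (u - us) / 2.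
  have bsym : dot (u *m H) us = dot (us *m H) u by rewrite dot_mulmx Hsym dotC.
  rewrite WE !dotNr !(dotC _ (us *m H)) mulmxBl !(dotDl, dotNl, dotDr, dotNr) bsym.
  by field.
have := Hc (u - us); rewrite uE => h.
rewrite /g; move: A1 A2 B1 B2; set X := f (t + sg^-1 *: us); set Y := f _.
by move=> ? ? ? ?; lra.
Qed.

End quadratic_forms.

Section studentization.
Context {R : realType} {d : nat}.
Implicit Types (u v w : 'rV[R]_d).

(** The bound on B does not involve V: with w = u B and v = w H^-1, the
    identity B V B = 1 says that dot (v L) v = dot u u, the lower bound on L
    controls v, and w = v H. *)
Lemma studentizing_matrix (H L : 'M[R]_d) (c h : R) :
  0 < c -> 0 <= h -> H^T = H -> L^T = L ->
  (forall u, c * `|u| ^+ 2 <= - dot (u *m H) u) ->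
  (forall u, c ^+ 2 * `|u| ^+ 2 <= dot (u *m L) u) ->
  (forall k l, `|H k l| <= h) ->
  let V := invmx H *m L *m invmx H in
  let B := invsqrtmx V in
  [/\ B^T = B, B *m V *m B = 1%:M & forall u, `|u *m B| <= d%:R ^+ 2 * h / c * `|u|].
Proof.
move=> c0 h0 Ht Lt Hc Lc Hh V B.
have Hu : H \in unitmx := coercive_unitmx c0 Hc.
have iHt : (invmx H)^T = invmx H by rewrite trmx_inv Ht.
have VE u : dot (u *m V) u = dot ((u *m invmx H) *m L) (u *m invmx H).
  by rewrite /V !mulmxA dot_mulmx iHt.
have Vpos : posdefmx V.
  split; first by rewrite /V !trmx_mul iHt Lt mulmxA.
  move=> u u0; rewrite -[(_ *m _) 0 0]/(dot (u *m V) u) VE.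
  apply: lt_le_trans (Lc _); rewrite mulr_gt0 ?exprn_gt0// normr_gt0.
  by apply: contra u0 => /eqP uH; rewrite -[u](mulmxKV Hu) uH mul0mx eqxx.
have [[Bt _] BBV] := posdef_invsqrt Vpos.
have BVB : B *m V *m B = 1%:M.
  by have := BBV; rewrite -mulmxA => /mulmx1C.
split => // u; set w := u *m B; set v := w *m invmx H.
have E : dot (v *m L) v = dot u u.
  rewrite -VE dotC /w [LHS]dot_mulmx Bt; congr (dot u _).
  have assoc (A1 A2 : 'M[R]_d) : u *m A1 *m A2 *m A1 = u *m (A1 *m A2 *m A1).
    by rewrite !mulmxA.
  by rewrite assoc BVB mulmx1.
have wv : `|w| <= d%:R * h * `|v|.
  by rewrite -[w](mulmxKV Hu); exact: norm_mulmx_le.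
have dh0 : 0 <= d%:R * h by rewrite mulr_ge0.
have w2 : `|w| ^+ 2 <= (d%:R * h) ^+ 2 * `|v| ^+ 2.
  by rewrite -exprMn lerXn2r ?nnegrE// mulr_ge0.
have c20 : 0 < c ^+ 2 by rewrite exprn_gt0.
have v2 : `|v| ^+ 2 <= d%:R * `|u| ^+ 2 / c ^+ 2.
  rewrite ler_pdivlMr// mulrC (le_trans (Lc v))// E.
  by have /ler_normlP[_] := dot_le u u; rewrite expr2.
have C0 : 0 <= d%:R ^+ 2 * h / c * `|u|.
  by rewrite !mulr_ge0// ?exprn_ge0 ?invr_ge0 ?ltW.
rewrite -(@ler_pXn2r _ 2)// ?nnegrE//.
apply: (le_trans w2); apply: le_trans (ler_wpM2l (sqr_ge0 _) v2) _.
have -> : (d%:R * h) ^+ 2 * (d%:R * `|u| ^+ 2 / c ^+ 2) =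
   d%:R ^+ 3 * (h ^+ 2 * `|u| ^+ 2 / c ^+ 2) :> R by field; rewrite gt_eqF.
have -> : (d%:R ^+ 2 * h / c * `|u|) ^+ 2 =
   d%:R ^+ 4 * (h ^+ 2 * `|u| ^+ 2 / c ^+ 2) :> R by field; rewrite gt_eqF.
have X0 : 0 <= h ^+ 2 * `|u| ^+ 2 / c ^+ 2.
  by rewrite divr_ge0 ?(ltW c20)// mulr_ge0 ?sqr_ge0.
apply: ler_wpM2r => //.
by rewrite -!natrX ler_nat; case: (d) => // d'; rewrite leq_pexp2l.
Qed.

Lemma gradient_argmax0 (Theta : set 'rV[R]_d) (f : 'rV[R]_d -> R) t (r : R) :
  0 < r -> (forall u, `|u| <= r -> Theta (t + u)) -> is_argmax Theta f t ->
  (forall u, Theta u -> differentiable f u) -> gradient f t = 0.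
Proof.
move=> r0 ball_ [Tt ft] df; apply/rowP => k; rewrite !mxE.
set e : 'rV[R]_d := delta_mx 0 k.
have e1 : `|e| <= 1.
  by apply: normrV_le => // j; rewrite mxE eqxx /=; case: eqP; rewrite ?normr1 ?normr0.
have inT (s : R) : s \in `]- r, r[ -> Theta (t + s *: e).
  rewrite in_itv/= -ltr_norml => sr; apply: ball_.
  by rewrite normrZ (le_trans (ler_piMr _ e1))// ltW.
have dl (s : R) : s \in `]- r, r[ -> is_derive s (1 : R) (fun s => f (t + s *: e)) ('D_e f (t + s *: e)).
  by move=> /inT sT; apply/is_derive_line/diff_derivable/df.
have z0 : (0 : R) \in `]- r, r[ by rewrite in_itv/= oppr_lt0 r0.
have := @derive1_at_max R (fun s => f (t + s *: e)) (- r) r 0 _ _ z0 _.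
have := dl 0 z0; rewrite scale0r addr0 => -[_ D0] H.
have [||s sr|_ D1] := H.
- by rewrite ge0_cp// ltW.
- by move=> s sr; have [] := dl s sr.
- by rewrite ?scale0r ?addr0; apply/ft/inT.
- by rewrite -D0 D1.
Qed.
End studentization.

(** * The subsample estimator for fixed data *)

Lemma enorm_le {R : realType} {d : nat} (x : 'rV[R]_d) : enorm x <= d%:R * `|x|.
Proof.
rewrite /enorm -(@ler_pXn2r _ 2)// ?nnegrE ?sqrtr_ge0 ?mulr_ge0// sqr_sqrtr; last first.
  by apply: sumr_ge0 => j _; exact: sqr_ge0.
apply: (@le_trans _ _ (d%:R * `|x| ^+ 2)).
  rewrite -sum_const_ord; apply: ler_sum => j _.
  by rewrite -real_normK ?num_real// lerXn2r ?nnegrE// norm_coord.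
rewrite exprMn ler_wpM2r ?exprn_ge0// -natrX ler_nat.
by case: (d) => // d'; rewrite -[leqLHS]expn1 leq_pexp2l.
Qed.

Section subsample.
Context {R : realType} {d : nat} {dS : measure_display} {S : measurableType dS}.
Context (m : S -> 'rV[R]_d -> R) (psi : S -> R) (Theta : set 'rV[R]_d).
Hypothesis m_diff : forall z t, Theta t -> twice_differentiable_at (m z) t.
Hypothesis m_concave : forall z, concave (m z).
Hypothesis hess_lip : forall z t1 t2 k l, Theta t1 -> Theta t2 ->
  `|hessian (m z) t1 k l - hessian (m z) t2 k l| <= psi z * enorm (t1 - t2).

Context (n s : nat) (z : n.-tuple S) (p : 'I_n -> R) (t : 'rV[R]_d) (r c K : R).
Hypotheses (n0 : (0 < n)%N) (s0 : (0 < s)%N) (r0 : 0 < r) (c0 : 0 < c) (K0 : 0 <= K).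
Hypotheses (p0 : forall i, 0 < p i) (p1 : \sum_i p i = 1).
Hypothesis ball_t : forall u : 'rV[R]_d, `|u| <= r -> Theta (t + u).
Hypothesis t_max : is_argmax Theta (full_criterion m z) t.

Let a i : R := (n%:R * p i)^-1.
Let G i := gradient (m (tnth z i)) t.
Let Hs i := hessian (m (tnth z i)) t.
Let H := mean_hessian m z t.
Let avg (f : 'I_n -> R) : R := n%:R^-1 * \sum_i f i.

Hypothesis Hc : forall u, c * `|u| ^+ 2 <= - dot (u *m H) u.
Hypothesis Gc : forall u, c * `|u| <= avg (fun i => `|dot u (G i)|).
Hypothesis aK : forall i, a i <= K.
Hypothesis G4 : avg (fun i => `|G i| ^+ 4) <= K.
Hypothesis H2 : forall k l, avg (fun i => Hs i k l ^+ 2) <= K.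
Hypothesis psi1 : avg (fun i => `|psi (tnth z i)|) <= K.

Let n0R : 0 < n%:R :> R. Proof. by rewrite ltr0n. Qed.
Let a0 i : 0 < a i. Proof. by rewrite invr_gt0 mulr_gt0. Qed.
Let p0' i : 0 <= p i. Proof. exact: ltW. Qed.
Let Tt : Theta t. Proof. by case: t_max. Qed.

(** Inverse-probability weighting is unbiased. *)
Lemma weighted_mean f : fexp p (fun i => a i * f i) = avg f.
Proof.
rewrite /fexp /avg mulr_sumr; apply: eq_bigr => i _.
by rewrite /a; field; rewrite !gt_eqF.
Qed.

Let avg_le f g : (forall i, f i <= g i) -> avg f <= avg g.
Proof. by move=> fg; rewrite ler_wpM2l ?invr_ge0//; apply: ler_sum. Qed.

Let avgZ b f : avg (fun i => b * f i) = b * avg f.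
Proof. by rewrite /avg -mulr_sumr mulrCA. Qed.

Let avg1D f : avg (fun i => 1 + f i) = 1 + avg f.
Proof. by rewrite /avg big_split /= sum_const_ord mulr1 mulrDr mulVf// gt_eqF. Qed.

Let in_ball u (e : R) : `|u| <= r -> 0 <= e <= 1 -> Theta (t + e *: u).
Proof.
move=> ur /andP[e0 e1]; apply: ball_t; rewrite normrZ ger0_norm//.
by rewrite (le_trans _ ur)// ler_piMl.
Qed.

Lemma mean_gradient0 k : avg (fun i => G i 0 k) = 0.
Proof.
have dm i u : Theta u -> differentiable (m (tnth z i)) u.
  by move=> Tu; have [/nbhs_singleton] := m_diff (tnth z i) Tu.
have fE : full_criterion m z = n%:R^-1 \*: \sum_(i < n) m (tnth z i).
  by apply/funext => u; rewrite /full_criterion /= fct_sumE.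
have df u : Theta u -> differentiable (full_criterion m z) u.
  by move=> Tu; rewrite fE; apply/differentiableZ/differentiable_sum => i; exact: dm.
have /rowP/(_ k) := gradient_argmax0 r0 ball_t t_max df.
rewrite !mxE => <-; rewrite fE deriveZ; last first.
  by apply: derivable_sum => i; apply/diff_derivable/dm.
rewrite derive_sum; last by move=> i; apply/diff_derivable/dm.
by congr (_ * _); apply: eq_bigr => i _; rewrite mxE.
Qed.

Let HE k l : H k l = avg (fun i => Hs i k l).
Proof. by rewrite /H /mean_hessian mxE summxE. Qed.

Let Hsym : H^T = H.
Proof.
apply/matrixP => k l; rewrite mxE !HE; congr (_ * _); apply: eq_bigr => i _.
by rewrite /Hs -[in LHS](hessian_sym (m_diff (tnth z i) Tt)) mxE.
Qed.

Let Hbound k l : `|H k l| <= 1 + K.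
Proof.
rewrite HE; apply: (@le_trans _ _ (avg (fun i => 1 + Hs i k l ^+ 2))).
  rewrite normrM ger0_norm ?invr_ge0 ?(ltW n0R)// ler_wpM2l ?invr_ge0 ?(ltW n0R)//.
  apply: le_trans (ler_norm_sum _ _ _) _; apply: ler_sum => i _.
  rewrite -(real_normK (num_real (Hs i k l))).
  by have := sqr_ge0 (`|Hs i k l| - 1); have := sqr_ge0 `|Hs i k l|; lra.
by rewrite avg1D lerD2l.
Qed.

Let L := LambdaR m p z t.

Let LE u v : dot (u *m L) v = fexp p (fun i => (a i * dot u (G i)) * (a i * dot v (G i))).
Proof.
rewrite /L /LambdaR -scalemxAr dotZl mulmx_sumr /fexp.
have -> : dot (\sum_i u *m ((p i)^-1 *: ((G i)^T *m G i))) v =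
    \sum_i (p i)^-1 * (dot u (G i) * dot v (G i)).
  rewrite /dot mulmx_suml summxE; apply: eq_bigr => i _.
  rewrite -scalemxAr -scalemxAl mxE; congr (_ * _).
  by rewrite mulmxA -(mulmxA _ (G i)) mxE big_ord1 -[X in _ * X]/(dot (G i) v) (dotC _ v).
rewrite mulr_sumr; apply: eq_bigr => i _; rewrite /a.
by field; rewrite !gt_eqF.
Qed.

Let Lsym : L^T = L.
Proof.
rewrite /L /LambdaR linearZ /= linear_sum; congr (_ *: _); apply: eq_bigr => i _.
by rewrite linearZ /= trmx_mul trmxK.
Qed.

(** Jensen's inequality: a second moment is at least the square of the mean
    absolute value, and by [weighted_mean] the latter is an unweighted
    average. The bound is therefore uniform in p. *)
Let Lc u : c ^+ 2 * `|u| ^+ 2 <= dot (u *m L) u.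
Proof.
rewrite LE -exprMn; set f := fun i => a i * dot u (G i).
set e := avg (fun i => `|dot u (G i)|).
have eE : e = fexp p (fun i => `|f i|).
  rewrite /e -weighted_mean; congr (fexp p _); apply/funext => i.
  by rewrite /f normrM gtr0_norm.
have ce : c * `|u| <= e := Gc u.
have cu0 : 0 <= c * `|u| by rewrite mulr_ge0// ltW.
apply: (@le_trans _ _ (e ^+ 2)); first by rewrite lerXn2r ?nnegrE// (le_trans cu0).
have : 0 <= fexp p (fun i => f i * f i + (- (2 * e) * `|f i| + e ^+ 2)).
  apply: sumr_ge0 => i _; rewrite mulr_ge0// -expr2 -real_normK ?num_real//.
  by have := sqr_ge0 (`|f i| - e); lra.
rewrite !fexpD fexpZ -eE fexp_cst//; lra.
Qed.

Let B := invsqrtmx (VR m p z t).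
Definition studentizer_bd : R := d%:R ^+ 2 * (1 + K) / c.

Let studentB : [/\ B^T = B, B *m VR m p z t *m B = 1%:M &
  forall u : 'rV[R]_d, `|u *m B| <= studentizer_bd * `|u|].
Proof.
by apply: studentizing_matrix => //; rewrite addr_ge0.
Qed.

Let CB0 : 0 <= studentizer_bd.
Proof. by rewrite /studentizer_bd !mulr_ge0 ?exprn_ge0 ?addr_ge0// invr_ge0 ltW. Qed.

(** The contribution of one draw to the standardized error, up to the factor
    s^(-1/2). *)
Let X i := - (a i *: (G i *m invmx H *m B)).

Let XE i k : X i 0 k = a i * - (G i *m invmx H *m B) 0 k.
Proof. by rewrite !mxE mulrN. Qed.

(** The gradient of the full criterion vanishes at its maximizer. *)
Lemma influence_mean k : fexp p (fun i => X i 0 k) = 0.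
Proof.
pose w l := - (invmx H *m B) l k.
transitivity (\sum_l w l * fexp p (fun i => a i * G i 0 l)); last first.
  by rewrite big1// => l _; rewrite weighted_mean mean_gradient0 mulr0.
rewrite /fexp; under [RHS]eq_bigr do rewrite mulr_sumr.
rewrite exchange_big /=; apply: eq_bigr => i _.
rewrite XE -mulmxA mxE -sumrN !mulr_sumr.
by apply: eq_bigr => l _; rewrite /w; ring.
Qed.

(** The standardizing matrix is built from the same data, so that the
    covariance is the identity exactly and not only in the limit. *)
Lemma influence_cov k l : fexp p (fun i => X i 0 k * X i 0 l) = (k == l)%:R.
Proof.
have [Bt BVB _] := studentB.
have iHt : (invmx H)^T = invmx H by rewrite trmx_inv Hsym.
have -> : (k == l)%:R = (1%:M : 'M[R]_d) k l by rewrite mxE.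
rewrite -BVB /VR -/H -/L.
pose ek : 'rV[R]_d := delta_mx 0 k; pose el : 'rV[R]_d := delta_mx 0 l.
have dE (v : 'rV[R]_d) j : v 0 j = dot (delta_mx 0 j) v.
  rewrite dotE (bigD1 j)//= mxE !eqxx mul1r big1 ?addr0// => j' jj.
  by rewrite mxE eqxx (negbTE jj) mul0r.
have sE : (B *m (invmx H *m L *m invmx H) *m B) k l =
    dot ((ek *m B *m invmx H) *m L) (el *m B *m invmx H).
  rewrite [RHS]dotC dot_mulmx iHt dot_mulmx Bt -dE.
  by rewrite /ek -rowE -!row_mul [RHS]mxE !mulmxA.
rewrite sE LE; congr (fexp p _); apply/funext => i.
rewrite !XE !dE.
have E (v : 'rV[R]_d) : dot v (G i *m invmx H *m B) = dot (v *m B *m invmx H) (G i).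
  by rewrite [LHS]dotC [LHS]dot_mulmx [LHS]dot_mulmx iHt Bt [LHS]dotC.
by rewrite !E; ring.
Qed.

Definition third_moment_bd : R := K ^+ 2 * (studentizer_bd * (d%:R / c)) ^+ 3 * (1 + K).

(** One factor a i is kept to undo the weighting and the other two are
    bounded by K; the third power of the gradient is bounded by means of its
    fourth. *)
Lemma influence_third : fexp p (fun i => `|X i| ^+ 3) <= third_moment_bd.
Proof.
have [_ _ BC] := studentB.
set C := studentizer_bd * (d%:R / c).
have C0 : 0 <= C by rewrite /C mulr_ge0// divr_ge0// ltW.
have Xn i : `|X i| <= a i * (C * `|G i|).
  rewrite normrN normrZ gtr0_norm// ler_pM2l//; apply: le_trans (BC _) _.
  rewrite /C -mulrA ler_wpM2l//; exact: coercive_invmx.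
apply: (@le_trans _ _ (fexp p (fun i => a i * (K ^+ 2 * C ^+ 3 * (1 + `|G i| ^+ 4))))).
  apply: fexp_le => // i.
  apply: (@le_trans _ _ ((a i * (C * `|G i|)) ^+ 3)).
    by rewrite lerXn2r ?nnegrE// (le_trans _ (Xn i)).
  have g30 : 0 <= `|G i| ^+ 3 by rewrite exprn_ge0.
  have g34 : `|G i| ^+ 3 <= 1 + `|G i| ^+ 4.
    have := sqr_ge0 (`|G i| - `|G i| ^+ 2); have := sqr_ge0 (1 - `|G i| ^+ 2).
    by have := sqr_ge0 (`|G i| ^+ 2); lra.
  have aK2 : a i ^+ 2 <= K ^+ 2 by rewrite lerXn2r ?nnegrE ?(ltW (a0 i)).
  have -> : (a i * (C * `|G i|)) ^+ 3 = a i * (a i ^+ 2 * (C ^+ 3 * `|G i| ^+ 3)) by ring.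
  rewrite ler_pM2l// -[leRHS]mulrA; apply: ler_pM => //.
  - exact: sqr_ge0.
  - by rewrite mulr_ge0// exprn_ge0.
  - by apply: ler_wpM2l => //; rewrite exprn_ge0.
rewrite weighted_mean avgZ avg1D /third_moment_bd -/C ler_wpM2l ?lerD2l//.
by rewrite mulr_ge0 ?exprn_ge0.
Qed.

Let sR : 0 < s%:R :> R. Proof. by rewrite ltr0n. Qed.
Let sg : R := Num.sqrt s%:R.
Let sg0 : 0 < sg. Proof. by rewrite sqrtr_gt0. Qed.
Let sg2 : sg ^+ 2 = s%:R. Proof. by rewrite sqr_sqrtr// ltW. Qed.

Implicit Types (h : s.-tuple 'I_n).

Definition score h : 'rV[R]_d := sg^-1 *: \sum_(j < s) a (tnth h j) *: G (tnth h j).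
Definition hess_dev h k l : R :=
  \sum_(j < s) (a (tnth h j) * Hs (tnth h j) k l - H k l).
Definition psi_sum h : R := \sum_(j < s) a (tnth h j) * `|psi (tnth z (tnth h j))|.

Lemma subsample_criterionE h u : subsample_criterion m p z h u =
  \sum_(j < s) (s%:R^-1 * a (tnth h j)) * m (tnth z (tnth h j)) u.
Proof.
apply: eq_bigr => j _; rewrite /a.
by field; rewrite !gt_eqF.
Qed.

Lemma subsample_criterion_concave h : concave_seg (subsample_criterion m p z h).
Proof.
rewrite (_ : subsample_criterion m p z h =
    fun u => \sum_(j < s) (s%:R^-1 * a (tnth h j)) * m (tnth z (tnth h j)) u).
  apply: concave_seg_sum => j; first by apply: mulr_ge0; [rewrite invr_ge0 ltW|exact: ltW].
  exact: concave_concave_seg.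
by apply/funext => u; exact: subsample_criterionE.
Qed.

Let qform (A : 'I_d -> 'I_d -> R) (u : 'rV[R]_d) : R :=
  \sum_k u 0 k * \sum_l A k l * u 0 l.

Let qformE (A : 'M[R]_d) u : dot (u *m A) u = qform (fun k l => A k l) u.
Proof.
rewrite dot_mulmx dotE; apply: eq_bigr => k _; congr (_ * _).
by rewrite mxE; apply: eq_bigr => l _; rewrite mxE mulrC.
Qed.

Let qform_le (A : 'I_d -> 'I_d -> R) (u : 'rV[R]_d) (e : R) :
  (forall k l, `|A k l| <= e) -> `|qform A u| <= e * (d%:R * `|u|) ^+ 2.
Proof.
move=> Ae; apply: le_trans (ler_norm_sum _ _ _) _.
have -> : e * (d%:R * `|u|) ^+ 2 = \sum_(k < d) `|u| * (\sum_(l < d) e * `|u|).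
  by rewrite !sum_const_ord; ring.
apply: ler_sum => k _; rewrite normrM ler_pM ?norm_coord//.
apply: le_trans (ler_norm_sum _ _ _) _; apply: ler_sum => l _.
by rewrite normrM ler_pM ?norm_coord.
Qed.

Let qformD (A A' : 'I_d -> 'I_d -> R) (b : R) u :
  qform (fun k l => b * A k l + A' k l) u = b * qform A u + qform A' u.
Proof.
rewrite /qform [X in _ = X + _]mulr_sumr -big_split; apply: eq_bigr => k _ /=.
rewrite mulrCA -mulrDr; congr (_ * _).
by rewrite mulr_sumr -big_split; apply: eq_bigr => l _ /=; ring.
Qed.

Let qform_sum (J : Type) (rs : seq J) (b : J -> R) (A : J -> 'I_d -> 'I_d -> R) u :
  \sum_(j <- rs) b j * qform (A j) u = qform (fun k l => \sum_(j <- rs) b j * A j k l) u.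
Proof.
elim: rs => [|j rs IH].
  rewrite big_nil /qform big1// => k _.
  by rewrite big1 ?mulr0// => l _; rewrite big_nil mul0r.
rewrite big_cons IH -qformD; congr (qform _ u); apply/funext => k; apply/funext => l.
by rewrite big_cons.
Qed.

(** Taylor expansion of every term at t, at the scale s^(-1/2). The second-
    order terms differ from H by the centred sum hess_dev, and the Lipschitz
    constants of the Hessians enter through psi_sum. *)
Lemma local_expansion h u (dl K2 : R) : `|u| <= sg * r ->
  (forall k l, `|hess_dev h k l| <= s%:R * dl) -> psi_sum h <= s%:R * K2 ->
  `|sg ^+ 2 * (subsample_criterion m p z h (t + sg^-1 *: u) - subsample_criterion m p z h t)
     - dot u (score h) - dot (u *m H) u / 2| <=
  dl * (d%:R * `|u|) ^+ 2 + K2 * (d%:R * `|u|) ^+ 3 / sg.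
Proof.
move=> ur Hd Pd; set u' := sg^-1 *: u.
have nu' : `|u'| = `|u| / sg by rewrite normrZ gtr0_norm ?invr_gt0// mulrC.
have u'r : `|u'| <= r by rewrite nu' ler_pdivrMr// mulrC.
pose rho i := m (tnth z i) (t + u') - m (tnth z i) t - dot u' (G i)
  - qform (fun k l => Hs i k l) u' / 2.
have rhoB i : `|rho i| <= `|psi (tnth z i)| * ((d%:R * `|u|) ^+ 3 / sg ^+ 3).
  have -> : `|psi (tnth z i)| * ((d%:R * `|u|) ^+ 3 / sg ^+ 3) =
     (`|psi (tnth z i)| * (d%:R * `|u'|)) * (d%:R * `|u'|) ^+ 2.
    by rewrite nu'; field; rewrite gt_eqF.
  rewrite /rho dotE; apply: taylor_hessian => [e e01|e k l e01].
    exact/m_diff/in_ball.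
  apply: le_trans (hess_lip _ _ _ (in_ball u'r e01) Tt) _.
  rewrite addrC addKr; apply: (@le_trans _ _ (`|psi (tnth z i)| * enorm (e *: u'))).
    by rewrite ler_wpM2r ?sqrtr_ge0// ler_norm.
  rewrite ler_wpM2l//; apply: le_trans (enorm_le _) _.
  rewrite ler_wpM2l// normrZ; case/andP: e01 => e0 e1.
  by rewrite ger0_norm// ler_piMl.
have -> : sg ^+ 2 * (subsample_criterion m p z h (t + u') - subsample_criterion m p z h t)
    - dot u (score h) - dot (u *m H) u / 2 =
    \sum_(j < s) a (tnth h j) * rho (tnth h j) + qform (hess_dev h) u / s%:R / 2.
  rewrite !subsample_criterionE -sumrB mulr_sumr sg2.
  have e1 : dot u (score h) = \sum_(j < s) a (tnth h j) * dot u' (G (tnth h j)).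
    rewrite /score dotZr dot_sumr mulr_sumr; apply: eq_bigr => j _.
    by rewrite dotZr /u' dotZl mulrCA.
  have e2 : \sum_(j < s) a (tnth h j) * qform (fun k l => Hs (tnth h j) k l) u' =
      dot (u *m H) u + qform (hess_dev h) u / s%:R.
    have qZ (A : 'I_d -> 'I_d -> R) : qform A u' = qform A u / s%:R.
      rewrite /qform mulr_suml; apply: eq_bigr => k _; rewrite mxE -sg2.
      under eq_bigr do rewrite mxE mulrCA.
      rewrite -mulr_sumr; field.
      by rewrite gt_eqF.
    under eq_bigr do rewrite qZ mulrA.
    rewrite -mulr_suml qform_sum qformE.
    rewrite (_ : (fun k l => _) = (fun k l => s%:R * H k l + hess_dev h k l)).
      by rewrite qformD; field; rewrite gt_eqF.
    apply/funext => k; apply/funext => l.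
    by rewrite /hess_dev sumrB sum_const_ord subrKC.
  have -> : dot (u *m H) u / 2 = \sum_(j < s) a (tnth h j) * qform (fun k l => Hs (tnth h j) k l) u' / 2
      - qform (hess_dev h) u / s%:R / 2.
    by rewrite -mulr_suml e2; ring.
  rewrite e1 opprD opprK addrA; congr (_ + _); rewrite -!sumrB; apply: eq_bigr => j _.
  by rewrite /rho; field; rewrite gt_eqF.
apply: le_trans (ler_normD _ _) _; rewrite addrC; apply: lerD.
  have := qform_le u Hd; rewrite normrM normrM (gtr0_norm (_ : 0 < 2^-1)) ?invr_gt0//.
  rewrite (gtr0_norm (_ : 0 < s%:R^-1)) ?invr_gt0// => q1.
  have : `|qform (hess_dev h) u| / s%:R <= dl * (d%:R * `|u|) ^+ 2.
    by rewrite ler_pdivrMr// mulrC mulrA.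
  have : 0 <= `|qform (hess_dev h) u| / s%:R by rewrite divr_ge0// ltW.
  by lra.
apply: (@le_trans _ _ (psi_sum h * ((d%:R * `|u|) ^+ 3 / sg ^+ 3))).
  apply: le_trans (ler_norm_sum _ _ _) _; rewrite /psi_sum mulr_suml.
  by apply: ler_sum => j _; rewrite normrM gtr0_norm// -mulrA ler_pM2l.
have d3 : 0 <= (d%:R * `|u|) ^+ 3 / sg ^+ 3 :> R.
  by rewrite divr_ge0 ?exprn_ge0 ?mulr_ge0// ltW.
apply: le_trans (ler_wpM2r d3 Pd) _; rewrite le_eqVlt; apply/orP; left; apply/eqP.
by rewrite -sg2; field; rewrite gt_eqF.
Qed.

Let avg_sqr_grad k : avg (fun i => G i 0 k ^+ 2) <= 1 + K.
Proof.
apply: (@le_trans _ _ (avg (fun i => 1 + `|G i| ^+ 4))); last by rewrite avg1D lerD2l.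
apply: avg_le => i; rewrite -real_normK ?num_real//.
have : `|G i 0 k| ^+ 2 <= `|G i| ^+ 2 by rewrite lerXn2r ?nnegrE// norm_coord.
by have := sqr_ge0 (`|G i| ^+ 2 - 1); have := sqr_ge0 (`|G i| ^+ 2); lra.
Qed.

(** Chebyshev's inequality for each coordinate. *)
Lemma score_tail (c1 : R) : 0 < c1 ->
  rexp p (fun h => (c1 < `|score h|)%R%:R) <= d%:R * (K * (1 + K)) / c1 ^+ 2.
Proof.
move=> c10; have cs0 : 0 < c1 * sg by rewrite mulr_gt0.
apply: (@le_trans _ _ (\sum_(k < d) rexp p (fun h => (c1 * sg <
    `|\sum_(j < s) a (tnth h j) * G (tnth h j) 0 k|)%R%:R))).
  rewrite /rexp exchange_big /=; apply: ler_sum => h _; rewrite -mulr_sumr.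
  rewrite ler_wpM2l ?prodr_ge0//; case: ltP => [c1W|_]; last exact: sumr_ge0.
  have [k ck] : exists k, c1 < `|score h 0 k|.
    apply: contrapT => /forallNP H'; move: c1W; apply/negP; rewrite -leNgt.
    by apply: normrV_le => [|k]; [exact: ltW|rewrite leNgt; apply/negP/H'].
  rewrite (bigD1 k)//= (_ : (_ < _) = true) ?lerDl ?sumr_ge0//.
  have e : score h 0 k = sg^-1 * \sum_(j < s) a (tnth h j) * G (tnth h j) 0 k.
    rewrite /score [LHS]mxE summxE; congr (_ * _); apply: eq_bigr => j _.
    by rewrite [LHS]mxE.
  by move: ck; rewrite e normrM gtr0_norm ?invr_gt0// mulrC ltr_pdivlMr.
rewrite -mulrA -sum_const_ord; apply: ler_sum => k _.
have mean0 : fexp p (fun i => a i * G i 0 k) = 0.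
  by rewrite weighted_mean mean_gradient0.
apply: le_trans (rexp_chebyshev p0' p1 s cs0 mean0) _.
have -> : s%:R * fexp p (fun i => (a i * G i 0 k) ^+ 2) / (c1 * sg) ^+ 2 =
    fexp p (fun i => (a i * G i 0 k) ^+ 2) / c1 ^+ 2.
  by rewrite exprMn -sg2; field; rewrite !gt_eqF.
rewrite ler_pM2r ?invr_gt0 ?exprn_gt0//.
apply: (@le_trans _ _ (fexp p (fun i => a i * (K * G i 0 k ^+ 2)))).
  apply: fexp_le => // i; rewrite exprMn expr2 -mulrA ler_pM2l//.
  by rewrite ler_wpM2r ?sqr_ge0.
by rewrite weighted_mean avgZ ler_wpM2l.
Qed.

Lemma hess_dev_tail (dl : R) : 0 < dl ->
  rexp p (fun h => (~~ [forall k, [forall l, `|hess_dev h k l| <= s%:R * dl]])%:R) <=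
  d%:R * (d%:R * (K ^+ 2 / (s%:R * dl ^+ 2))).
Proof.
move=> dl0; have sd0 : 0 < s%:R * dl by rewrite mulr_gt0.
apply: (@le_trans _ _ (\sum_(k < d) \sum_(l < d) rexp p (fun h => (s%:R * dl <
    `|hess_dev h k l|)%R%:R))).
  under [leRHS]eq_bigr do rewrite /rexp exchange_big /=.
  rewrite /rexp [leRHS]exchange_big /=; apply: ler_sum => h _.
  under [leRHS]eq_bigr do rewrite -mulr_sumr.
  rewrite -mulr_sumr.
  rewrite ler_wpM2l ?prodr_ge0//; case: forallPn => [[k /forallPn[l ckl]]|_]; last first.
    by apply: sumr_ge0 => k _; exact: sumr_ge0.
  rewrite (bigD1 k)//= (bigD1 l)//= ltNge ckl -addrA lerDl addr_ge0//.
    exact: sumr_ge0.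
  by apply: sumr_ge0 => k' _; exact: sumr_ge0.
rewrite -[leRHS]sum_const_ord; apply: ler_sum => k _; rewrite -[leRHS]sum_const_ord.
apply: ler_sum => l _.
have mean0 : fexp p (fun i => a i * Hs i k l - H k l) = 0.
  by rewrite fexpD fexp_cst// weighted_mean -HE subrr.
apply: le_trans (rexp_chebyshev p0' p1 s sd0 mean0) _.
have -> : s%:R * fexp p (fun i => (a i * Hs i k l - H k l) ^+ 2) / (s%:R * dl) ^+ 2 =
   fexp p (fun i => (a i * Hs i k l - H k l) ^+ 2) / (s%:R * dl ^+ 2).
  by field; rewrite !gt_eqF.
rewrite ler_pM2r ?invr_gt0 ?mulr_gt0 ?exprn_gt0//.
apply: (@le_trans _ _ (fexp p (fun i => a i * (K * Hs i k l ^+ 2)))); last first.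
  by rewrite weighted_mean avgZ expr2 ler_wpM2l.
have : fexp p (fun i => (a i * Hs i k l - H k l) ^+ 2) =
    fexp p (fun i => (a i * Hs i k l) ^+ 2) - H k l ^+ 2.
  rewrite (_ : (fun i => (a i * Hs i k l - H k l) ^+ 2) = (fun i =>
    (a i * Hs i k l) ^+ 2 + (- (2 * H k l) * (a i * Hs i k l) + H k l ^+ 2))).
    by rewrite !fexpD fexpZ fexp_cst// weighted_mean -HE; ring.
  by apply/funext => i; ring.
move=> ->; apply: (@le_trans _ _ (fexp p (fun i => (a i * Hs i k l) ^+ 2))).
  by rewrite gerBl sqr_ge0.
apply: fexp_le => // i; rewrite exprMn expr2 -mulrA ler_pM2l//.
by rewrite ler_wpM2r ?sqr_ge0.
Qed.

(** Markov's inequality, as only a first moment of psi is controlled. *)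
Lemma psi_tail (K2 : R) : 0 < K2 ->
  rexp p (fun h => (s%:R * K2 < psi_sum h)%R%:R) <= K / K2.
Proof.
move=> K20; have sK : 0 < s%:R * K2 by rewrite mulr_gt0.
apply: le_trans (rexp_markov p0' sK _) _.
  by move=> h; apply: sumr_ge0 => j _; rewrite mulr_ge0// ltW.
have -> : rexp p (fun h => psi_sum h) = s%:R * fexp p (fun i => a i * `|psi (tnth z i)|).
  exact: rexp_sum.
rewrite weighted_mean -mulf_div mulfV ?gt_eqF// mul1r.
by rewrite ler_pM2r ?invr_gt0.
Qed.

Context (tt : s.-tuple 'I_n -> 'rV[R]_d).
Hypothesis tt_max : forall h, is_argmax Theta (subsample_criterion m p z h) (tt h).

Lemma estimator_linearization h (c1 dl K2 rho : R) :
  let R1 := d%:R / c * c1 + rho in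
  0 < rho -> 0 <= c1 -> 0 <= dl -> 0 <= K2 ->
  `|score h| <= c1 -> (forall k l, `|hess_dev h k l| <= s%:R * dl) ->
  psi_sum h <= s%:R * K2 -> R1 <= sg * r ->
  4 * (dl * (d%:R * R1) ^+ 2 + K2 * (d%:R * R1) ^+ 3 / sg) < c * rho ^+ 2 ->
  `|sg *: (tt h - t) + score h *m invmx H| < rho.
Proof.
move=> R1 rho0 c10 dl0 K20 Wc Hd Pd R1r err.
apply: (@argmax_linearization _ _ _ _ c0 Hc Hsym Theta (subsample_criterion m p z h)
  t (tt h) (score h) sg rho (d%:R / c * c1) _ _ _ sg0 rho0 _ err) => //.
- exact: subsample_criterion_concave.
- apply: le_trans (coercive_invmx c0 Hc _) _; rewrite ler_wpM2l// divr_ge0//.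
  exact: ltW.
move=> u uR; have ur : `|u| <= sg * r by exact: le_trans R1r.
split.
  apply: ball_t; rewrite normrZ gtr0_norm ?invr_gt0// mulrC ler_pdivrMr//.
  by rewrite mulrC.
apply: le_trans (local_expansion ur Hd Pd) _.
have du : d%:R * `|u| <= d%:R * R1 by rewrite ler_wpM2l.
have du0 : 0 <= d%:R * `|u| by rewrite mulr_ge0.
have dR0 : 0 <= d%:R * R1 by exact: le_trans du.
apply: lerD; first by rewrite ler_wpM2l// lerXn2r ?nnegrE.
by rewrite ler_pM2r ?invr_gt0// ler_wpM2l// lerXn2r ?nnegrE.
Qed.

(** The constants of [remainder_tail], in the order in which they are
    chosen: the precision of the linearization, bounds on the score and on
    psi_sum that fail with probability at most eta / 3 each, the radius of
    the ball where the expansion is needed, the deviation of the Hessian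
    that this radius tolerates, and finally lower bounds for sqrt s and s.
    They depend on the data through r, c and K only, which makes the final
    estimate uniform. *)
Definition tol eta : R := eta / (studentizer_bd + 1).
Definition score_bd eta : R := 1 + 3 * d%:R * (K * (1 + K)) / eta.
Definition psi_bd eta : R := 1 + 3 * K / eta.
Definition radius eta : R := d%:R / c * score_bd eta + tol eta.
Definition hess_bd eta : R := c * tol eta ^+ 2 / (8 * ((d%:R * radius eta) ^+ 2 + 1)).
Definition root_bd eta : R :=
  8 * (psi_bd eta * (d%:R * radius eta) ^+ 3) / (c * tol eta ^+ 2) + radius eta / r + 1.
Definition size_bd eta : R :=
  root_bd eta ^+ 2 + 3 * (d%:R ^+ 2 * K ^+ 2) / (hess_bd eta ^+ 2 * eta).

(** Outside three exceptional events of probability at most eta / 3, the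
    standardized error is within eta of the normalized sum of the
    influences, by [argmax_linearization] and the expansion
    [local_expansion]. *)
Lemma remainder_tail eta : 0 < eta -> size_bd eta <= s%:R ->
  rexp p (fun h => (eta < `|standardized_error m s p z t (tt h) -
     (Num.sqrt s%:R)^-1 *: \sum_(j < s) X (tnth h j)|)%R%:R) <= eta.
Proof.
move=> eta0 sb; have CB1 : 0 < studentizer_bd + 1 by rewrite ltr_wpDl.
have rho0 : 0 < tol eta by rewrite divr_gt0.
have c10 : 0 < score_bd eta.
  by rewrite ltr_pwDl// divr_ge0 ?(ltW eta0)// !mulr_ge0// addr_ge0.
have K20 : 0 < psi_bd eta by rewrite ltr_pwDl// divr_ge0 ?(ltW eta0)// mulr_ge0.
have R10 : 0 < radius eta.
  by rewrite ltr_wpDl// mulr_ge0//; [apply: divr_ge0 => //|]; exact: ltW.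
have q0 : 0 < c * tol eta ^+ 2 by rewrite mulr_gt0 ?exprn_gt0.
have dR0 : 0 <= d%:R * radius eta by rewrite mulr_ge0// ltW.
have den0 : 0 < 8 * ((d%:R * radius eta) ^+ 2 + 1).
  by rewrite mulr_gt0// ltr_wpDl// exprn_ge0.
have dl0 : 0 < hess_bd eta by rewrite divr_gt0.
have t1 : 0 <= 8 * (psi_bd eta * (d%:R * radius eta) ^+ 3) / (c * tol eta ^+ 2).
  apply: divr_ge0; last exact: ltW.
  by apply: mulr_ge0 => //; apply: mulr_ge0; [exact: ltW|exact: exprn_ge0].
have t2 : 0 <= radius eta / r by apply: divr_ge0; exact: ltW.
have t3 : 0 <= 3 * (d%:R ^+ 2 * K ^+ 2) / (hess_bd eta ^+ 2 * eta).
  apply: divr_ge0; first by rewrite !mulr_ge0 ?exprn_ge0.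
  by apply: mulr_ge0; [exact: sqr_ge0|exact: ltW].
have root0 : 0 <= root_bd eta by rewrite /root_bd !addr_ge0.
have rsg : root_bd eta <= sg.
  rewrite -(@ler_pXn2r _ 2) ?nnegrE// ?(ltW sg0)// sg2.
  by apply: le_trans sb; rewrite lerDl.
have h3 : 3 * (d%:R ^+ 2 * K ^+ 2) / (hess_bd eta ^+ 2 * eta) <= s%:R.
  by apply: le_trans sb; rewrite lerDr sqr_ge0.
have R1r : radius eta <= sg * r.
  rewrite -ler_pdivrMr//; apply: le_trans rsg; rewrite /root_bd; lra.
have err : 4 * (hess_bd eta * (d%:R * radius eta) ^+ 2 +
    psi_bd eta * (d%:R * radius eta) ^+ 3 / sg) < c * tol eta ^+ 2.
  have e1 : 8 * (hess_bd eta * (d%:R * radius eta) ^+ 2) < c * tol eta ^+ 2.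
    rewrite /hess_bd; set q := c * tol eta ^+ 2; set y := (d%:R * radius eta) ^+ 2.
    have -> : 8 * (q / (8 * (y + 1)) * y) = q * y / (y + 1).
      by field; rewrite gt_eqF// ltr_wpDl// exprn_ge0.
    rewrite ltr_pdivrMr; last by rewrite ltr_wpDl// exprn_ge0.
    by rewrite ltr_pM2l//; lra.
  have e2 : 8 * (psi_bd eta * (d%:R * radius eta) ^+ 3 / sg) <= c * tol eta ^+ 2.
    rewrite mulrA ler_pdivrMr// (mulrC (c * _)) -ler_pdivrMr//.
    by apply: le_trans rsg; rewrite /root_bd; lra.
  by lra.
have [_ _ BC] := studentB.
have DS h : standardized_error m s p z t (tt h) - (Num.sqrt s%:R)^-1 *: \sum_(j < s) X (tnth h j)
    = (sg *: (tt h - t) + score h *m invmx H) *m B.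
  rewrite /standardized_error -/B scalemxAl [RHS]mulmxDl; congr (_ + _).
  rewrite /score -!scalemxAl -scalerN -sumrN !mulmx_suml; congr (_ *: _).
  by apply: eq_bigr => j _; rewrite /X opprK -!scalemxAl.
apply: (@le_trans _ _ (rexp p (fun h => (score_bd eta < `|score h|)%R%:R +
   ((~~ [forall k, [forall l, `|hess_dev h k l| <= s%:R * hess_bd eta]])%:R +
    (s%:R * psi_bd eta < psi_sum h)%R%:R)))).
  apply: rexp_le => // h.
  rewrite -!natrD ler_nat DS; case: ltP => // big.
  case: ltP => [_|Wc]; first by rewrite add1n.
  case: (boolP [forall k, _]) => [/forallP Hd|_]; last by rewrite add0n add1n.
  case: ltP => [//|Pd]; exfalso; move: big; apply/negP; rewrite -leNgt.
  have Hd' k l : `|hess_dev h k l| <= s%:R * hess_bd eta by have /forallP := Hd k; exact.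
  have lin := estimator_linearization rho0 (ltW c10) (ltW dl0) (ltW K20) Wc Hd' Pd R1r err.
  apply: le_trans (BC _) _; apply: le_trans (ler_wpM2l CB0 (ltW lin)) _.
  by rewrite /tol mulrA ler_pdivrMr// mulrC ler_pM2l// lerDl.
rewrite !rexpD.
have S1 := score_tail c10; have S2 := hess_dev_tail dl0; have S3 := psi_tail K20.
have U1 : d%:R * (K * (1 + K)) / score_bd eta ^+ 2 <= eta / 3.
  rewrite ler_pdivrMr ?exprn_gt0//.
  have x0 : 0 <= 3 * d%:R * (K * (1 + K)) / eta.
    by rewrite divr_ge0 ?(ltW eta0)// !mulr_ge0// addr_ge0.
  have -> : d%:R * (K * (1 + K)) = eta / 3 * (3 * d%:R * (K * (1 + K)) / eta).
    by field; rewrite gt_eqF.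
  rewrite ler_pM2l ?divr_gt0// /score_bd; move: (_ / eta) x0 => y y0.
  by have := sqr_ge0 y; lra.
have U2 : d%:R * (d%:R * (K ^+ 2 / (s%:R * hess_bd eta ^+ 2))) <= eta / 3.
  have hb : 0 < hess_bd eta ^+ 2 by rewrite exprn_gt0.
  move: h3; rewrite ler_pdivrMr; last by rewrite mulr_gt0.
  have -> : d%:R * (d%:R * (K ^+ 2 / (s%:R * hess_bd eta ^+ 2))) =
    d%:R ^+ 2 * K ^+ 2 / (s%:R * hess_bd eta ^+ 2) by rewrite !mulrA.
  rewrite ler_pdivrMr; last by rewrite mulr_gt0.
  by lra.
have U3 : K / psi_bd eta <= eta / 3.
  rewrite ler_pdivrMr// /psi_bd; have -> : eta / 3 * (1 + 3 * K / eta) = eta / 3 + K.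
    by field; rewrite gt_eqF.
  by rewrite lerDr divr_ge0// ltW.
by lra.
Qed.
End subsample.

(** * Conditional normality for fixed data *)

Lemma resampling_probE {R : realType} (n s : nat) (p : 'I_n -> R) (E : pred (s.-tuple 'I_n)) :
  resampling_prob p [set k | E k] = rexp p (fun k => (E k)%:R).
Proof.
rewrite /resampling_prob /rexp big_mkcond; apply: eq_bigr => k _.
have -> : (k \in [set k | E k]) = E k by apply/idP/idP; rewrite inE.
by case: (E k); rewrite ?mulr1 ?mulr0.
Qed.

(** A statement about fixed data: [clt_with_remainder] applied to the
    influences of the draws, with the remainder of [remainder_tail]. What is
    required of the data is expressed by inequalities with the constants r,
    c and K, and N is chosen before the data. *)
Lemma conditional_normality (R : realType) (d : nat) (x : 'rV[R]_d) (r c K e : R) :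
  0 < r -> 0 < c -> 0 <= K -> 0 < e -> exists N : nat,
  forall (dS : measure_display) (S : measurableType dS) (m : S -> 'rV[R]_d -> R)
    (psi : S -> R) (Theta : set 'rV[R]_d),
  (forall z t, Theta t -> twice_differentiable_at (m z) t) ->
  (forall z, concave (m z)) ->
  (forall z t1 t2 k l, Theta t1 -> Theta t2 ->
     `|hessian (m z) t1 k l - hessian (m z) t2 k l| <= psi z * enorm (t1 - t2)) ->
  forall (n s : nat) (z : n.-tuple S) (p : 'I_n -> R) (t : 'rV[R]_d)
    (tt : s.-tuple 'I_n -> 'rV[R]_d),
  (N <= s)%N -> (0 < n)%N -> (forall i, 0 < p i) -> \sum_i p i = 1 ->
  (forall u : 'rV[R]_d, `|u| <= r -> Theta (t + u)) ->
  is_argmax Theta (full_criterion m z) t ->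
  (forall h, is_argmax Theta (subsample_criterion m p z h) (tt h)) ->
  (forall u, c * `|u| ^+ 2 <= - dot (u *m mean_hessian m z t) u) ->
  (forall u, c * `|u| <= n%:R^-1 * \sum_(i < n) `|dot u (gradient (m (tnth z i)) t)|) ->
  (forall i, (n%:R * p i)^-1 <= K) ->
  n%:R^-1 * \sum_(i < n) `|gradient (m (tnth z i)) t| ^+ 4 <= K ->
  (forall k l, n%:R^-1 * \sum_(i < n) hessian (m (tnth z i)) t k l ^+ 2 <= K) ->
  n%:R^-1 * \sum_(i < n) `|psi (tnth z i)| <= K ->
  `|resampling_prob p [set k : s.-tuple 'I_n | forall j,
      standardized_error m s p z t (tt k) 0 j <= x 0 j] - std_normal_cdf x| <= e.
Proof.
move=> r0 c0 K0 e0.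
have CB0 : 0 <= @studentizer_bd R d c K by rewrite /studentizer_bd !mulr_ge0 ?exprn_ge0 ?addr_ge0// invr_ge0 ltW.
have C30 : 0 <= @third_moment_bd R d c K.
  by rewrite /third_moment_bd !mulr_ge0 ?exprn_ge0 ?addr_ge0 ?mulr_ge0// ?invr_ge0 ltW.
have [eta [N [eta0 HN]]] := clt_with_remainder x C30 e0.
pose b := @size_bd R d r c K eta.
exists (maxn 1 (maxn N (Num.bound b))).
move=> dS S m psi Theta m_diff m_conc h_lip n s z p t tt.
rewrite !geq_max => /and3P[s0 Ns bs] n0 p0 p1 ball_t t_max tt_max Hc Gc aK G4 H2 psi1.
have -> : [set k : s.-tuple 'I_n | forall j,
      standardized_error m s p z t (tt k) 0 j <= x 0 j] =
    [set k | [forall j, standardized_error m s p z t (tt k) 0 j <= x 0 j]].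
  by apply/seteqP; split => k /= /forallP.
rewrite resampling_probE /std_normal_cdf.
pose X (i : 'I_n) := - ((n%:R * p i)^-1 *: (gradient (m (tnth z i)) t *m
  invmx (mean_hessian m z t) *m invsqrtmx (VR m p z t))).
have sb : b <= s%:R.
  have [b0|b0] := leP 0 b; last by rewrite (le_trans (ltW b0)).
  by apply: le_trans (ltW (archi_boundP b0)) _; rewrite ler_nat.
apply: (HN _ p X s (fun k => standardized_error m s p z t (tt k))) => //.
- by move=> i; exact: ltW.
- by move=> k; apply: (@influence_mean R d dS S m Theta m_diff n z p t r).
- move=> k l; apply: (@influence_cov R d dS S m Theta m_diff n z p t c K) => //.
- by apply: (@influence_third R d dS S m Theta m_diff n z p t c K).
- by apply: (@remainder_tail R d dS S m psi Theta m_diff m_conc h_lip n s z p t r c K).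
Qed.

(** * Expectations of linear combinations and tightness of averages *)

Section more_integrals.
Context {d} {S : measurableType d} {R : realType}.
Variable Q : probability S R.

Lemma Rintegral_lincomb (I : Type) (rs : seq I) (b : I -> R) (F : I -> S -> R) :
  (forall i, Q.-integrable setT (EFin \o F i)) ->
  Q.-integrable setT (EFin \o (fun z => \sum_(i <- rs) b i * F i z)) /\
  \int[Q]_z (\sum_(i <- rs) b i * F i z) = \sum_(i <- rs) b i * \int[Q]_z F i z.
Proof.
move=> IF; elim: rs => [|i rs [I1 E1]].
  rewrite (_ : (fun z => _) = (fun=> 0)); last by apply/funext => z; rewrite big_nil.
  by split; [exact: integrable_cst_prob|rewrite Rintegral_cst// mul0r big_nil].
have [I2 E2] := RintegralZD (b i) (IF i) I1.
rewrite (_ : (fun z => _) = (fun z => b i * F i z + \sum_(i <- rs) b i * F i z)); last first.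
  by apply/funext => z; rewrite big_cons.
by rewrite big_cons -E1.
Qed.

Lemma square_integrable_lincomb (I : Type) (rs : seq I) (b : I -> R) (F : I -> S -> R) :
  (forall i, measurable_fun setT (F i)) -> (forall i, square_integrable Q (F i)) ->
  square_integrable Q (fun z => \sum_(i <- rs) b i * F i z).
Proof.
move=> mF sF; elim: rs => [|i rs IH].
  rewrite (_ : (fun z => _) = (fun=> 0)); last by apply/funext => z; rewrite big_nil.
  by apply/square_integrableP => //; exact: integrable_cst_prob.
rewrite (_ : (fun z => _) = (fun z => b i * F i z + \sum_(i <- rs) b i * F i z)); last first.
  by apply/funext => z; rewrite big_cons.
apply: square_integrableZD => //; apply: measurable_sum => j.
exact: measurable_funM.
Qed.

Lemma square_integrable_sum (I : Type) (rs : seq I) (F : I -> S -> R) :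
  (forall i, measurable_fun setT (F i)) -> (forall i, square_integrable Q (F i)) ->
  square_integrable Q (fun z => \sum_(i <- rs) F i z).
Proof.
move=> mF sF; have := square_integrable_lincomb rs (fun=> 1) mF sF.
by under [X in square_integrable Q X -> _]eq_fun do under eq_bigr do rewrite mul1r.
Qed.

Lemma square_integrableZ (c : R) (f : S -> R) : measurable_fun setT f ->
  square_integrable Q f -> square_integrable Q (fun z => c * f z).
Proof.
move=> mf sf; rewrite (_ : (fun z => _) = (fun z => c * f z + (fun=> 0) z)).
  apply: square_integrableZD => //.
  by apply/square_integrableP => //; exact: integrable_cst_prob.
by apply/funext => z; rewrite addr0.
Qed.

Lemma square_integrable_norm (f : S -> R) : measurable_fun setT f ->
  square_integrable Q f -> square_integrable Q (fun z => `|f z|).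
Proof.
move=> mf sf; apply: (@square_integrable_dom _ _ _ _ _ f) => //; first exact: measurableT_comp.
by move=> z; rewrite normr_id.
Qed.

Lemma expectation_Rintegral (f : S -> R) : fine ('E_Q[f])%E = \int[Q]_z f z.
Proof. by rewrite unlock. Qed.

Lemma integral_norm_gt0 (f : S -> R) : measurable_fun setT f ->
  Q.-integrable setT (EFin \o (fun z => `|f z|)) ->
  0 < \int[Q]_z (f z ^+ 2) -> 0 < \int[Q]_z `|f z|.
Proof.
move=> mf If f2; rewrite lt_neqAle Rintegral_ge0// andbT eq_sym.
apply/eqP => f0; move: f2; rewrite /Rintegral.
have f0E : (\int[Q]_z `|(EFin \o f) z| = 0)%E.
  by rewrite -[LHS]fineK ?[fine _]f0//; exact: (integrable_fin_num _ If).
have /ae_eq_integral_abs : measurable_fun setT (EFin \o f) by exact/measurable_EFinP.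
move=> /(_ Q measurableT) [/(_ f0E) ae0 _].
rewrite (@ae_eq_integral _ _ _ Q setT (cst 0%E)) ?integral0 ?ltxx//.
- by apply/measurable_EFinP; exact: measurable_funX.
- by move: ae0; apply: filterS => z /= /(_ I) [->] _; rewrite expr0n.
Qed.

End more_integrals.

Section markov_average.
Context {dT dS : measure_display} {T : measurableType dT} {S : measurableType dS}
  {R : realType} {P : probability T R} {Q : probability S R}
  {Z : nat -> {mfun T >-> S}}.
Hypothesis HZ : iid P Z Q.

(** Markov's inequality; the averages have the same mean for all n. *)
Lemma average_tight (f : S -> R) (dl : R) : 0 < dl -> measurable_fun setT f ->
  (forall z, 0 <= f z) -> Q.-integrable setT (EFin \o f) ->
  exists2 K : R, 0 <= K & eventually_prob P dl (fun n => [set w | average (Z := Z) f n w <= K]).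
Proof.
move=> dl0 mf f0 If; set mu := \int[Q]_z f z.
have mu0 : 0 <= mu by exact: Rintegral_ge0.
have K0 : 0 < (mu + 1) / dl by rewrite divr_gt0// ltr_wpDl.
exists ((mu + 1) / dl); first exact: ltW.
have mfZ i : measurable_fun setT (fun w => f (Z i w)) by exact: measurableT_comp.
near=> n.
have [IA EA] := @Rintegral_lincomb _ _ _ P 'I_n (index_enum _) (fun=> n%:R^-1)
  (fun (i : 'I_n) w => f (Z i w)) (fun i : 'I_n => (iid_integral HZ i If).1).
have avE : (fun w => \sum_(i < n) n%:R^-1 * f (Z i w)) = average (Z := Z) f n.
  by apply/funext => w; rewrite /average mulr_sumr.
rewrite avE in IA EA.
have n0 : (0 < n)%N by near: n; exact: nbhs_infty_gt.
have {}EA : \int[P]_w average (Z := Z) f n w = mu.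
  rewrite EA; under eq_bigr do rewrite (iid_integral HZ _ If).2.
  by rewrite sum_const_ord mulrA mulfV ?mul1r// pnatr_eq0 -lt0n.
have mA : measurable_fun setT (average (Z := Z) f n).
  by apply/measurable_EFinP; exact: (measurable_int P).
have -> : ~` [set w | average (Z := Z) f n w <= (mu + 1) / dl] =
    [set w | ((mu + 1) / dl < average (Z := Z) f n w)%R].
  by apply/seteqP; split => w /=; rewrite ltNge => /negP.
have mS : measurable [set w | ((mu + 1) / dl < average (Z := Z) f n w)%R].
  have /measurable_EFinP mE := mA.
  by have := emeasurable_fun_o_infty measurableT mE ((mu + 1) / dl)%:E; rewrite setTI.
rewrite measurable_mu_extE//; apply: le_trans (markov_Rintegral K0 mA _ IA) _.
  by move=> w; rewrite /average mulr_ge0 ?invr_ge0// sumr_ge0.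
rewrite lee_fin EA invf_div mulrCA ger_pMr// ler_pdivrMr ?ltr_wpDl//.
by rewrite mul1r lerDl.
Unshelve. all: by end_near. Qed.
End markov_average.

Section measurable_derivative.
Context {dS : measure_display} {S : measurableType dS} {R : realType} {d : nat}.

(** A pointwise limit of difference quotients along r / (n + 1), the steps
    being at most r so that the segment stays where f is known to be
    measurable. *)
Lemma measurable_derive (f : S -> 'rV[R]_d -> R) (t v : 'rV[R]_d) (r : R) : 0 < r ->
  (forall e : R, 0 <= e <= r -> measurable_fun setT (fun z => f z (t + e *: v))) ->
  (forall z, derivable (f z) t v) ->
  measurable_fun setT (fun z => 'D_v (f z) t).
Proof.
move=> r0 mf df; pose h (n : nat) : R := r * n.+1%:R^-1.
have h0 n : 0 < h n by rewrite mulr_gt0// invr_gt0.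
have hr n : 0 <= h n <= r.
  by rewrite ltW//= ler_piMr ?(ltW r0)// invf_le1 ?ler1n.
have hc : h @ \oo --> (0 : R).
  rewrite -(mulr0 r); apply: cvgM; [exact: cvg_cst|exact: cvg_harmonic].
apply: (measurable_fun_cvg (h := fun n z => (h n)^-1 * (f z (t + h n *: v) - f z t))).
  move=> n; apply: measurable_funM => //; apply: measurable_funB; first exact: mf.
  have := mf 0; rewrite scale0r addr0; apply.
  by rewrite lexx ltW.
move=> z _; have := df z; rewrite /derivable => /cvg_ex[l hl].
have lE : 'D_v (f z) t = l by apply: cvg_lim hl.
rewrite lE; apply/cvgrPdist_le => e e0.
have /cvgrPdist_le/(_ e e0) H := hl.
have /nbhs_normP[q q0 hq] : nbhs (0 : R) (fun x => x != 0 ->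
    `|l - x^-1 *: (f z (x *: v + t) - f z t)| <= e) by exact: H.
near=> n; have := hq (h n).
rewrite /ball_/= sub0r normrN gtr0_norm// (addrC _ t) => H'.
apply: H'; last by rewrite gt_eqF.
near: n; exact: (cvgr_lt 0 hc q q0).
Unshelve. all: by end_near. Qed.
End measurable_derivative.

(** * Envelopes of the derivatives near the population maximizer *)

Lemma sphere_closed {R : realType} {V : normedModType R} (x : V) (e : R) :
  closed [set t : V | `|t - x| = e].
Proof.
have c : continuous (fun t : V => `|t - x|).
  by move=> t; apply: cvg_norm; apply: cvgB; [exact: cvg_id|exact: cvg_cst].
have /continuous_closedP/(_ [set e]) := c; apply; exact: closed_eq.
Qed.

Section local_envelopes.
Context {dS : measure_display} {S : measurableType dS} {R : realType} {d : nat}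
  (Q : probability S R) (m : S -> 'rV[R]_d -> R) (psi : S -> R)
  (Theta : set 'rV[R]_d) (t0 : 'rV[R]_d) (r : R).
Hypothesis r0 : 0 < r.
Hypothesis ball_Theta : forall u : 'rV[R]_d, `|u| <= r -> Theta (t0 + u).
Hypothesis m_meas : forall t, measurable_fun [set: S] (m ^~ t).
Hypothesis m_diff : forall z t, Theta t -> twice_differentiable_at (m z) t.
Hypothesis hess_sq : forall t k l, Theta t ->
  square_integrable Q (fun z => hessian (m z) t k l).
Hypotheses (psi_meas : measurable_fun [set: S] psi) (psi_sq : square_integrable Q psi).
Hypothesis hess_lip : forall z t1 t2 k l, Theta t1 -> Theta t2 ->
  `|hessian (m z) t1 k l - hessian (m z) t2 k l| <= psi z * enorm (t1 - t2).
Hypothesis grad_sq : forall t k, Theta t ->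
  square_integrable Q (fun z => gradient (m z) t 0 k).

Lemma center_Theta : Theta t0.
Proof. by rewrite -[t0]addr0; apply: ball_Theta; rewrite normr0 ltW. Qed.

Lemma measurable_gradient t k : Theta t ->
  measurable_fun setT (fun z => gradient (m z) t 0 k).
Proof.
move=> Tt; rewrite (_ : (fun z => _) = (fun z => 'D_(delta_mx 0 k : 'rV[R]_d) (m z) t)); last first.
  by apply/funext => z; rewrite mxE.
apply: (@measurable_derive _ _ _ _ m _ _ 1) => //.
by move=> z; apply: diff_derivable; have [/nbhs_singleton] := m_diff z Tt.
Qed.

Lemma measurable_hessian k l : measurable_fun setT (fun z => hessian (m z) t0 k l).
Proof.
rewrite (_ : (fun z => _) = (fun z => 'D_(delta_mx 0 l : 'rV[R]_d)
    ((fun z u => gradient (m z) u 0 k) z) t0)); last first.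
  by apply/funext => z; rewrite mxE; congr ('D_ _ _ _); apply/funext => u; rewrite mxE.
apply: (@measurable_derive _ _ _ _ (fun z u => gradient (m z) u 0 k) _ _ r) => //.
  move=> e /andP[e0 er]; apply/measurable_gradient/ball_Theta.
  rewrite normrZ ger0_norm//; apply: le_trans er; rewrite ler_piMr//.
  by apply: normrV_le => // i; rewrite mxE eqxx /=; case: eqP; rewrite ?normr1 ?normr0.
move=> z; have [_ dg] := m_diff z center_Theta.
apply: diff_derivable; rewrite (_ : (fun u => _) = (fun y => 'D_(delta_mx 0 k : 'rV[R]_d) (m z) y)).
  exact: differentiable_partial.
by apply/funext => u; rewrite mxE.
Qed.

(** A square integrable bound for the Hessians on the ball of radius r about
    t0, given by the Lipschitz condition; grad_envelope is the bound that
    follows for the gradients by the mean value theorem. *)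
Definition hess_envelope (z : S) : R :=
  \sum_(q : 'I_d * 'I_d) `|hessian (m z) t0 q.1 q.2| + d%:R * r * `|psi z|.

Definition grad_envelope (z : S) : R :=
  \sum_k `|gradient (m z) t0 0 k| + d%:R * r * hess_envelope z.

Lemma measurable_hess_envelope : measurable_fun setT hess_envelope.
Proof.
apply: measurable_funD; last by apply: measurable_funM => //; exact: measurableT_comp.
apply: measurable_sum => q; apply: measurableT_comp => //; exact: measurable_hessian.
Qed.

Lemma measurable_grad_envelope : measurable_fun setT grad_envelope.
Proof.
apply: measurable_funD; last by apply: measurable_funM => //; exact: measurable_hess_envelope.
apply: measurable_sum => q; apply: measurableT_comp => //.
exact/measurable_gradient/center_Theta.
Qed.

Lemma square_integrable_hess_envelope : square_integrable Q hess_envelope.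
Proof.
rewrite (_ : hess_envelope = (fun z => d%:R * r * `|psi z| +
    \sum_(q : 'I_d * 'I_d) `|hessian (m z) t0 q.1 q.2|)); last first.
  by apply/funext => z; rewrite addrC.
have mh (q : 'I_d * 'I_d) : measurable_fun setT (fun z => `|hessian (m z) t0 q.1 q.2|).
  by apply: measurableT_comp => //; exact: measurable_hessian.
apply: square_integrableZD; first exact: measurableT_comp.
- exact: measurable_sum.
- exact: square_integrable_norm.
apply: square_integrable_sum => // q; apply: square_integrable_norm.
  exact: measurable_hessian.
exact/hess_sq/center_Theta.
Qed.

Lemma square_integrable_grad_envelope : square_integrable Q grad_envelope.
Proof.
rewrite (_ : grad_envelope = (fun z => d%:R * r * hess_envelope z +
    \sum_k `|gradient (m z) t0 0 k|)); last first.
  by apply/funext => z; rewrite addrC.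
have mg k : measurable_fun setT (fun z => gradient (m z) t0 0 k).
  exact/measurable_gradient/center_Theta.
have mg' k : measurable_fun setT (fun z => `|gradient (m z) t0 0 k|).
  exact: measurableT_comp.
apply: square_integrableZD; first exact: measurable_hess_envelope.
- exact: measurable_sum.
- exact: square_integrable_hess_envelope.
apply: square_integrable_sum => // k; apply: square_integrable_norm => //.
exact/grad_sq/center_Theta.
Qed.

Lemma hess_shift z u k l : `|u| <= r ->
  `|hessian (m z) (t0 + u) k l - hessian (m z) t0 k l| <= d%:R * `|u| * `|psi z|.
Proof.
move=> ur; apply: le_trans (hess_lip z k l (ball_Theta ur) center_Theta) _.
rewrite addrC addKr; apply: le_trans (ler_wpM2r (sqrtr_ge0 _) (ler_norm _)) _.
by rewrite mulrC ler_wpM2r//; exact: enorm_le.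
Qed.

Lemma hess_envelope_ge0 z : 0 <= hess_envelope z.
Proof. by rewrite addr_ge0 ?sumr_ge0// !mulr_ge0// ltW. Qed.

Lemma hess_envelopeP z u k l : `|u| <= r ->
  `|hessian (m z) (t0 + u) k l| <= hess_envelope z.
Proof.
move=> ur; have H := hess_shift z k l ur.
have H1 : `|hessian (m z) t0 k l| <= \sum_(q : 'I_d * 'I_d) `|hessian (m z) t0 q.1 q.2|.
  by rewrite (bigD1 (k, l))//= lerDl sumr_ge0.
have H2 : d%:R * `|u| * `|psi z| <= d%:R * r * `|psi z|.
  by rewrite ler_wpM2r// ler_wpM2l.
rewrite -[hessian _ _ k l](subrK (hessian (m z) t0 k l)).
by apply: le_trans (ler_normD _ _) _; rewrite /hess_envelope; lra.
Qed.

Let scaled_in_ball (u : 'rV[R]_d) (s : R) : `|u| <= r -> 0 <= s <= 1 -> `|s *: u| <= r.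
Proof.
move=> ur /andP[s0 s1]; rewrite normrZ ger0_norm//; apply: le_trans ur.
by rewrite ler_piMl.
Qed.

Lemma grad_shift z u k : `|u| <= r ->
  `|gradient (m z) (t0 + u) 0 k - gradient (m z) t0 0 k| <= d%:R * `|u| * hess_envelope z.
Proof.
move=> ur; have -> : d%:R * `|u| * hess_envelope z = d%:R * hess_envelope z * `|u| by ring.
apply: gradient_lipschitz => [s s01|s l s01].
  exact/m_diff/ball_Theta/scaled_in_ball.
exact/hess_envelopeP/scaled_in_ball.
Qed.

Lemma grad_envelopeP z u k : `|u| <= r ->
  `|gradient (m z) (t0 + u) 0 k| <= grad_envelope z.
Proof.
move=> ur; have H := grad_shift z k ur.
have H1 : `|gradient (m z) t0 0 k| <= \sum_k `|gradient (m z) t0 0 k|.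
  by rewrite (bigD1 k)//= lerDl sumr_ge0.
have H2 : d%:R * `|u| * hess_envelope z <= d%:R * r * hess_envelope z.
  by rewrite ler_wpM2r ?hess_envelope_ge0// ler_wpM2l.
rewrite -[gradient _ _ 0 k](subrK (gradient (m z) t0 0 k)).
by apply: le_trans (ler_normD _ _) _; rewrite /grad_envelope; lra.
Qed.

Lemma m_lipschitz z u v : `|u| <= r -> `|v| <= r ->
  `|m z (t0 + u) - m z (t0 + v)| <= d%:R * grad_envelope z * `|u - v|.
Proof.
move=> ur vr.
have seg (s : R) : 0 <= s <= 1 -> `|v + s *: (u - v)| <= r.
  move=> /andP[s0 s1]; rewrite (_ : v + _ = s *: u + (1 - s) *: v); last first.
    by rewrite scalerBl scale1r scalerBr addrCA addrA.
  apply: le_trans (ler_normD _ _) _; rewrite !normrZ !ger0_norm ?subr_ge0//.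
  have s1' : 0 <= 1 - s by rewrite subr_ge0.
  by have := ler_wpM2l s0 ur; have := ler_wpM2l s1' vr; lra.
have -> : t0 + u = t0 + v + (u - v) by rewrite -addrA [v + _]addrC subrK.
apply: lipschitz_of_gradient => [s s01|s k s01]; rewrite -addrA.
  exact/m_diff/ball_Theta/seg.
exact/grad_envelopeP/seg.
Qed.

(** * Consistency of the full data estimator *)

Context {dT : measure_display} {T : measurableType dT} (P : probability T R)
  (Z : nat -> {mfun T >-> S}).
Hypothesis HZ : iid P Z Q.
Hypothesis m_concave : forall z, concave (m z).
Hypothesis t0_max : is_argmax Theta (fun t => fine ('E_Q[m ^~ t])%E) t0.
Hypothesis t0_unique : forall t,
  is_argmax Theta (fun t => fine ('E_Q[m ^~ t])%E) t -> t = t0.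
Hypothesis m_sq : forall t, Theta t -> square_integrable Q (m ^~ t).
Hypothesis hess_posdef : posdefmx (- mx_expectation Q (fun z => hessian (m z) t0)).
Hypothesis Lambda_posdef : posdefmx (mx_expectation Q
  (fun z => (gradient (m z) t0)^T *m gradient (m z) t0)).
Context (theta_hat : forall n : nat, n.-tuple S -> 'rV[R]_d).
Hypothesis theta_hat_max : forall n (z : n.-tuple S),
  is_argmax Theta (full_criterion m z) (theta_hat z).

Local Notation sample n w := [tuple Z i w | i < n].

Lemma average_sample (f : S -> R) n w :
  n%:R^-1 * \sum_(i < n) f (tnth (sample n w) i) = average (Z := Z) f n w.
Proof. by congr (_ * _); apply: eq_bigr => i _; rewrite tnth_mktuple. Qed.

Lemma sphere_compact (x : 'rV[R]_d) (e : R) : compact [set t : 'rV[R]_d | `|t - x| = e].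
Proof.
apply: bounded_closed_compact; last exact: sphere_closed.
exists (`|x| + e); split; first exact: num_real.
move=> M Me t /= te; apply: le_trans (ltW Me).
by rewrite -[t](subrK x) -[in leRHS]te addrC; exact: ler_normD.
Qed.

(** On the sphere of radius e about t0 the averages of m z t0 - m z t are
    positive by [uniform_positive], since t0 is the only population
    maximizer; by concavity the sample maximizer then lies inside the
    sphere. *)
Lemma estimator_consistent e : 0 < e -> e <= r ->
  whp P (fun n => [set w | `|theta_hat (sample n w) - t0| < e]).
Proof.
move=> e0 er; set K := [set t : 'rV[R]_d | `|t - t0| = e].
have KT t : K t -> Theta t /\ exists2 u, `|u| <= r & t = t0 + u.
  rewrite /K /= => te; have tr : `|t - t0| <= r by rewrite te.
  by split; [rewrite -[t](subrK t0) addrC; exact: ball_Theta|exists (t - t0); rewrite // addrC subrK].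
have T0 := center_Theta.
have mL : measurable_fun setT (fun z => d%:R * grad_envelope z).
  by apply: measurable_funM => //; exact: measurable_grad_envelope.
have sL : square_integrable Q (fun z => d%:R * grad_envelope z).
  apply: square_integrableZ; first exact: measurable_grad_envelope.
  exact: square_integrable_grad_envelope.
have fE t : (fun z => m z t0 - m z t) = (fun z => (-1) * m z t + m z t0).
  by apply/funext => z; rewrite mulN1r addrC.
have [t Kt|t Kt|t Kt|z t t' Kt Kt'|c c0 wc] :=
  uniform_positive HZ (f := fun z t => m z t0 - m z t) (@sphere_compact t0 e) mL sL.
- by rewrite fE; apply: measurable_funD => //; exact: measurable_funM.
- rewrite fE; have [Tt _] := KT _ Kt.
  by apply: square_integrableZD => //; exact: m_sq.
- rewrite fE; have [Tt _] := KT _ Kt.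
  have [_ ->] := RintegralZD (-1) (square_integrable1 (m_meas t) (m_sq Tt))
    (square_integrable1 (m_meas t0) (m_sq T0)).
  rewrite mulN1r addrC subr_gt0 -!expectation_Rintegral lt_neqAle.
  have [_ tmax] := t0_max; rewrite tmax// andbT; apply/eqP => E.
  have tE : t = t0 by apply: t0_unique; split => // u Tu; rewrite E tmax.
  by move: Kt; rewrite /K /= tE subrr normr0 => H; rewrite H ltxx in e0.
- have [_ [u ur ->]] := KT _ Kt; have [_ [v vr ->]] := KT _ Kt'.
  have -> : m z t0 - m z (t0 + u) - (m z t0 - m z (t0 + v)) =
    m z (t0 + v) - m z (t0 + u) by ring.
  by rewrite distrC opprD addrACA subrr add0r; exact: m_lipschitz.
apply: whp_sub wc _; near=> n => w /= H.
have [_ hmax] := theta_hat_max (sample n w).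
apply: (@concave_superlevel _ _ (full_criterion m (sample n w))) => //; last exact: hmax.
  rewrite (_ : full_criterion _ _ = (fun t => \sum_(i < n) n%:R^-1 * m (tnth (sample n w) i) t)).
    apply: concave_seg_sum => [_|i]; first by rewrite invr_ge0.
    exact: concave_concave_seg.
  by apply/funext => t; rewrite /full_criterion mulr_sumr.
move=> t Kt; rewrite /full_criterion !(average_sample (m ^~ _)) -subr_gt0 averageB.
exact: lt_le_trans c0 (H t Kt).
Unshelve. all: by end_near. Qed.

(** * Curvature and score dispersion at the estimator *)

Let T0 : Theta t0 := center_Theta.
Let mh k l := measurable_hessian k l.
Let mg k := measurable_gradient k T0.

Lemma quad_expand (A : 'M[R]_d) (u : 'rV[R]_d) :
  - dot (u *m A) u = \sum_(q : 'I_d * 'I_d) (- (u 0 q.1 * u 0 q.2)) * A q.1 q.2.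
Proof.
rewrite dotE -sumrN -(pair_big predT predT (fun k l => - (u 0 k * u 0 l) * A k l)) /= exchange_big.
apply: eq_bigr => l _; rewrite mxE mulr_suml -sumrN.
by apply: eq_bigr => k _; ring.
Qed.

Lemma quad_lipschitz (A : 'M[R]_d) (u v : 'rV[R]_d) (h : R) : 0 <= h ->
  (forall k l, `|A k l| <= h) -> `|u| = 1 -> `|v| = 1 ->
  `|- dot (u *m A) u - - dot (v *m A) v| <= 2 * d%:R ^+ 2 * h * `|u - v|.
Proof.
move=> h0 Ah u1 v1.
have -> : - dot (u *m A) u - - dot (v *m A) v =
    - (dot ((u - v) *m A) u + dot (v *m A) (u - v)).
  by rewrite mulmxBl dotDl dotNl dotDr dotNr; ring.
rewrite normrN; apply: le_trans (ler_normD _ _) _.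
have H1 : `|dot ((u - v) *m A) u| <= d%:R * (d%:R * h * `|u - v|).
  apply: le_trans (dot_le _ _) _; rewrite u1 mulr1 ler_wpM2l//.
  exact: norm_mulmx_le.
have H2 : `|dot (v *m A) (u - v)| <= d%:R * (d%:R * h * `|u - v|).
  apply: le_trans (dot_le _ _) _; rewrite ler_wpM2l// ler_wpM2r//.
  by apply: le_trans (norm_mulmx_le v h0 Ah) _; rewrite v1 mulr1.
have -> : 2 * d%:R ^+ 2 * h * `|u - v| = d%:R * (d%:R * h * `|u - v|) +
  d%:R * (d%:R * h * `|u - v|) by ring.
exact: lerD.
Qed.

Lemma expected_quad (u : 'rV[R]_d) :
  \int[Q]_z (- dot (u *m hessian (m z) t0) u) =
  (u *m (- mx_expectation Q (fun z => hessian (m z) t0)) *m u^T) 0 0.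
Proof.
have [_ E] := Rintegral_lincomb (Q := Q) (index_enum _)
  (fun q : 'I_d * 'I_d => - (u 0 q.1 * u 0 q.2))
  (fun q => square_integrable1 (mh q.1 q.2) (hess_sq q.1 q.2 T0)).
rewrite (_ : (fun z => _) = (fun z => \sum_(q : 'I_d * 'I_d)
  (- (u 0 q.1 * u 0 q.2)) * hessian (m z) t0 q.1 q.2)); last first.
  by apply/funext => z; exact: quad_expand.
rewrite E mulmxN mulNmx mxE -[(_ *m _) 0 0]/(dot (u *m _) u) quad_expand.
by apply: eq_bigr => q _; rewrite mxE expectation_Rintegral.
Qed.

Lemma expected_sqr (u : 'rV[R]_d) :
  \int[Q]_z (dot u (gradient (m z) t0) ^+ 2) =
  (u *m (mx_expectation Q (fun z => (gradient (m z) t0)^T *m gradient (m z) t0)) *m u^T) 0 0.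
Proof.
have IG (q : 'I_d * 'I_d) : Q.-integrable setT (EFin \o (fun z =>
    gradient (m z) t0 0 q.1 * gradient (m z) t0 0 q.2)).
  by apply: mul_integrable => //; apply/square_integrableP => //; exact: grad_sq.
have [_ E] := Rintegral_lincomb (index_enum _)
  (fun q : 'I_d * 'I_d => u 0 q.1 * u 0 q.2) IG.
rewrite (_ : (fun z => _) = (fun z => \sum_(q : 'I_d * 'I_d)
  (u 0 q.1 * u 0 q.2) * (gradient (m z) t0 0 q.1 * gradient (m z) t0 0 q.2))); last first.
  apply/funext => z; rewrite dotE expr2 mulr_suml.
  rewrite -(pair_big predT predT (fun k l => u 0 k * u 0 l *
    (gradient (m z) t0 0 k * gradient (m z) t0 0 l))) /=.
  apply: eq_bigr => k _; rewrite mulr_sumr; apply: eq_bigr => l _.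
  by ring.
rewrite E -[RHS]opprK -[(_ *m _) 0 0]/(dot (u *m _) u) quad_expand -sumrN.
apply: eq_bigr => q _; rewrite [in RHS]mxE expectation_Rintegral mulNr opprK.
by congr (_ * _); apply: eq_Rintegral => z _; rewrite [RHS]mxE big_ord1 [X in _ = X * _]mxE.
Qed.

Lemma unit_sphereP (u : 'rV[R]_d) : [set t : 'rV[R]_d | `|t - 0| = 1] u <-> `|u| = 1.
Proof. by rewrite /= subr0. Qed.

Lemma half_lower_bound (a b D c : R) : c <= a -> `|a - b| <= D -> D <= c / 2 -> c / 2 <= b.
Proof. by move=> ca /ler_normlP[_]; lra. Qed.

Lemma unit_sphere_scale (u : 'rV[R]_d) : u != 0 -> exists2 v : 'rV[R]_d, `|v| = 1 & u = `|u| *: v.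
Proof.
move=> u0; have n0 : `|u| != 0 by rewrite normr_eq0.
exists (`|u|^-1 *: u); last by rewrite scalerA mulfV// scale1r.
by rewrite normrZ ger0_norm ?invr_ge0// mulVf.
Qed.

Lemma average_norm_bounded (f : S -> R) : measurable_fun setT f -> square_integrable Q f ->
  exists2 B : R, 0 < B & whp P (fun n => [set w | average (Z := Z) (fun z => `|f z|) n w <= B]).
Proof.
move=> mf sf; exists (`|\int[Q]_z `|f z| | + 1); first by rewrite ltr_wpDl.
have W := weak_law HZ ltr01 (measurableT_comp (@normr_measurable _ setT) mf)
  (square_integrable_norm mf sf).
apply: whp_sub W _; near=> n => w /= /ler_normlP[_]; rewrite lerBlDl => H.
by apply: (le_trans H); rewrite lerD2r ler_norm.
Unshelve. all: by end_near. Qed.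

Lemma mean_hessian_quad n w (t u : 'rV[R]_d) :
  - dot (u *m mean_hessian m (sample n w) t) u =
  average (Z := Z) (fun z => - dot (u *m hessian (m z) t) u) n w.
Proof.
rewrite -(average_sample (fun z => - dot (u *m hessian (m z) t) u)) sumrN mulrN.
congr (- _); rewrite /mean_hessian -scalemxAr dotZl mulmx_sumr dotC dot_sumr.
by congr (_ * _); apply: eq_bigr => i _; rewrite dotC.
Qed.

(** At t0, [uniform_positive] on the unit sphere applies because minus the
    expected Hessian is positive-definite. The Lipschitz condition carries
    the bound to the estimator, which is close to t0, at the price of half
    of c. *)
Lemma criterion_curvature : exists2 c : R, 0 < c & whp P (fun n => [set w | forall u : 'rV[R]_d,
  c * `|u| ^+ 2 <= - dot (u *m mean_hessian m (sample n w) (theta_hat (sample n w))) u]).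
Proof.
pose K := [set u : 'rV[R]_d | `|u - 0| = 1].
have mE := measurable_hess_envelope; have sE := square_integrable_hess_envelope.
have mf u : measurable_fun setT (fun z => - dot (u *m hessian (m z) t0) u).
  rewrite (_ : (fun z => _) = (fun z => \sum_(q : 'I_d * 'I_d)
    (- (u 0 q.1 * u 0 q.2)) * hessian (m z) t0 q.1 q.2)).
    by apply: measurable_sum => q; apply: measurable_funM.
  by apply/funext => z; exact: quad_expand.
have [||u Ku|u Ku|u Ku|z u v Ku Kv|c c0 wc] := uniform_positive HZ
  (K := K) (f := fun z u => - dot (u *m hessian (m z) t0) u)
  (L := fun z => 2 * d%:R ^+ 2 * hess_envelope z) (@sphere_compact 0 1).
- exact: measurable_funM.
- exact: square_integrableZ.
- exact: mf.
- rewrite (_ : (fun z => _) = (fun z => \sum_(q : 'I_d * 'I_d)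
    (- (u 0 q.1 * u 0 q.2)) * hessian (m z) t0 q.1 q.2)).
    apply: (@square_integrable_lincomb _ _ _ _ _ _ _
      (fun (q : 'I_d * 'I_d) z => hessian (m z) t0 q.1 q.2)) => q //.
    exact: hess_sq.
  by apply/funext => z; exact: quad_expand.
- rewrite expected_quad; apply: hess_posdef.2.
  by rewrite -normr_eq0; move/unit_sphereP: Ku => ->; rewrite oner_eq0.
- move/unit_sphereP: Ku => u1; move/unit_sphereP: Kv => v1.
  apply: quad_lipschitz => // [|k l]; first exact: hess_envelope_ge0.
  by rewrite -[t0 in hessian _ t0]addr0; apply: hess_envelopeP; rewrite normr0 ltW.
have [B B0 wB] := average_norm_bounded psi_meas psi_sq.
pose e := Num.min r (c / (2 * (d%:R ^+ 3 + 1) * B)).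
have D0 : 0 < (d%:R ^+ 3 + 1 : R) by rewrite ltr_wpDl// exprn_ge0.
have e0 : 0 < e by rewrite lt_min r0 divr_gt0// !mulr_gt0.
have er : e <= r by rewrite ge_min lexx.
have eB : d%:R ^+ 3 * e * B <= c / 2.
  have : e <= c / (2 * (d%:R ^+ 3 + 1) * B) by rewrite ge_min lexx orbT.
  rewrite ler_pdivlMr ?mulr_gt0// => H; have := mulr_gt0 e0 B0.
  by move: H; move: (d%:R ^+ 3 : R) => D H H'; lra.
exists (c / 2); first by rewrite divr_gt0.
apply: whp_sub (whpI (whpI wc wB) (estimator_consistent e0 er)) _.
near=> n => w /= [[Hc HB] Ht].
set t := theta_hat _ in Ht *; set b := t - t0 in Ht.
have br : `|b| <= r by rewrite (le_trans (ltW Ht)).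
have tE : t = t0 + b by rewrite /b addrC subrK.
have unit u : `|u| = 1 -> c / 2 <= average (Z := Z) (fun z => - dot (u *m hessian (m z) t) u) n w.
  move=> u1; have H := Hc u ((unit_sphereP u).2 u1).
  have : `|average (Z := Z) (fun z => - dot (u *m hessian (m z) t0) u) n w -
      average (Z := Z) (fun z => - dot (u *m hessian (m z) t) u) n w| <=
      d%:R ^+ 3 * e * average (Z := Z) (fun z => `|psi z|) n w.
    rewrite averageB -averageZ; apply: average_norm_le => z.
    have -> : - dot (u *m hessian (m z) t0) u - - dot (u *m hessian (m z) t) u =
       dot (u *m (hessian (m z) t - hessian (m z) t0)) u.
      by rewrite mulmxBr dotDl dotNl opprK addrC.
    apply: le_trans (dot_le _ _) _; rewrite u1 mulr1.
    have h0 : 0 <= d%:R * e * `|psi z| by rewrite !mulr_ge0// ltW.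
    have -> : d%:R ^+ 3 * e * `|psi z| = d%:R * (d%:R * (d%:R * e * `|psi z|) * `|u|).
      by rewrite u1; ring.
    rewrite ler_wpM2l//; apply: norm_mulmx_le => // k l.
    rewrite tE [X in `|X|]mxE [X in _ + X]mxE; apply: le_trans (hess_shift _ _ _ br) _.
    by rewrite ler_wpM2r// ler_wpM2l// ltW.
  move=> /(half_lower_bound H); apply; apply: le_trans eB.
  by rewrite ler_wpM2l// mulr_ge0 ?exprn_ge0// ltW.
move=> u; rewrite mean_hessian_quad.
have [->|/unit_sphere_scale[v v1 uE]] := eqVneq u 0.
  rewrite normr0 expr0n mulr0 /average mulr_ge0 ?invr_ge0// sumr_ge0// => i _.
  by rewrite mul0mx /dot mul0mx mxE oppr0.
rewrite uE normrZ normr_id v1 mulr1.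
rewrite (_ : (fun z => _) = (fun z => `|u| ^+ 2 * - dot (v *m hessian (m z) t) v)).
  by rewrite averageZ mulrC ler_wpM2l ?exprn_ge0// unit.
by apply/funext => z; rewrite -scalemxAl dotZl dotZr; ring.
Unshelve. all: by end_near. Qed.

(** A first absolute moment instead of a second one, because the averages of
    |dot u (gradient)| obey the weak law under square integrability of the
    gradient alone. Their means are positive on the unit sphere since the
    second moments are. *)
Lemma gradient_dispersion : exists2 c : R, 0 < c & whp P (fun n => [set w | forall u : 'rV[R]_d,
  c * `|u| <= n%:R^-1 * \sum_(i < n)
    `|dot u (gradient (m (tnth (sample n w) i)) (theta_hat (sample n w)))|]).
Proof.
pose K := [set u : 'rV[R]_d | `|u - 0| = 1].
have mE := measurable_hess_envelope; have sE := square_integrable_hess_envelope.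
have dE u : (fun z => dot u (gradient (m z) t0)) =
    (fun z => \sum_k u 0 k * gradient (m z) t0 0 k).
  by apply/funext => z; rewrite dotE.
have mf u : measurable_fun setT (fun z => dot u (gradient (m z) t0)).
  by rewrite dE; apply: measurable_sum => q; apply: measurable_funM.
have sf u : square_integrable Q (fun z => dot u (gradient (m z) t0)).
  rewrite dE; apply: (@square_integrable_lincomb _ _ _ _ _ _ _
    (fun k z => gradient (m z) t0 0 k)) => k //.
  exact: grad_sq.
have mG : measurable_fun setT (fun z => \sum_k `|gradient (m z) t0 0 k|).
  by apply: measurable_sum => k; exact: measurableT_comp.
have [||u Ku|u Ku|u Ku|z u v Ku Kv|c c0 wc] := uniform_positive HZ
  (K := K) (f := fun z u => `|dot u (gradient (m z) t0)|)
  (L := fun z => d%:R * \sum_k `|gradient (m z) t0 0 k|) (@sphere_compact 0 1).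
- exact: measurable_funM.
- apply: square_integrableZ => //; apply: square_integrable_sum => k.
    exact: measurableT_comp.
  by apply: square_integrable_norm => //; exact: grad_sq.
- exact: measurableT_comp.
- exact: square_integrable_norm.
- apply: integral_norm_gt0 => //.
    apply: square_integrable1; first exact: measurableT_comp.
    exact: square_integrable_norm.
  rewrite expected_sqr; apply: Lambda_posdef.2.
  by rewrite -normr_eq0; move/unit_sphereP: Ku => ->; rewrite oner_eq0.
- apply: le_trans (ler_dist_dist _ _) _; rewrite -dotNl -dotDl.
  apply: le_trans (dot_le _ _) _; rewrite -mulrA ler_wpM2l// mulrC ler_wpM2r//.
  apply: normrV_le => [|k]; first exact: sumr_ge0.
  by rewrite (bigD1 k)//= lerDl sumr_ge0.
have [B B0 wB] := average_norm_bounded mE sE.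
pose e := Num.min r (c / (2 * (d%:R ^+ 2 + 1) * B)).
have D0 : 0 < (d%:R ^+ 2 + 1 : R) by rewrite ltr_wpDl// exprn_ge0.
have e0 : 0 < e by rewrite lt_min r0 divr_gt0// !mulr_gt0.
have er : e <= r by rewrite ge_min lexx.
have eB : d%:R ^+ 2 * e * B <= c / 2.
  have : e <= c / (2 * (d%:R ^+ 2 + 1) * B) by rewrite ge_min lexx orbT.
  rewrite ler_pdivlMr ?mulr_gt0// => H; have := mulr_gt0 e0 B0.
  by move: H; move: (d%:R ^+ 2 : R) => D H H'; lra.
exists (c / 2); first by rewrite divr_gt0.
apply: whp_sub (whpI (whpI wc wB) (estimator_consistent e0 er)) _.
near=> n => w /= [[Hc HB] Ht].
set t := theta_hat _ in Ht *; set b := t - t0 in Ht.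
have br : `|b| <= r by rewrite (le_trans (ltW Ht)).
have tE : t = t0 + b by rewrite /b addrC subrK.
have unit u : `|u| = 1 -> c / 2 <= average (Z := Z) (fun z => `|dot u (gradient (m z) t)|) n w.
  move=> u1; have H := Hc u ((unit_sphereP u).2 u1).
  have : `|average (Z := Z) (fun z => `|dot u (gradient (m z) t0)|) n w -
      average (Z := Z) (fun z => `|dot u (gradient (m z) t)|) n w| <=
      d%:R ^+ 2 * e * average (Z := Z) (fun z => `|hess_envelope z|) n w.
    rewrite averageB -averageZ; apply: average_norm_le => z.
    apply: le_trans (ler_dist_dist _ _) _; rewrite distrC -dotNr -dotDr.
    apply: le_trans (dot_le _ _) _; rewrite u1 mul1r.
    have -> : d%:R ^+ 2 * e * `|hess_envelope z| = d%:R * (d%:R * e * `|hess_envelope z|) by ring.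
    rewrite ler_wpM2l//; apply: normrV_le => [|k]; first by rewrite !mulr_ge0// ltW.
    rewrite tE [X in `|X|]mxE [X in _ + X]mxE; apply: le_trans (grad_shift _ _ br) _.
    rewrite ger0_norm ?hess_envelope_ge0// ler_wpM2r ?hess_envelope_ge0// ler_wpM2l// ltW//.
  move=> /(half_lower_bound H); apply; apply: le_trans eB.
  by rewrite ler_wpM2l// mulr_ge0 ?exprn_ge0// ltW.
move=> u; rewrite (average_sample (fun z => `|dot u (gradient (m z) t)|)).
have [->|/unit_sphere_scale[v v1 uE]] := eqVneq u 0.
  by rewrite normr0 mulr0 /average mulr_ge0 ?invr_ge0// sumr_ge0.
rewrite uE normrZ normr_id v1 mulr1.
rewrite (_ : (fun z => _) = (fun z => `|u| * `|dot v (gradient (m z) t)|)).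
  by rewrite averageZ mulrC ler_wpM2l// unit.
by apply/funext => z; rewrite dotZl normrM normr_id.
Unshelve. all: by end_near. Qed.

End local_envelopes.

(** * Convergence in outer probability *)

Section outer_probability.
Context {dT : measure_display} {T : measurableType dT} {R : realType}
  (P : probability T R).

Lemma whp_cvg_in_prob (X : nat -> T -> R) (l : R) :
  (forall e, 0 < e -> whp P (fun n => [set w | `|X n w - l| <= e])) ->
  cvg_in_prob P X l.
Proof.
move=> H e e0; have {}H := H e e0.
have setE n : ~` [set w | `|X n w - l| <= e] = [set w | e < `|X n w - l|].
  by apply/seteqP; split => w /=; rewrite ltNge => /negP.
have fin n (dl : R) : ((P^*)%mu [set w | (e < `|X n w - l|)%R] <= dl%:E)%E ->
    (P^*)%mu [set w | e < `|X n w - l|] \is a fin_num /\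
    `|fine ((P^*)%mu [set w | e < `|X n w - l|])| <= dl.
  have : (0 <= (P^*)%mu [set w | (e < `|X n w - l|)%R])%E by exact: outer_measure_ge0.
  case: ((P^*)%mu _) => [x| |]//; rewrite !lee_fin => x0 xd; split => //=.
  by rewrite ger0_norm.
apply/fine_cvgP; split.
  have := H 1 ltr01; rewrite /eventually_prob => {}H; near=> n.
  by apply: (fin n 1 _).1; rewrite -setE; near: n.
apply/cvgrPdist_le => dl dl0; have := H dl dl0; rewrite /eventually_prob => {}H.
near=> n; rewrite sub0r normrN; apply: (fin n dl _).2.
by rewrite -setE; near: n.
Unshelve. all: by end_near. Qed.

Lemma bounded_in_prob_le (X : nat -> T -> \bar R) (a : R) : 0 < a -> bounded_in_prob P X ->
  exists2 K : R, 0 <= K & eventually_prob P a (fun n => [set w | (X n w <= K%:E)%E]).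
Proof.
move=> a0 /(_ a a0)[K HK]; exists `|K| => //; near=> n.
apply: (@le_trans _ _ ((P^*)%mu [set w | (K%:E < X n w)%E])).
  apply: le_outer_measure => w /= /negP; rewrite -ltNge; apply: le_lt_trans.
  by rewrite lee_fin ler_norm.
by apply: ltW; near: n.
Unshelve. all: by end_near. Qed.
End outer_probability.

Lemma norm_le_enorm {R : realType} {d : nat} (x : 'rV[R]_d) : `|x| <= enorm x.
Proof.
apply: normrV_le => [|k]; first exact: sqrtr_ge0.
rewrite -sqrtr_sqr ler_wsqrtr// (bigD1 k)//= lerDl sumr_ge0// => j _.
exact: sqr_ge0.
Qed.

(** * Convergence of the subsample estimator given the data *)

Theorem theorem1 (R : realType) (d : nat)
  (dT dS : measure_display) (T : measurableType dT) (S : measurableType dS)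
  (P : probability T R) (Q : probability S R)
  (Z : nat -> {mfun T >-> S}) (HZ : iid P Z Q)
  (m : S -> 'rV[R]_d -> R)
  (m_meas : forall t, measurable_fun [set: S] (m ^~ t))
  (* (i) *)
  (Theta : set 'rV[R]_d) (Theta_compact : compact Theta)
  (m_diff : forall z t, Theta t -> twice_differentiable_at (m z) t)
  (* (ii) *)
  (m_concave : forall z, concave (m z))
  (theta0 : 'rV[R]_d)
  (theta0_max : is_argmax Theta (fun t => fine ('E_Q[m ^~ t])%E) theta0)
  (theta0_unique : forall t,
     is_argmax Theta (fun t => fine ('E_Q[m ^~ t])%E) t -> t = theta0)
  (theta0_interior : interior Theta theta0)
  (m_sq : forall t, Theta t -> square_integrable Q (m ^~ t))
  (* (iii) *)
  (hess_posdef : forall t, Theta t ->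
     posdefmx (- mx_expectation Q (fun z => hessian (m z) t)))
  (hess_sq : forall t k l, Theta t ->
     square_integrable Q (fun z => hessian (m z) t k l))
  (psi : S -> R) (psi_meas : measurable_fun [set: S] psi)
  (psi_sq : square_integrable Q psi)
  (hess_lip : forall z t1 t2 k l, Theta t1 -> Theta t2 ->
     `|hessian (m z) t1 k l - hessian (m z) t2 k l| <=
       psi z * enorm (t1 - t2))
  (* the full data estimator *)
  (theta_hat : forall n : nat, n.-tuple S -> 'rV[R]_d)
  (theta_hat_meas : forall n j,
     measurable_fun [set: n.-tuple S] (fun z => theta_hat n z 0 j))
  (theta_hat_max : forall n (z : n.-tuple S),
     is_argmax Theta (full_criterion m z) (theta_hat n z))
  (* (iv) *)
  (grad_sq : forall t k, Theta t ->
     square_integrable Q (fun z => gradient (m z) t 0 k))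
  (Lambda_posdef : forall t, Theta t ->
     posdefmx (mx_expectation Q
       (fun z => (gradient (m z) t)^T *m gradient (m z) t)))
  (grad_fourth : exists2 r : R, 0 < r & bounded_in_prob P (fun n w =>
     let z := [tuple Z i w | i < n] in
     local_fourth_moment m Theta r z (theta_hat n z)))
  (* the subsampling distribution and (v) *)
  (p : forall n : nat, n.-tuple S -> 'I_n -> R)
  (pi_meas : forall n i,
     measurable_fun [set: n.-tuple S] (fun z => p n z i))
  (pi_gt0 : forall n (z : n.-tuple S) i, 0 < p n z i)
  (pi_sum1 : forall n (z : n.-tuple S), (0 < n)%N ->
     \sum_(i < n) p n z i = 1)
  (pi_bound : bounded_in_prob P (fun n w =>
     (\big[Num.max/0]_(i < n)
        (n%:R * p n [tuple Z i w | i < n] i)^-1)%:E))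
  (* the subsample size and the subsample estimator *)
  (s : nat -> nat) (s_lt : \forall n \near \oo, (s n < n)%N)
  (s_oo : s n @[n --> \oo] --> \oo)
  (theta_til : forall n : nat, n.-tuple S -> (s n).-tuple 'I_n -> 'rV[R]_d)
  (theta_til_meas : forall n k j,
     measurable_fun [set: n.-tuple S] (fun z => theta_til n z k 0 j))
  (theta_til_max : forall n (z : n.-tuple S) (k : (s n).-tuple 'I_n),
     is_argmax Theta (subsample_criterion m (p n z) z k) (theta_til n z k)) :
  cvg_in_cond_distr P
    (fun n w x =>
       let z := [tuple Z i w | i < n] in
       resampling_prob (p n z)
         [set k : (s n).-tuple 'I_n | forall j,
            standardized_error m (s n) (p n z) z
              (theta_hat n z) (theta_til n z k) 0 j <= x 0 j])
    (@std_normal_cdf R d).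
Proof.
move=> x; apply: whp_cvg_in_prob => e e0.
have [q q0 ballq] : exists2 q : R, 0 < q & forall y, `|theta0 - y| < q -> Theta y.
  by have /nbhs_normP[q q0 hq] := theta0_interior; exists q.
(* The ball of radius r about theta0 lies in Theta; the estimator is within
   r / 2 of theta0, so that the ball of radius r / 2 about it lies in Theta
   too. *)
pose r : R := q / 2; have r0 : 0 < r by rewrite divr_gt0.
have ball_Theta (u : 'rV[R]_d) : `|u| <= r -> Theta (theta0 + u).
  move=> ur; apply: ballq; rewrite opprD addNKr normrN; apply: (le_lt_trans ur).
  by rewrite ltr_pdivrMr// ltr_pMr// ltr1n.
have Theta0 : Theta theta0 := theta0_max.1.
have [c1 c10 curv] := criterion_curvature r0 ball_Theta m_meas m_diff hess_sq psi_meas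
  psi_sq hess_lip grad_sq HZ m_concave theta0_max theta0_unique m_sq
  (hess_posdef _ Theta0) theta_hat_max.
have [c2 c20 disp] := gradient_dispersion r0 ball_Theta m_meas m_diff hess_sq psi_meas
  psi_sq hess_lip grad_sq HZ m_concave theta0_max theta0_unique m_sq
  (Lambda_posdef _ Theta0) theta_hat_max.
have r20 : 0 < r / 2 by rewrite divr_gt0.
have r2r : r / 2 <= r by rewrite ler_pdivrMr// ler_pMr// ler1n.
have cons := estimator_consistent r0 ball_Theta m_meas m_diff hess_sq psi_meas
  psi_sq hess_lip grad_sq HZ m_concave theta0_max theta0_unique m_sq theta_hat_max r20 r2r.
have [B B0 psiB] := average_norm_bounded HZ psi_meas psi_sq.
(* The data are good outside seven events of probability at most a each. *)
move=> dl dl0; pose a : R := dl / 7; have a0 : 0 < a by rewrite divr_gt0.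
have [K1 K10 piK] := bounded_in_prob_le a0 pi_bound.
have [rho rho0 gradK'] := grad_fourth.
have [K2 K20 gradK] := bounded_in_prob_le a0 gradK'.
pose env := hess_envelope m psi theta0 r.
have menv : measurable_fun setT env.
  exact: (measurable_hess_envelope r0 ball_Theta m_meas m_diff psi_meas).
have senv : square_integrable Q env.
  exact: (square_integrable_hess_envelope r0 ball_Theta m_meas m_diff hess_sq psi_meas psi_sq).
have [||K3 K30 hessK] := average_tight HZ (f := fun z => env z ^+ 2) a0 (measurable_funX 2 menv).
- by move=> z; exact: sqr_ge0.
- exact/square_integrableP.
pose c := Num.min c1 c2; have c0 : 0 < c by rewrite lt_min c10.
pose K := K1 + K2 + K3 + B.
have K0 : 0 <= K by rewrite !addr_ge0// ltW.
have [N HN] := conditional_normality x r20 c0 K0 e0.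
have := eventually_probI (curv a a0) (eventually_probI (disp a a0)
  (eventually_probI (cons a a0) (eventually_probI (psiB a a0)
  (eventually_probI piK (eventually_probI gradK hessK))))).
rewrite (_ : a + _ = dl); last by rewrite /a; field.
have sN : \forall n \near \oo, (N <= s n)%N by exact: s_oo _ (nbhs_infty_ge N).
move=> /eventually_prob_sub; apply; near=> n.
have n0 : (0 < n)%N by near: n; exact: nbhs_infty_gt.
have Ns : (N <= s n)%N by near: n.
move=> w [/= W1 [W2 [W3 [W4 [W5 [W6 W7]]]]]].
set z := [tuple Z i w | i < n] in W1 W2 W3 W5 W6 *.
have br : `|theta_hat n z - theta0| <= r by apply: le_trans (ltW W3) r2r.
have tE : theta_hat n z = theta0 + (theta_hat n z - theta0) by rewrite addrC subrK.
apply: (HN _ _ m psi Theta m_diff m_concave hess_lip) => //.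
- exact: pi_sum1.
- move=> u ur; rewrite tE -addrA; apply: ball_Theta.
  by rewrite [r]splitr; apply: le_trans (ler_normD _ _) _; rewrite lerD// ltW.
- move=> u; apply: le_trans (W1 u); rewrite ler_wpM2r ?exprn_ge0//.
  by rewrite ge_min lexx.
- move=> u; apply: le_trans (W2 u); rewrite ler_wpM2r//.
  by rewrite ge_min lexx orbT.
- move=> i; apply: (@le_trans _ _ K1); last by rewrite /K -!addrA lerDl !addr_ge0// ltW.
  by move: W5; rewrite lee_fin; apply: le_trans; apply: (le_bigmax_cond _ (fun i => (n%:R * p n z i)^-1)).
- apply: (@le_trans _ _ K2); last first.
    by rewrite /K -!addrA (addrCA K1) lerDl !addr_ge0// ltW.
  have : (local_fourth_moment m Theta rho z (theta_hat n z) <= K2%:E)%E := W6.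
  rewrite -lee_fin; apply: le_trans; apply: (le_trans _ (ereal_sup_ubound _)); last first.
    exists (theta_hat n z); last by [].
    split; first exact: (theta_hat_max n z).1.
    rewrite subrr; apply: le_lt_trans rho0; apply: le_trans (enorm_le _) _.
    by rewrite normr0 mulr0.
  rewrite lee_fin ler_wpM2l ?invr_ge0//; apply: ler_sum => i _.
  by rewrite lerXn2r ?nnegrE ?sqrtr_ge0// norm_le_enorm.
- move=> k l; apply: (@le_trans _ _ K3); last first.
    by rewrite /K -[K1 + K2 + K3 + B]addrA (addrCA _ K3) lerDl !addr_ge0// ltW.
  apply: le_trans W7; rewrite -[leRHS](average_sample Z (fun z => env z ^+ 2)).
  rewrite ler_wpM2l ?invr_ge0//; apply: ler_sum => i _.
  have := hess_envelopeP r0 ball_Theta hess_lip (tnth z i) k l br.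
  rewrite -tE => H; rewrite -real_normK ?num_real// lerXn2r ?nnegrE//.
  exact: le_trans H.
- apply: (@le_trans _ _ B); last by rewrite /K lerDr !addr_ge0.
  by rewrite (average_sample Z (fun z => `|psi z|)).
Unshelve. all: by end_near. Qed.
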